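(* Let $T$ be any tree obtained by the following inductive procedure, starting with $j_0:=0$. (1) Take a graph $G_0$ with exactly one edge (and its two end vertices), choose an integer $k_{G_0}\ge 0$ and add $2k_{G_0}$ vertices in the interior of the edge (subdividing it). The result is still called $G_0$. (2) Given $G_{j_0}$: for each vertex $v$ of degree $2$ of $G_{j_0}$, take a graph $G_{j_0,v}$ with exactly one edge and two vertices, identify one of its two vertices, $v_0$, with $v$, choose an integer $k_{G_{j_0,v}}\ge 0$ and add $2k_{G_{j_0,v}}$ vertices in the interior of the edge of $G_{j_0,v}$. Doing this for all vertices $v$ of degree $2$ of $G_{j_0}$ yields a graph $G_{j_0+1}$. Replace $G_{j_0}$ by $G_{j_0+1}$ and repeat as long as the graph has vertices of degree $2$; the choices are such that after finitely many steps a graph, denoted again $G_{j_0}$, with no vertex of degree $2$ is reached. (3) For each edge $e$ of this final $G_{j_0}$, let $j_{0,e}\in\{0,1,2\}$ be the number of vertices of degree $3$ of $G_{j_0}$ incident to $e$; choose an integer $j_e$ with $2j_e\ge 2j_{0,e}$ and add $2j_e$ vertices in the interior of $e$. The resulting tree is $T$. Then $T$ is (isomorphic to) the Poincaré-Reeb graph of some SS-region obtained from the SS-region given by the unit disk, $(D^2,\{S^1\})$, by finitely many operations each of which is an MBCC addition or an SSCC addition.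
   Context: Write $\pi_{2,1}(x_1,x_2)=x_1$, $\pi_{2,1}'(x_1,x_2)=x_2$ on $\mathbb{R}^2$; $\overline{D}$ is the closure in $\mathbb{R}^2$. $D^2$ is the unit disk (as an SS-region, its interior is meant) and $S^1$ the unit circle, both centered at the origin. A circle is a set $\{x\in\mathbb{R}^2 : \|x-x_0\|=r\}$ with $r>0$. Graphs: a graph is a $1$-dimensional finite connected polyhedron (cell complex with $0$-cells = vertices, $1$-cells = edges); the degree of a vertex is the number of edges incident to it; a tree is a graph with first Betti number $0$. SS-region: a pair $(D,\{S_j\}_{j=1}^l)$, $l>0$, where $D\subset\mathbb{R}^2$ is a connected open set, the $S_j$ are circles, $\overline{D}-D\subset\bigcup_j S_j$, $\overline{D}\cap S_j\neq\emptyset$ for each $j$; for distinct $S_{j_1},S_{j_2}$ and each $p\in S_{j_1}\cap S_{j_2}\cap(\overline{D}-D)$ one has $T_pS_{j_1}\oplus T_pS_{j_2}=T_p\mathbb{R}^2$; and no three distinct circles of the family have a common point in $\overline{D}-D$. Singular point of an SS-region: a point $p\in\overline{D}-D$ that either lies in exactly two of the circles, or lies in exactly one of the circles and is a critical point of the restriction of $\pi_{2,1}$ to a sufficiently small open neighborhood of $p$ in $\overline{D}-D$ (diffeomorphic to $\mathbb{R}$). Poincaré-Reeb graph of an SS-region: the quotient space of $\overline{D}$ whose points are the connected components of the sets $\pi_{2,1}^{-1}(t)\cap\overline{D}$, $t\in\mathbb{R}$; a point is a vertex if and only if the corresponding component contains a singular point. The vertical Poincaré-Reeb graph is defined in the same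 way using $\pi_{2,1}'$ in place of $\pi_{2,1}$ (also in the definition of singular points). MBCC addition to $(D,\{S_j\}_{j=1}^l)$: choose a point $p\in\overline{D}-D$ lying in exactly one circle of the family and mapped neither to a vertex of the Poincaré-Reeb graph nor to a vertex of the vertical Poincaré-Reeb graph. Let $S_{l+1}$ be a circle centered at $p$ of sufficiently small radius, bounding the closed disk $D_{l+1}$. The new SS-region is $(D',\{S_j\}_{j=1}^{l+1})$ with $D'=D\cap(\mathbb{R}^2-D_{l+1})$. SSCC addition to $(D,\{S_j\}_{j=1}^l)$: choose two distinct points $p_1,p_2\in\overline{D}-D$, both lying in exactly one circle $S_j$ of the family, and in a connected arc of $S_j\cap\overline{D}$, such that $p_1,p_2$ are both mapped into the interior of one and the same edge of the Poincaré-Reeb graph and into the interior of one and the same edge of the vertical Poincaré-Reeb graph. Let $C_{p_1,p_2}$ be the chord (straight segment) joining $p_1,p_2$. Let $S_{l+1}$ be a circle through $p_1$ and $p_2$, different from every $S_1,\dots,S_l$, bounding the closed disk $D_{l+1}$. Let $D_{j,l+1}$ be the region surrounded by $S_j$ and $S_{l+1}$, i.e. the bounded region enclosed by the arc of $S_j\cap\overline{D}$ from $p_1$ to $p_2$ and the arc of $S_{l+1}$ from $p_1$ to $p_2$ lying inside $S_j$ (Case A) or outside $S_j$ (Case B). - Case A-1: $C_{p_1,p_2}\subset\overline{D}$ and $C_{p_1,p_2}\subset\overline{D_{j,l+1}}$. If $p_1,p_2$ are sufficiently close and the Lebesgue measure of $\overline{D_{j,l+1}}$ is sufficiently small, put $D'=D\cap(\mathbb{R}^2-D_{l+1})$.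 - Case A-2: $C_{p_1,p_2}\subset\overline{D}$ and $C_{p_1,p_2}$ is outside $D_{j,l+1}$. If the Lebesgue measure of $\overline{D_{j,l+1}}$ is sufficiently small, put $D'=D\cap D_{l+1}$ (as an open set, i.e. up to the boundary circle). - Case B: $C_{p_1,p_2}$ is outside $\overline{D}$. If the Lebesgue measure of $\overline{D_{j,l+1}}$ is sufficiently small, put $D'=D\cap(\mathbb{R}^2-D_{l+1})$. In each case the new SS-region is $(D',\{S_j\}_{j=1}^{l+1})$. *)

(* Defs.v *)
From HB Require Import structures.
From mathcomp Require Import all_boot all_order all_algebra generic_quotient.
From mathcomp Require Import all_classical all_reals all_analysis.

Set Implicit Arguments.
Unset Strict Implicit.
Unset Printing Implicit Defensive.

Import Order.TTheory GRing.Theory Num.Theory.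
Import numFieldNormedType.Exports.

Local Open Scope classical_set_scope.
Local Open Scope ring_scope.
Local Open Scope quotient_scope.

(* Finite cell complexes of dimension at most 1; the orientation of an edge
   only serves to order the vertices added in its interior. *)
Record graph := Graph {
  vertex : finType;
  edge : finType;
  src : edge -> vertex;
  tgt : edge -> vertex }.

Section Trees.
Local Open Scope nat_scope.

Definition incident (G : graph) (e : edge G) (v : vertex G) : bool :=
  (src e == v) || (tgt e == v).

Definition degree (G : graph) (v : vertex G) : nat :=
  #|[set e : edge G | incident e v]%SET|.

Definition one_edge_graph : graph :=
  @Graph bool unit (fun=> false) (fun=> true).

(* Adds [m e] vertices in the interior of each edge [e], which is thus replaced
   by the [(m e).+1] edges [(e, 0), ..., (e, m e)]; the [i]-th of them joins the
   new vertices [(e, i - 1)] and [(e, i)], except that [(e, 0)] starts at the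
   source of [e] and [(e, m e)] ends at its target. *)
Definition subdivide (G : graph) (m : edge G -> nat) : graph :=
  let V := (vertex G + {e : edge G & 'I_(m e)})%type in
  let E := {e : edge G & 'I_(m e).+1} in
  @Graph V E
    (fun x => if unlift ord0 (tagged x) is Some k
              then inr (Tagged (fun e => 'I_(m e)) k)
              else inl (src (tag x)))
    (fun x => if unlift ord_max (tagged x) is Some k
              then inr (Tagged (fun e => 'I_(m e)) k)
              else inl (tgt (tag x))).

Definition degree2_vertex (G : graph) : finType :=
  {v : vertex G | degree v == 2}.

(* Identifies with each vertex of degree 2 one end of a new edge. *)
Definition sprout (G : graph) : graph :=
  @Graph (vertex G + degree2_vertex G)%type (edge G + degree2_vertex G)%type
    (fun x => match x with inl e => inl (src e) | inr v => inl (val v) end)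
    (fun x => match x with inl e => inl (tgt e) | inr v => inr v end).

Definition grow (G : graph) (k : degree2_vertex G -> nat) : graph :=
  @subdivide (sprout G)
    (fun x => match x with inl _ => 0 | inr v => 2 * k v end).

Inductive stage : graph -> Prop :=
| stage_start (k : nat) : stage (@subdivide one_edge_graph (fun=> 2 * k))
| stage_grow (G : graph) (k : degree2_vertex G -> nat) :
    stage G -> (exists v : vertex G, degree v = 2) -> stage (grow k).

Definition degree3_ends (G : graph) (e : edge G) : nat :=
  #|[set v : vertex G | incident e v & degree v == 3]%SET|.

Inductive procedure_tree : graph -> Prop :=
| Procedure_tree (G : graph) (j : edge G -> nat) :
    stage G -> (forall v : vertex G, degree v <> 2) ->
    (forall e, 2 * degree3_ends e <= 2 * j e) ->
    procedure_tree (subdivide (fun e => 2 * j e)).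

End Trees.

(* The vertices are the vectors of the standard basis and the edges are straight
   segments. This realizes the graphs without loops and without multiple edges,
   in particular all trees. *)
Definition vertex_pt (R : realType) (G : graph) (v : vertex G)
  : 'rV[R]_#|vertex G| := delta_mx 0 (enum_rank v).

Definition realization (R : realType) (G : graph) : set 'rV[R]_#|vertex G| :=
  [set x | (exists v : vertex G, x = vertex_pt R v) \/
     exists (e : edge G) (t : R), 0 <= t <= 1 /\
       x = (1 - t) *: vertex_pt R (src e) + t *: vertex_pt R (tgt e)].

Arguments realization : clear implicits.

Section Plane.
Variable R : realType.

(* The norm that the library puts on [R * R] is the sup norm. *)
Definition dot (u v : R * R) : R := u.1 * v.1 + u.2 * v.2.
Definition enorm (u : R * R) : R := Num.sqrt (dot u u).

(* A circle is encoded by its center and its radius, which it determines. *)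
Definition circle := {c : (R * R) * R | 0 < c.2}.
Definition center (S : circle) : R * R := (val S).1.
Definition radius (S : circle) : R := (val S).2.

Definition circle_set (S : circle) : set (R * R) :=
  [set x | enorm (x - center S) = radius S].
Definition open_disk (S : circle) : set (R * R) :=
  [set x | enorm (x - center S) < radius S].
Definition closed_disk (S : circle) : set (R * R) :=
  [set x | enorm (x - center S) <= radius S].

Definition tangent (S : circle) (p : R * R) : set (R * R) :=
  [set v | dot (p - center S) v = 0].

Definition direct_sum_plane (A B : set (R * R)) : Prop :=
  (forall w, exists u v, [/\ A u, B v & w = u + v]) /\
  (forall v, A v -> B v -> v = 0).

Record ss_pair := SSPair { dom : set (R * R); circles : seq circle }.

Definition bd (X : ss_pair) : set (R * R) := closure (dom X) `\` dom X.

Definition is_ss_region (X : ss_pair) : Prop :=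
  [/\ circles X <> [::],
      open (dom X) /\ connected (dom X),
      (forall p, bd X p -> exists2 S, S \in circles X & circle_set S p),
      (forall S, S \in circles X -> (closure (dom X) `&` circle_set S) !=set0) &
      (forall S1 S2, S1 \in circles X -> S2 \in circles X -> S1 != S2 ->
         forall p, bd X p -> circle_set S1 p -> circle_set S2 p ->
         direct_sum_plane (tangent S1 p) (tangent S2 p)) /\
      (forall S1 S2 S3,
         S1 \in circles X -> S2 \in circles X -> S3 \in circles X ->
         S1 != S2 -> S1 != S3 -> S2 != S3 ->
         forall p, bd X p ->
         ~ [/\ circle_set S1 p, circle_set S2 p & circle_set S3 p])].

Definition in_exactly_one (X : ss_pair) (S : circle) (p : R * R) : Prop :=
  forall S', (S' \in circles X /\ circle_set S' p) <-> S' = S.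

Definition in_exactly_two (X : ss_pair) (p : R * R) : Prop :=
  exists S1 S2, S1 <> S2 /\
    forall S', (S' \in circles X /\ circle_set S' p) <-> S' = S1 \/ S' = S2.

(* [proj] is one of the two coordinate projections; being linear, it is its own
   differential, so [p] is critical on a curve iff [proj] vanishes on the
   tangent line. The second disjunct first says that, near [p], the boundary is
   an arc of [S]. *)
Definition singular (proj : R * R -> R) (X : ss_pair) (p : R * R) : Prop :=
  bd X p /\
  (in_exactly_two X p \/
   exists S, [/\ in_exactly_one X S p,
     (\forall q \near p, bd X q <-> circle_set S q) &
     forall v, tangent S p v -> proj v = 0]).

Definition fiber (proj : R * R -> R) (X : ss_pair) (t : R) : set (R * R) :=
  closure (dom X) `&` proj @^-1` [set t].

Definition same_component (proj : R * R -> R) (X : ss_pair)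
  : rel (closure (dom X)) :=
  fun x y =>
    `[< connected_component (fiber proj X (proj (val x))) (val x) (val y) >].

Lemma same_component_equiv (proj : R * R -> R) (X : ss_pair) :
  equiv_class_of (@same_component proj X).
Proof.
have eqf x y : same_component proj (X := X) x y -> proj (val y) = proj (val x).
  by move=> /asboolP /connected_component_sub[].
split.
- move=> x; apply/asboolP; apply: connected_component_refl.
  by split => //; exact: set_mem (valP x).
- suff sym x y : same_component proj x y -> same_component proj (X := X) y x.
    by move=> x y; apply/idP/idP; exact: sym.
  move=> xy; apply/asboolP; rewrite (eqf _ _ xy).
  by apply: connected_component_sym; exact/asboolP.
- move=> y x z xy yz; apply/asboolP.
  apply: (@connected_component_trans _ _ (val y)); first exact/asboolP.
  by rewrite -(eqf _ _ xy); exact/asboolP.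
Qed.

Canonical same_component_equiv_rel (proj : R * R -> R) (X : ss_pair) :=
  EquivRelPack (same_component_equiv proj X).

(* The quotient of the closure of the domain, with the quotient topology, whose
   points are the connected components of the fibers of [proj]. *)
Definition reeb (proj : R * R -> R) (X : ss_pair) : topologicalType :=
  quotient_topology {eq_quot same_component_equiv_rel proj X}.

Definition reeb_pi (proj : R * R -> R) (X : ss_pair) (x : closure (dom X))
  : reeb proj X :=
  (\pi_({eq_quot same_component_equiv_rel proj X}) x)%qT.

Definition reeb_vertex (proj : R * R -> R) (X : ss_pair) : set (reeb proj X) :=
  [set q | exists x : closure (dom X),
             singular proj X (val x) /\ reeb_pi proj x = q].

Arguments reeb_vertex : clear implicits.

(* The interiors of the edges are the connected components of the complement of
   the set of vertices. *)
Definition same_edge (proj : R * R -> R) (X : ss_pair) (x y : closure (dom X))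
  : Prop :=
  connected_component (~` reeb_vertex proj X) (reeb_pi proj x) (reeb_pi proj y).

Definition reeb_isomorphic (proj : R * R -> R) (X : ss_pair) (G : graph)
  : Prop :=
  exists (f : reeb proj X -> realization R G)
         (g : realization R G -> reeb proj X),
    [/\ continuous f, continuous g, cancel f g, cancel g f &
        forall q, reeb_vertex proj X q <-> exists v, val (f q) = vertex_pt R v].

Definition remove_disk (X : ss_pair) (S : circle) : ss_pair :=
  SSPair (dom X `\` closed_disk S) (rcons (circles X) S).

Definition keep_disk (X : ss_pair) (S : circle) : ss_pair :=
  SSPair (dom X `&` open_disk S) (rcons (circles X) S).

(* The closed arc of [S] with ends [p] and [q] on the left of the oriented line
   from [p] to [q]; the other arc is [circle_arc S q p]. *)
Definition circle_arc (S : circle) (p q : R * R) : set (R * R) :=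
  [set x | circle_set S x /\
     0 <= (q.1 - p.1) * (x.2 - p.2) - (q.2 - p.2) * (x.1 - p.1)].

Definition chord (p q : R * R) : set (R * R) :=
  [set x | exists2 t : R, 0 <= t <= 1 & x = (1 - t) *: p + t *: q].

(* The bounded region enclosed by a closed curve [K]. *)
Definition enclosed (K : set (R * R)) : set (R * R) :=
  [set x | ~ K x /\ bounded_set (connected_component (~` K) x)].

Definition area (A : set (R * R)) : \bar R :=
  ((@lebesgue_measure R) \x (@lebesgue_measure R))%E A.

(* What "sufficiently small" means in the additions: for each choice made before
   the small quantity, an arbitrary bound on that quantity. In the first kind of
   SSCC addition the region contains the chord, so that its area can only be
   small if the two points are close: there, the bounds are set once the first
   point is chosen. *)
Record smallness := Smallness {
  mbcc_radius : ss_pair -> R * R -> {posnum R};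
  sscc_dist : ss_pair -> R * R -> {posnum R};
  sscc_area_near : ss_pair -> R * R -> {posnum R};
  sscc_area : ss_pair -> R * R -> R * R -> {posnum R} }.

Definition mbcc_addition (eps : smallness) (X X' : ss_pair) : Prop :=
  exists (p : closure (dom X)) (S S' : circle),
    [/\ bd X (val p) /\ in_exactly_one X S (val p),
        ~ reeb_vertex fst X (reeb_pi fst p) /\
        ~ reeb_vertex snd X (reeb_pi snd p),
        center S' = val p /\ radius S' < (mbcc_radius eps X (val p))%:num,
        X' = remove_disk X S' &
        is_ss_region X'].

(* The pair [(p1, p2)] is ordered so that the given arc of [S] between the two
   points is [circle_arc S p1 p2]. *)
Definition sscc_addition (eps : smallness) (X X' : ss_pair) : Prop :=
  exists (p1 p2 : closure (dom X)) (S S' : circle),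
    let a := val p1 in
    let b := val p2 in
    let C := chord a b in
    let W_in := enclosed (circle_arc S a b `|` (circle_set S' `&` closed_disk S)) in
    let W_out := enclosed (circle_arc S a b `|` (circle_set S' `\` open_disk S)) in
    [/\ [/\ a <> b, bd X a /\ bd X b,
            in_exactly_one X S a /\ in_exactly_one X S b &
            circle_arc S a b `<=` closure (dom X)],
        same_edge fst p1 p2 /\ same_edge snd p1 p2,
        [/\ circle_set S' a, circle_set S' b & S' \notin circles X],
        [\/ [/\ C `<=` closure (dom X), C `<=` closure W_in,
                enorm (b - a) < (sscc_dist eps X a)%:num,
                (area (closure W_in) < (sscc_area_near eps X a)%:num%:E)%E &
                X' = remove_disk X S'],
            [/\ C `<=` closure (dom X), C `&` W_in = set0,
                (area (closure W_in) < (sscc_area eps X a b)%:num%:E)%E &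
                X' = keep_disk X S'] |
            [/\ C `&` closure (dom X) = [set a; b],
                (area (closure W_out) < (sscc_area eps X a b)%:num%:E)%E &
                X' = remove_disk X S']] &
        is_ss_region X'].

Inductive obtained (eps : smallness) (X : ss_pair) : ss_pair -> Prop :=
| obtained_refl : obtained eps X X
| obtained_step (Y Z : ss_pair) : obtained eps X Y ->
    mbcc_addition eps Y Z \/ sscc_addition eps Y Z -> obtained eps X Z.

Definition unit_circle : circle := exist _ (((0, 0), 1) : (R * R) * R) ltr01.

Definition unit_disk : ss_pair := SSPair (open_disk unit_circle) [:: unit_circle].

End Plane.

(* Main.v *)
Require Import Defs.
From mathcomp Require Import all_boot all_order all_algebra.
From mathcomp Require Import all_classical all_reals all_analysis.
From mathcomp Require Import generic_quotient zify ring lra.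
Require Import Defs.

(** The regions to be constructed are the unit disk minus finitely many closed
    disks, and the tree is read on their vertical slices: a [layout] labels the
    connected components of the slices with vertices and edges, and
    [layout_reeb_isomorphic] shows that a layout whose vertices are the slices
    through the singular points identifies the Poincaré-Reeb graph.

    Let [a] and [b] be two close points on a boundary arc under which the region
    lies. The circles through [a] and [b] form a pencil, in which the power of a
    point is an affine function of the parameter, so that all comparisons between
    such circles reduce to the sign of one affine form, [line a b]. Removing the
    disk of such a circle changes the slices in one of two ways.
    - If the center is well above the chord, the slices between [a] and [b] only
      lose their top. The graph does not change as a space, but [a] and [b] are
      singular points, hence two new vertices on the edge ([flat_cut]). The arc
      may be on the unit circle, where the disk covers the chord, or on a disk
      removed earlier, where the chord is outside the region and the new circle
      has to be close to the old one.
    - If the center is well below the chord, the leftmost and rightmost points of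
      the new circle are inside the region. At each of them the slices branch,
      and a horn remains between the disk and the old arc, with its tip at [a] or
      [b]: the edge gets two vertices of degree 3 with a leaf at each of them
      ([branch_cut]). The chord has to be in the region, so the arc is taken on
      the unit circle.

    On the side of the graphs, a vertex of degree 2 gets a leaf at the next step of
    the procedure, so the two can be added together: up to isomorphism, the tree
    is obtained from one edge by adding pairs of vertices of degree 3 with their
    leaves and, at the end, pairs of vertices of degree 2. The edges to which the
    former is done should still touch the upper half of the unit circle, and they
    do if new vertices are always inserted next to the target of an edge, since
    the horns and the two outer parts of the edge touch it ([procedure_drawn]).

    It remains to make the additions small. The point [a] is chosen generic, so
    that near [a] the boundary is a graph with a bounded slope and no fiber
    contains a singular point; then [b] tends to [a] along the arc
    ([slot_exists]). The enclosed regions are located by escaping to infinity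
    along rays from the other points, and their areas are bounded by those of a
    square ([near_addition]) or of a thin crescent ([far_addition]). *)

Set Implicit Arguments.
Unset Strict Implicit.
Unset Printing Implicit Defensive.

(** * Isomorphisms and elementary operations on graphs *)

Record giso (G H : graph) := Giso {
  isoV : vertex G -> vertex H;
  invV : vertex H -> vertex G;
  isoE : edge G -> edge H;
  invE : edge H -> edge G;
  isoVK : cancel isoV invV;
  invVK : cancel invV isoV;
  isoEK : cancel isoE invE;
  invEK : cancel invE isoE;
  iso_src : forall e, src (isoE e) = isoV (src e);
  iso_tgt : forall e, tgt (isoE e) = isoV (tgt e) }.

Definition giso_sym G H (f : giso G H) : giso H G.
Proof.
apply: (@Giso H G (invV f) (isoV f) (invE f) (isoE f)).
- exact: invVK.
- exact: isoVK.
- exact: invEK.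
- exact: isoEK.
- by move=> e; rewrite -{2}(invEK f e) iso_src isoVK.
- by move=> e; rewrite -{2}(invEK f e) iso_tgt isoVK.
Defined.

Definition giso_trans G H K (f : giso G H) (g : giso H K) : giso G K.
Proof.
apply: (@Giso G K (isoV g \o isoV f) (invV f \o invV g)
                  (isoE g \o isoE f) (invE f \o invE g)).
- exact: can_comp (isoVK g) (isoVK f).
- exact: can_comp (invVK f) (invVK g).
- exact: can_comp (isoEK g) (isoEK f).
- exact: can_comp (invEK f) (invEK g).
- by move=> e /=; rewrite !iso_src.
- by move=> e /=; rewrite !iso_tgt.
Defined.

(** The edge [Some e] is the half of [e] that contains its source. *)
Definition split_edge (G : graph) (e : edge G) : graph :=
  @Graph (option (vertex G)) (option (edge G))
    (fun x => if x is Some f then Some (src f) else None)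
    (fun x => if x is Some f then if f == e then None else Some (tgt f)
              else Some (tgt e)).

Definition add_leaf (G : graph) (v : vertex G) : graph :=
  @Graph (option (vertex G)) (option (edge G))
    (fun x => if x is Some f then Some (src f) else Some v)
    (fun x => omap (@tgt G) x).

Lemma omapK (A B : Type) (f : A -> B) (g : B -> A) :
  cancel f g -> cancel (omap f) (omap g).
Proof. by move=> fg [x|] //=; rewrite fg. Qed.

Definition split_edge_iso G H (f : giso G H) (e : edge G) :
  giso (split_edge e) (split_edge (isoE f e)).
Proof.
apply: (@Giso (split_edge e) (split_edge (isoE f e)) (omap (isoV f))
  (omap (invV f)) (omap (isoE f)) (omap (invE f))).
- exact/omapK/isoVK.
- exact/omapK/invVK.
- exact/omapK/isoEK.
- exact/omapK/invEK.
- by case=> [x|] //=; rewrite iso_src.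
- case=> [x|] /=; last by rewrite iso_tgt.
  by rewrite (inj_eq (can_inj (isoEK f))); case: eqP => //= _; rewrite iso_tgt.
Defined.

Definition add_leaf_iso G H (f : giso G H) (v : vertex G) :
  giso (add_leaf v) (add_leaf (isoV f v)).
Proof.
apply: (@Giso (add_leaf v) (add_leaf (isoV f v)) (omap (isoV f))
  (omap (invV f)) (omap (isoE f)) (omap (invE f))).
- exact/omapK/isoVK.
- exact/omapK/invVK.
- exact/omapK/isoEK.
- exact/omapK/invEK.
- by case=> [x|] //=; rewrite iso_src.
- by case=> [x|] //=; rewrite iso_tgt.
Defined.

Definition swap_option (A : Type) (x : option (option A)) :=
  match x with
  | None => Some None
  | Some None => None
  | Some (Some a) => Some (Some a)
  end.

Lemma swap_optionK A : cancel (@swap_option A) (@swap_option A).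
Proof. by case=> [[]|]. Qed.

Definition leaf_split_swap G (e : edge G) (v : vertex G) :
  giso (@add_leaf (split_edge e) (Some v))
       (@split_edge (add_leaf v) (Some e)).
Proof.
apply: (@Giso (@add_leaf (split_edge e) (Some v))
       (@split_edge (add_leaf v) (Some e))
  (@swap_option _) (@swap_option _) (@swap_option _) (@swap_option _));
  try exact: swap_optionK.
- by case=> [[x|]|].
- by case=> [[x|]|] //=; rewrite (inj_eq (@Some_inj _)); case: eqP.
Defined.

Definition split_twice (G : graph) (e : edge G) : graph :=
  @split_edge (split_edge e) None.

(** What is done to the Poincaré-Reeb graph by an addition at an arc of the edge
    [e] when the new disk has its leftmost and rightmost points inside the
    region: the fibers branch at these two points. *)
Definition branch_twice (G : graph) (e : edge G) : graph :=
  @add_leaf (@add_leaf (split_twice e) (Some None)) (Some None).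

(** The edges to which [branch_twice] may be applied next. The middle third of
    [e] is excluded: the arc over it is covered by the new disk. *)
Definition branch_active (G : graph) (e : edge G) (act : edge G -> bool)
    (x : edge (branch_twice e)) : bool :=
  match x with
  | Some (Some (Some (Some f))) => act f
  | Some (Some (Some None)) => false
  | _ => true
  end.

(** The leaf and the second subdivision concern different places and commute, so
    that both vertices can be added with their leaves one after the other. *)
Definition branch_twice_iso G (e : edge G) :
  giso (branch_twice e)
    (@add_leaf (@split_edge (@add_leaf (split_edge e) None) (Some None)) None) :=
  add_leaf_iso (@leaf_split_swap (split_edge e) None None) (Some None).

(** * Subdivisions *)

Section Increment.
Variables (E : finType) (e0 : E).
Local Notation positions m := {e : E & 'I_(m e)}.

(** The positions of [incr m] are those of [m] and a last one on [e0], which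
    [position_restr] and [position_ext] identify with [None]. *)
Definition incr (m : E -> nat) (e : E) : nat := m e + (e == e0).

Lemma eq_position (m : E -> nat) (x y : positions m) :
  tag x = tag y -> tagged x = tagged y :> nat -> x = y.
Proof.
case: x y => [e i] [e' i'] /= ee'; case: e' / ee' i' => i' ii'.
by congr existT; apply: val_inj.
Qed.

Definition position (m : E -> nat) (e : E) (n : nat) : option (positions m) :=
  omap (fun i : 'I_(m e) => Tagged (fun e => 'I_(m e)) i) (insub n).

Lemma position_lt m e n (lt_n : n < m e) :
  position m e n = Some (Tagged (fun e => 'I_(m e)) (Ordinal lt_n)).
Proof. by rewrite /position insubT. Qed.

Lemma position_ge m e n : m e <= n -> position m e n = None.
Proof. by move=> le_n; rewrite /position insubF // ltnNge le_n. Qed.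

Definition position_restr (m : E -> nat) (x : positions (incr m)) :
  option (positions m) := position m (tag x) (tagged x).

Lemma incr_last_subproof (m : E -> nat) : m e0 < incr m e0.
Proof. by rewrite /incr eqxx addn1. Qed.

Lemma incr_widen_subproof (m : E -> nat) e : m e <= incr m e.
Proof. exact: leq_addr. Qed.

Definition position_ext (m : E -> nat) (x : option (positions m)) :
    positions (incr m) :=
  match x with
  | None => Tagged (fun e => 'I_(incr m e)) (Ordinal (incr_last_subproof m))
  | Some y => Tagged (fun e => 'I_(incr m e))
                (widen_ord (incr_widen_subproof m (tag y)) (tagged y))
  end.

Lemma incr_max (m : E -> nat) (x : positions (incr m)) :
  m (tag x) <= tagged x -> tag x = e0 /\ tagged x = m e0 :> nat.
Proof.
case: x => e [i i_lt] /= le_i; move: i_lt le_i; rewrite /incr.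
case: eqP => [-> | _]; rewrite ?addn1 ?addn0 ?ltnS => lt_i le_i; last first.
  by rewrite ltnNge le_i in lt_i.
by split=> //; apply/eqP; rewrite eqn_leq lt_i.
Qed.

Lemma position_restrK m : cancel (@position_restr m) (@position_ext m).
Proof.
move=> x; rewrite /position_restr; case: (ltnP (tagged x) (m (tag x))) => Hx.
  by rewrite position_lt; apply: eq_position.
rewrite position_ge //; have [tx vx] := incr_max Hx.
by apply: eq_position => /=; rewrite ?tx ?vx.
Qed.

Lemma position_extK m : cancel (@position_ext m) (@position_restr m).
Proof.
case=> [[e i]|] /=; last by rewrite /position_restr position_ge.
rewrite /position_restr /= position_lt //=.
by congr Some; apply: eq_position.
Qed.

End Increment.

Lemma subdivide_src0 (G : graph) (m : edge G -> nat) e :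
  @src (subdivide m) (Tagged (fun e => 'I_(m e).+1) (ord0 : 'I_(m e).+1)) = inl (src e).
Proof. by rewrite /= unlift_none. Qed.

Lemma subdivide_srcS (G : graph) (m : edge G -> nat) e (k : 'I_(m e)) :
  @src (subdivide m) (Tagged (fun e => 'I_(m e).+1) (lift ord0 k)) =
  inr (Tagged (fun e => 'I_(m e)) k).
Proof. by rewrite /= liftK. Qed.

Lemma subdivide_tgt_max (G : graph) (m : edge G -> nat) e :
  @tgt (subdivide m) (Tagged (fun e => 'I_(m e).+1) (ord_max : 'I_(m e).+1)) = inl (tgt e).
Proof. by rewrite /= unlift_none. Qed.

Lemma subdivide_tgt_lift (G : graph) (m : edge G -> nat) e (k : 'I_(m e)) :
  @tgt (subdivide m) (Tagged (fun e => 'I_(m e).+1) (lift ord_max k)) =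
  inr (Tagged (fun e => 'I_(m e)) k).
Proof. by rewrite /= liftK. Qed.

Definition last_segment (G : graph) (m : edge G -> nat) (e : edge G) :
  edge (subdivide m) := Tagged (fun e => 'I_(m e).+1) (ord_max : 'I_(m e).+1).

Section SubdivideIncr.
Variables (G : graph) (m : edge G -> nat) (e0 : edge G).
Local Notation m' := (incr e0 m).

Definition subdiv_isoV (x : vertex (subdivide m')) :
    vertex (split_edge (last_segment m e0)) :=
  match x with
  | inl v => Some (inl v)
  | inr j => omap inr (position_restr j)
  end.

Definition subdiv_invV (x : vertex (split_edge (last_segment m e0))) :
    vertex (subdivide m') :=
  match x with
  | Some (inl v) => inl v
  | Some (inr j) => inr (position_ext e0 (Some j))
  | None => inr (position_ext e0 (None : option {e : edge G & 'I_(m e)}))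
  end.

Definition subdiv_isoE (x : edge (subdivide m')) :
    edge (split_edge (last_segment m e0)) :=
  @position_restr _ e0 (fun e => (m e).+1) x.

Lemma subdiv_isoVK : cancel subdiv_isoV subdiv_invV.
Proof.
case=> [v|j] //=; rewrite -[in RHS](position_restrK j).
by case: (position_restr j).
Qed.

Lemma subdiv_invVK : cancel subdiv_invV subdiv_isoV.
Proof.
case=> [[v|j]|] //.
  by rewrite /subdiv_isoV /subdiv_invV position_extK.
by rewrite /subdiv_isoV /subdiv_invV position_extK.
Qed.

Lemma subdiv_iso_src e :
  @src (split_edge (last_segment m e0)) (subdiv_isoE e) =
  subdiv_isoV (@src (subdivide m') e).
Proof.
case: e => e i; rewrite /subdiv_isoE /position_restr.
case: (unliftP ord0 i) => [k ik|i0].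
  rewrite [in RHS]ik subdivide_srcS /subdiv_isoV /position_restr /=.
  case: (ltnP k (m e)) => Hk.
    have Hi : i < (m e).+1 by rewrite ik /= /bump /= add1n.
    rewrite (position_lt Hi) (position_lt Hk) /=.
    have -> : Ordinal Hi = lift ord0 (Ordinal Hk) by apply: val_inj; rewrite /= ik.
    by rewrite liftK.
  by rewrite !position_ge //= ik /= /bump /= add1n.
rewrite [in RHS]i0 subdivide_src0 /=.
have Hi : i < (m e).+1 by rewrite i0.
rewrite (position_lt Hi) /=.
suff -> : Ordinal Hi = ord0 by rewrite unlift_none.
by apply: val_inj; rewrite /= i0.
Qed.

Lemma subdiv_iso_tgt e :
  @tgt (split_edge (last_segment m e0)) (subdiv_isoE e) =
  subdiv_isoV (@tgt (subdivide m') e).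
Proof.
case: e => e i; rewrite /subdiv_isoE /position_restr.
have iseg (Hi : i < (m e).+1) : (Tagged (fun e => 'I_(m e).+1) (Ordinal Hi)
      == last_segment m e0) = (e == e0) && (i == m e :> nat).
  apply/eqP/andP => [eq_x|[/eqP ee /eqP ii]].
    have := congr1 tag eq_x; rewrite /= => ee; subst e; rewrite eqxx; split=> //.
    move/eqP: eq_x; rewrite eq_Tagged => /eqP/(congr1 val) /= ->.
    by rewrite eqxx.
  by subst e; apply: eq_position.
case: (unliftP ord_max i) => [k ik|i0].
  rewrite [in RHS]ik subdivide_tgt_lift /subdiv_isoV /position_restr /=.
  have vik : i = k :> nat.
    by rewrite ik /= /bump leqNgt ltn_ord.
  case: (ltnP k (m e)) => Hk.
    have Hi : i < (m e).+1 by rewrite vik ltnW.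
    have nmax : (i == m e :> nat) = false by rewrite vik (ltn_eqF Hk).
    rewrite (position_lt Hi) (position_lt Hk) /= iseg nmax andbF.
    have -> : Ordinal Hi = lift ord_max (Ordinal Hk).
      by apply: val_inj; rewrite /= vik /= /bump leqNgt Hk.
    by rewrite liftK.
  have [/= ee kk] := @incr_max _ _ _ (Tagged (fun e => 'I_(m' e)) k) Hk; subst e.
  have Hi : i < (m e0).+1 by rewrite vik kk.
  have imax : (i == m e0 :> nat) by rewrite vik kk.
  by rewrite (position_lt Hi) /= iseg imax !eqxx position_ge.
rewrite [in RHS]i0 subdivide_tgt_max /=.
have vi : i = m e + (e == e0) :> nat by rewrite i0.
have [ee|ee] := eqVneq e e0.
  have vi1 : i = (m e).+1 :> nat by rewrite vi ee eqxx addn1.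
  have ge_i : (m e).+1 <= i by rewrite vi1.
  by rewrite (@position_ge _ (fun e => (m e).+1) _ _ ge_i) /= unlift_none ee.
have vi0 : i = m e :> nat by rewrite vi (negbTE ee) addn0.
have Hi : i < (m e).+1 by rewrite vi0.
rewrite (position_lt Hi) /= iseg (negbTE ee) /=; congr Some.
suff -> : Ordinal Hi = ord_max by rewrite unlift_none.
by apply: val_inj; rewrite /= vi0.
Qed.

(** The last of the vertices added to [e0] cuts the last segment in two. *)
Definition subdivide_incr_iso :
  giso (subdivide m') (split_edge (last_segment m e0)) :=
  Giso subdiv_isoVK subdiv_invVK
    (@position_restrK _ e0 (fun e => (m e).+1))
    (@position_extK _ e0 (fun e => (m e).+1))
    subdiv_iso_src subdiv_iso_tgt.

End SubdivideIncr.

(** When [G] has no vertices of degree 2, this is [sprout (subdivide m)], as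
    [sprout_subdivide_iso] shows; the description below avoids the subtype of the
    vertices of degree 2, and follows more easily an induction on [m]. *)
Definition sprouted (G : graph) (m : edge G -> nat) : graph :=
  let J := {e : edge G & 'I_(m e)} in
  @Graph (vertex (subdivide m) + J)%type (edge (subdivide m) + J)%type
    (fun x => match x with
              | inl e => inl (@src (subdivide m) e) | inr j => inl (inr j) end)
    (fun x => match x with
              | inl e => inl (@tgt (subdivide m) e) | inr j => inr j end).

Section SumOption.
Variables (A A' B B' : Type) (f : A -> option A') (f' : option A' -> A).
Variables (g : B -> option B') (g' : option B' -> B).
Hypotheses (fK : cancel f f') (f'K : cancel f' f).
Hypotheses (gK : cancel g g') (g'K : cancel g' g).

Definition sum_option (x : A + B) : option (option (A' + B')) :=
  match x with
  | inl a => Some (omap inl (f a))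
  | inr b => omap (Some \o inr) (g b)
  end.

Definition option_sum (x : option (option (A' + B'))) : A + B :=
  match x with
  | None => inr (g' None)
  | Some None => inl (f' None)
  | Some (Some (inl a)) => inl (f' (Some a))
  | Some (Some (inr b)) => inr (g' (Some b))
  end.

Lemma sum_optionK : cancel sum_option option_sum.
Proof.
by case=> [a|b] /=; [rewrite -[in RHS](fK a); case: (f a)
                    |rewrite -[in RHS](gK b); case: (g b)].
Qed.

Lemma option_sumK : cancel option_sum sum_option.
Proof. by case=> [[[a|b]|]|] /=; rewrite ?f'K ?g'K. Qed.

End SumOption.

Section SproutedIncr.
Variables (G : graph) (m : edge G -> nat) (e0 : edge G).
Local Notation m' := (incr e0 m).
Local Notation f := (subdivide_incr_iso m e0).

Definition sprouted_incr_iso : giso (sprouted m')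
  (@add_leaf (@split_edge (sprouted m) (inl (last_segment m e0))) None).
Proof.
apply: (@Giso (sprouted m')
  (@add_leaf (@split_edge (sprouted m) (inl (last_segment m e0))) None)
  (sum_option (isoV f) (@position_restr _ e0 m))
  (option_sum (invV f) (@position_ext _ e0 m))
  (sum_option (isoE f) (@position_restr _ e0 m))
  (option_sum (invE f) (@position_ext _ e0 m))).
- exact: sum_optionK (isoVK f) (@position_restrK _ _ _).
- exact: option_sumK (invVK f) (@position_extK _ _ _).
- exact: sum_optionK (isoEK f) (@position_restrK _ _ _).
- exact: option_sumK (invEK f) (@position_extK _ _ _).
- case=> [x|j]; last by rewrite /=; case: (position_restr j).
  move: (iso_src f x); case E: (isoE f x) => [y|] H;
    rewrite -[@src (sprouted m') (inl x)]/(inl (@src (subdivide m') x));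
    by rewrite /sum_option E -H.
- case=> [x|j]; last by rewrite /=; case: (position_restr j).
  move: (iso_tgt f x); case E: (isoE f x) => [y|] H;
    rewrite -[@tgt (sprouted m') (inl x)]/(inl (@tgt (subdivide m') x));
    rewrite /sum_option E -H //=.
  by rewrite (inj_eq (@inl_inj _ _)); case: eqP.
Defined.

End SproutedIncr.

Section SubdivideZero.
Variables (G : graph) (m : edge G -> nat).
Hypothesis m0 : forall e, m e = 0.

Definition no_position (T : Type) (j : {e : edge G & 'I_(m e)}) : T.
Proof. by exfalso; case: j => e [i]; rewrite m0. Defined.

Definition first_segment (e : edge G) : edge (subdivide m) :=
  Tagged (fun e => 'I_(m e).+1) (ord0 : 'I_(m e).+1).

Lemma tagK_first : cancel tag first_segment.
Proof.
move=> x; apply: eq_position => //=.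
by case: x => e [i] /=; move: (m0 e); case: (m e) => // _; case: i.
Qed.

Definition subdivide0_iso : giso G (subdivide m).
Proof.
apply: (@Giso G (subdivide m) inl
  (fun x => match x with inl v => v | inr j => no_position _ j end)
  first_segment tag) => //.
- by case=> // j; exact: no_position.

- exact: tagK_first.
- by move=> e; exact: subdivide_src0.
- move=> e; rewrite -[RHS]/(inl (tgt e)) -(subdivide_tgt_max m e).
  by congr tgt; apply: eq_position => //=; rewrite m0.
Defined.

Definition sprouted0_iso : giso G (sprouted m).
Proof.
apply: (@Giso G (sprouted m) (fun v => inl (isoV subdivide0_iso v))
  (fun x => match x with
            | inl v => invV subdivide0_iso v | inr j => no_position _ j end)
  (fun e => inl (isoE subdivide0_iso e))
  (fun x => match x with
            | inl e => invE subdivide0_iso e | inr j => no_position _ j end)).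
- by move=> v; exact: (isoVK subdivide0_iso).
- by case=> [v|j]; [congr inl; exact: (invVK subdivide0_iso)|exact: no_position].
- by move=> v; exact: (isoEK subdivide0_iso).
- by case=> [v|j]; [congr inl; exact: (invEK subdivide0_iso)|exact: no_position].
- by move=> e; rewrite -(iso_src subdivide0_iso).
- by move=> e; rewrite -(iso_tgt subdivide0_iso).
Defined.

End SubdivideZero.

(** * Degrees *)

Definition loopless (G : graph) := forall e : edge G, src e != tgt e.
Definition no_degree2 (G : graph) := forall v : vertex G, degree v <> 2.

Lemma subdivide_incident_new (G : graph) (m : edge G -> nat) e (k : 'I_(m e)) x :
  @incident (subdivide m) x (inr (Tagged (fun e => 'I_(m e)) k)) =
  (x == Tagged (fun e => 'I_(m e).+1) (lift ord0 k)) ||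
  (x == Tagged (fun e => 'I_(m e).+1) (lift ord_max k)).
Proof.
rewrite /incident; congr (_ || _); apply/eqP/eqP => [|->]; first last.
- by rewrite subdivide_tgt_lift.
- case: x => f i; case: (unliftP ord_max i) => [l ->|->].
    rewrite subdivide_tgt_lift => -[fe]; subst f.
    by move/eqP; rewrite -tag_eqE /tag_eq /= eqxx tagged_asE => /eqP ->.
  by rewrite subdivide_tgt_max.
- by rewrite subdivide_srcS.
- case: x => f i; case: (unliftP ord0 i) => [l ->|->].
    rewrite subdivide_srcS => -[fe]; subst f.
    by move/eqP; rewrite -tag_eqE /tag_eq /= eqxx tagged_asE => /eqP ->.
  by rewrite subdivide_src0.
Qed.

Lemma subdivide_degree_new (G : graph) (m : edge G -> nat)
    (j : {e : edge G & 'I_(m e)}) : @degree (subdivide m) (inr j) = 2.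
Proof.
case: j => e k; rewrite /degree.
have -> : [set x | @incident (subdivide m) x (inr (Tagged (fun e => 'I_(m e)) k))]%SET
    = [set Tagged (fun e => 'I_(m e).+1) (lift ord0 k);
           Tagged (fun e => 'I_(m e).+1) (lift ord_max k)]%SET.
  by apply/setP => x; rewrite !inE subdivide_incident_new.
rewrite cards2 eq_Tagged /= -val_eqE /= /bump /= leqNgt ltn_ord.
by rewrite add0n add1n neq_ltn leqnn orbT.
Qed.

Lemma subdivide_degree_old (G : graph) (m : edge G -> nat) (v : vertex G) :
  loopless G -> @degree (subdivide m) (inl v) = degree v.
Proof.
move=> noloop; rewrite /degree.
pose h := fun e : edge G => (Tagged (fun e => 'I_(m e).+1)
  (if src e == v then ord0 else ord_max : 'I_(m e).+1) : edge (subdivide m)).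
have h_inj : injective h by move=> e e' E; have := congr1 (fun x => tag x) E.
rewrite -(card_imset _ h_inj); apply: eq_card => x; rewrite !inE.
apply/idP/imsetP => [|[e]].
  case: x => e i /orP[] /eqP.
    case: (unliftP ord0 i) => [k ->|->]; first by rewrite subdivide_srcS.
    rewrite subdivide_src0 => -[ev]; exists e; first by rewrite inE /incident ev eqxx.
    by rewrite /h ev eqxx.
  case: (unliftP ord_max i) => [k ->|->]; first by rewrite subdivide_tgt_lift.
  rewrite subdivide_tgt_max => -[ev]; exists e.
    by rewrite inE /incident ev eqxx orbT.
  by rewrite /h -ev (negbTE (noloop e)).
rewrite inE /incident /h => + ->.
have [ev _|ev /=] := eqVneq (src e) v; first by rewrite subdivide_src0 ev eqxx.
by move/eqP=> ev'; rewrite unlift_none ev' eqxx orbT.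
Qed.

Lemma subdivide_loopless (G : graph) (m : edge G -> nat) :
  loopless G -> loopless (subdivide m).
Proof.
move=> noloop [e i]; case: (unliftP ord0 i) => [k ik|i0].
  have := @subdivide_srcS G m e k; rewrite -ik => ->.
  case: (unliftP ord_max i) => [l il|i1].
    have := @subdivide_tgt_lift G m e l; rewrite -il => ->.
    apply/eqP => -[] /eqP; rewrite -tag_eqE /tag_eq /= eqxx tagged_asE => /eqP kl.
    have := congr1 val ik; rewrite il kl /= /bump leqNgt ltn_ord /= add0n.
    by rewrite add1n => /eqP; rewrite ltn_eqF.
  by have := @subdivide_tgt_max G m e; rewrite -i1 => ->.
have := @subdivide_src0 G m e; rewrite -i0 => ->.
case: (unliftP ord_max i) => [l il|i1].
  by have := @subdivide_tgt_lift G m e l; rewrite -il => ->.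
have := @subdivide_tgt_max G m e; rewrite -i1 => ->.
by apply: contra (noloop e) => /eqP[->].
Qed.

Lemma sprout_loopless (G : graph) : loopless G -> loopless (sprout G).
Proof.
move=> noloop [e|v] //=; apply: contra (noloop e).
by rewrite (inj_eq (@inl_inj _ _)).
Qed.

(** A vertex of degree 2 gets a third edge, and its new neighbour has degree 1.
    So the vertices of degree 2 that the next step uses are among those that
    subdivide the new edges. *)
Lemma sprout_no_degree2 (G : graph) : no_degree2 (sprout G).
Proof.
case=> [v|v]; rewrite /degree.
  case: (altP (degree v =P 2)) => deg_v.
    have dv : degree v == 2 by rewrite deg_v.
    have -> : [set e | @incident (sprout G) e (inl v)]%SET =
        (inr (Sub v dv : degree2_vertex G) |:
         (@inl (edge G) (degree2_vertex G) @: [set e | incident e v]))%SET.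
      apply/setP => -[e|w]; rewrite !inE /incident /=.
        rewrite (mem_imset _ _ (@inl_inj _ _)) inE /incident.
        by rewrite !(inj_eq (@inl_inj _ _)).
      rewrite orbF (inj_eq (@inr_inj _ _)) (inj_eq (@inl_inj _ _)).
      have -> : (inr w \in [set inl x | x in [set e | incident e v]]%SET) = false.
        by apply/negP => /imsetP[].
      by rewrite orbF -val_eqE.
    rewrite cardsU1 (card_imset _ (@inl_inj _ _)).
    rewrite -/(degree v) deg_v.
    by case: imsetP => // -[].
  have -> : [set e | @incident (sprout G) e (inl v)]%SET =
         (@inl (edge G) (degree2_vertex G) @: [set e | incident e v])%SET.
    apply/setP => -[e|w]; rewrite !inE /incident /=.
      rewrite (mem_imset _ _ (@inl_inj _ _)) inE /incident.
      by rewrite !(inj_eq (@inl_inj _ _)).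
    have -> : (inr w \in [set inl x | x in [set e | incident e v]]%SET) = false.
      by apply/negP => /imsetP[].
    rewrite orbF (inj_eq (@inl_inj _ _)).
    apply/negbTE; apply: contra deg_v => /eqP <-; exact: valP w.
  by rewrite (card_imset _ (@inl_inj _ _)); apply/eqP.
have -> : [set e | @incident (sprout G) e (inr v)]%SET = [set inr v]%SET.
  apply/setP => -[e|w]; rewrite !inE /incident //=.
by rewrite cards1.
Qed.

Section SproutSubdivide.
Variables (G : graph) (m : edge G -> nat).
Hypotheses (noloop : loopless G) (no2 : no_degree2 G).
Local Notation J := {e : edge G & 'I_(m e)}.

Lemma degree2_new (v : degree2_vertex (subdivide m)) : {j : J | val v = inr j}.
Proof.
case: v => -[v|j] dv /=; last by exists j.
by exfalso; move: dv; rewrite subdivide_degree_old // => /eqP; apply: no2.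
Qed.

Definition degree2_position v : J := sval (degree2_new v).

Lemma degree2_vertex_subproof (j : J) : @degree (subdivide m) (inr j) == 2.
Proof. by rewrite subdivide_degree_new. Qed.

Definition position_degree2 (j : J) : degree2_vertex (subdivide m) :=
  Sub (inr j : vertex (subdivide m)) (degree2_vertex_subproof j).

Lemma degree2_positionK : cancel degree2_position position_degree2.
Proof.
by move=> v; apply: val_inj; rewrite /= /degree2_position; case: degree2_new.
Qed.

Lemma position_degree2K : cancel position_degree2 degree2_position.
Proof.
by move=> j; rewrite /degree2_position; case: (degree2_new _) => k /= [].
Qed.

Definition sum_map (A B C : Type) (f : B -> C) (x : A + B) : A + C :=
  match x with inl a => inl a | inr b => inr (f b) end.

Lemma sum_mapK A B C (f : B -> C) (g : C -> B) :
  cancel f g -> cancel (@sum_map A _ _ f) (@sum_map A _ _ g).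
Proof. by move=> fg [a|b] //=; rewrite fg. Qed.

Definition sprout_subdivide_iso : giso (sprouted m) (sprout (subdivide m)).
Proof.
apply: (@Giso (sprouted m) (sprout (subdivide m))
  (sum_map position_degree2) (sum_map degree2_position)
  (sum_map position_degree2) (sum_map degree2_position));
  try exact/sum_mapK/degree2_positionK; try exact/sum_mapK/position_degree2K.
- by case.
- by case.
Defined.

End SproutSubdivide.

Lemma sprout_trivial_iso (G : graph) : no_degree2 G -> giso (sprout G) G.
Proof.
move=> no2.
have abs (T : Type) (v : degree2_vertex G) : T.
  by exfalso; case: v => v /eqP; exact: no2.
apply: (@Giso (sprout G) G
  (fun x => match x with inl v => v | inr w => abs _ w end) inl
  (fun x => match x with inl v => v | inr w => abs _ w end) inl) => //.
- by case=> // w; exact: abs.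
- by case=> // w; exact: abs.
- by case=> // w; exact: abs.
- by case=> // w; exact: abs.
Qed.

(** * From the procedure to elementary operations *)

Section Generation.
Variable drawn : forall G : graph, (edge G -> bool) -> Prop.
Hypothesis drawn_iso : forall G H (f : giso G H)
    (act : edge G -> bool) (act' : edge H -> bool), (forall e, act' (isoE f e) -> act e) -> drawn act -> drawn act'.
Hypothesis drawn_split : forall G (act : edge G -> bool) (e : edge G),
  drawn act -> @drawn (split_twice e) (fun=> false).
Hypothesis drawn_branch : forall G (act : edge G -> bool) (e : edge G),
  act e -> drawn act -> drawn (@branch_active G e act).
Hypothesis drawn_edge : @drawn one_edge_graph (fun=> true).

Lemma incr_ind (E : finType) (Q : (E -> nat) -> Prop) :
  Q (fun=> 0) -> (forall m e, Q m -> Q (incr e m)) -> forall m, Q m.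
Proof.
move=> Q0 QS m; move En: (\sum_e m e) => n.
elim: n m En => [|n IHn] m Em.
  suff -> : m = (fun=> 0) by [].
  apply/funext => e; apply/eqP; move/eqP: Em; rewrite sum_nat_eq0.
  by move=> /forallP/(_ e).
have [e me] : exists e, m e != 0.
  apply/existsP; rewrite -negb_forall; apply/negP => /forallP m0.
  by move: Em; rewrite big1 // => e _; apply/eqP.
pose m0 f := m f - (f == e).
have -> : m = incr e m0.
  apply/funext => f; rewrite /incr /m0 subnK //.
  by case: eqP => [->|//]; rewrite lt0n.
apply/QS/IHn.
have : \sum_(f : E) m f = \sum_(f : E) (m0 f + (f == e)).
  apply: eq_bigr => f _; rewrite /m0 subnK //.
  by case: eqP => [->|//]; rewrite lt0n.
rewrite big_split Em /=.
have -> : \sum_(f : E) (f == e : nat) = 1.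
  rewrite (bigD1 e) //= eqxx big1 // => f.
  by move/negbTE->.
by rewrite addn1 => /eqP; rewrite eqSS => /eqP ->.
Qed.

Lemma double_incr (E : finType) (m : E -> nat) e :
  (fun f => 2 * incr e m f) = incr e (incr e (fun f => 2 * m f)).
Proof. by apply/funext => f; rewrite /incr mulnDr (mul2n (f == e)) -addnn addnA. Qed.

Lemma drawn_subdivide G (act : edge G -> bool) (m : edge G -> nat) :
  drawn act -> @drawn (subdivide (fun e => 2 * m e)) (fun=> false).
Proof.
move=> dG; move: m; apply: incr_ind => [|m e IH].
  by apply: drawn_iso dG => //; apply: subdivide0_iso.
rewrite double_incr.
set m2 := fun f => 2 * m f.
have f1 := subdivide_incr_iso m2 e.
have g := subdivide_incr_iso (incr e m2) e.
pose h := split_edge_iso (subdivide_incr_iso m2 e) (last_segment (incr e m2) e).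
have e_last : isoE (subdivide_incr_iso m2 e) (last_segment (incr e m2) e) = None.
  by rewrite /= /subdiv_isoE /position_restr position_ge //= /incr eqxx addn1.
move: h; rewrite e_last => h.
apply: (drawn_iso (f := giso_sym (giso_trans g h))) => //.
exact: drawn_split IH.
Qed.

(** Vertices are always inserted next to the target of an edge, so its last
    segment has to remain active; after [branch_twice], that is the third at this
    end. *)
Definition sprouted_active G (act : edge G -> bool) (m : edge G -> nat)
    (x : edge (sprouted m)) : bool :=
  match x with
  | inl y => act (tag y) && (tagged y == ord_max)
  | inr _ => true
  end.

Lemma drawn_sprouted G (act : edge G -> bool) (m : edge G -> nat) :
  (forall e, 0 < m e -> act e) -> drawn act ->
  drawn (@sprouted_active G act (fun e => 2 * m e)).
Proof.
move=> + dG; move: m; apply: incr_ind => [_|m e IH m_act].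
  by apply: (drawn_iso (f := @sprouted0_iso _ _ _)) dG => // e /andP[].
have act_e : act e by apply: m_act; rewrite /incr eqxx addn1.
have /IH {IH} dm : forall f, 0 < m f -> act f.
  by move=> f mf; apply: m_act; rewrite /incr addn_gt0 mf.
rewrite double_incr; set m2 := fun f => 2 * m f in dm *.
pose g := sprouted_incr_iso m2 e.
pose g' := sprouted_incr_iso (incr e m2) e.
have e_last : isoE g (inl (last_segment (incr e m2) e)) = Some None.
  by rewrite /= /subdiv_isoE /position_restr position_ge //= /incr eqxx addn1.
set last1 : edge (sprouted (incr e m2)) := inl (last_segment (incr e m2) e).
pose h := add_leaf_iso (split_edge_iso g last1) None.
pose last0 : edge (sprouted m2) := inl (last_segment m2 e).
pose k := branch_twice_iso last0.
have [kk kkE] : exists kk : giso (branch_twice last0)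
    (@add_leaf (split_edge (isoE g last1)) None),
    forall x, isoE kk x = isoE k x :> option (option (option (option _))).
  by rewrite /last1 e_last; exists k.
have act_last : sprouted_active act last0 by rewrite /= act_e eqxx.
apply: (drawn_iso (f := giso_trans kk (giso_sym (giso_trans g' h)))) (drawn_branch act_last dm).
move=> x; rewrite [isoE _ x]/= kkE /k /branch_twice_iso.
case: x => [[[[[y|j]|]|]|]|] //=.
- case/andP=> -> /= /eqP/(congr1 val) /= top; apply/eqP/val_inj => /=.
  move: top (ltn_ord (tagged y)); rewrite /incr.
  by case: (tag y == e) => /=; lia.
- case/andP=> _ /eqP/(congr1 val) /=.
  by rewrite /incr eqxx /=; lia.
Qed.

(** One step adds vertices to an edge and then, at the next step, a leaf to each
    of them. Regrouping the two halves, the graph grows by pairs of branching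
    vertices, and it is [sprout G] rather than [G] that is drawn: this requires
    that the edges to be subdivided next, which are the new leaves, be active. *)
Lemma stage_drawn_sprout G : stage G -> loopless G /\
  @drawn (sprout G) (fun x => if x is inr _ then true else false).
Proof.
have sprouting H (act : edge H -> bool) m : loopless H -> no_degree2 H ->
    (forall e, 0 < m e -> act e) -> drawn act ->
    @drawn (sprout (subdivide (fun e => 2 * m e)))
      (fun x => if x is inr _ then true else false).
  move=> noloop no2 m_act /(drawn_sprouted m_act).
  by apply: (drawn_iso (f := sprout_subdivide_iso _ noloop no2)) => -[].
elim=> [k|{}G k _ [noloop IH] _].
  split; first exact/subdivide_loopless.
  apply: sprouting drawn_edge => // v.
  rewrite /degree => deg2.
  have := max_card [set e : edge one_edge_graph | incident e v]%SET.
  by rewrite deg2 card_unit.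
split; first exact/subdivide_loopless/sprout_loopless.
rewrite /grow.
have -> : (fun x : edge (sprout G) => match x with inl _ => 0 | inr v => 2 * k v end)
    = (fun x => 2 * match x with inl _ => 0 | inr v => k v end).
  by apply/funext => -[].
apply: sprouting IH; first exact: sprout_loopless.
  exact: sprout_no_degree2.
by case.
Qed.

(** The vertices of the last subdivision come in pairs on each edge and are not
    branched afterwards, so that no edge has to remain active. *)
Theorem procedure_drawn T : procedure_tree T -> @drawn T (fun=> false).
Proof.
case=> G j /stage_drawn_sprout[_ dG] no2 _; apply: (drawn_subdivide (act := fun=> false)).
by apply: (drawn_iso (f := sprout_trivial_iso no2)) dG.
Qed.

End Generation.

Import Order.TTheory GRing.Theory Num.Theory.
Import numFieldNormedType.Exports.

Local Open Scope classical_set_scope.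
Local Open Scope ring_scope.

(** * Layouts *)

Section Layout.
Variable R : realType.
Implicit Types (G : graph) (p q : R * R) (K A : set (R * R)).

Definition btw (a b t : R) : bool := (a < t < b) || (b < t < a).

Lemma btw_neq a b t : btw a b t -> (t != a) && (t != b).
Proof.
by case/orP => /andP[h1 h2]; rewrite ?(gt_eqF h1) ?(lt_eqF h2) ?(lt_eqF h1) ?(gt_eqF h2).
Qed.

Lemma btw_split a b m t : btw a b m ->
  btw a b t = [|| btw a m t, t == m | btw m b t].
Proof.
rewrite /btw => h; apply/idP/or3P => [ht|].
  have [tm|mt|->] := ltgtP t m; last by constructor 2.
  - by case/orP: h => /andP[h1 h2]; case/orP: ht => /andP[h3 h4];
      do [constructor 1; lra|constructor 3; lra|exfalso; lra].
  - by case/orP: h => /andP[h1 h2]; case/orP: ht => /andP[h3 h4];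
      do [constructor 1; lra|constructor 3; lra|exfalso; lra].
by case/orP: h => /andP[h1 h2]; case=> [/orP[]/andP[h3 h4]|/eqP ->|/orP[]/andP[h3 h4]];
  apply/orP; do [by left; apply/andP; split; lra|by right; apply/andP; split; lra].
Qed.

Lemma btw_disjoint a b m t : btw a b m -> btw a m t -> btw m b t = false.
Proof.
by rewrite /btw => /orP[]/andP[h1 h2] /orP[]/andP[h3 h4]; apply/negbTE/negP => /orP[]/andP[h5 h6]; lra.
Qed.

Definition closed_edge G (e : edge G) (x : vertex G + edge G) : bool :=
  [|| x == inr e, x == inl (src e) | x == inl (tgt e)].

(** [lab] says to which vertex or open edge the vertical slice through a point of
    [K] belongs, and [xv] places the vertices on the horizontal axis: edges need
    not go from left to right. Slices of a label are intervals, and closed edges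
    have closed preimages; with the compactness of [K] this makes the graph a
    quotient of [K]. *)
Record layout K G (xv : vertex G -> R) (lab : R * R -> vertex G + edge G)
    : Prop := Layout {
  lay_ends : forall e, xv (src e) != xv (tgt e);
  lay_vx : forall p v, K p -> lab p = inl v -> p.1 = xv v;
  lay_ex : forall p e, K p -> lab p = inr e -> btw (xv (src e)) (xv (tgt e)) p.1;
  lay_v : forall v, exists p, K p /\ lab p = inl v;
  lay_e : forall e t, btw (xv (src e)) (xv (tgt e)) t ->
    exists p, [/\ K p, lab p = inr e & p.1 = t];
  lay_convex : forall p q y, K p -> K q -> lab p = lab q -> p.1 = q.1 ->
    p.2 <= y <= q.2 -> K (p.1, y) /\ lab (p.1, y) = lab p;
  lay_closed : forall e, closed [set p | K p /\ closed_edge e (lab p)] }.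

Lemma closed_fst (x : R) : closed [set p : R * R | p.1 = x].
Proof.
apply: (@closed_comp _ _ fst [set x]); last exact: closed_eq.
by move=> p _; exact: cvg_fst.
Qed.

Lemma closed_fst_le (x : R) : closed [set p : R * R | p.1 <= x].
Proof.
apply: (@closed_comp _ _ fst [set t | t <= x]); last exact: closed_le.
by move=> p _; exact: cvg_fst.
Qed.

Lemma closed_fst_ge (x : R) : closed [set p : R * R | x <= p.1].
Proof.
apply: (@closed_comp _ _ fst [set t | x <= t]); last exact: closed_ge.
by move=> p _; exact: cvg_fst.
Qed.

Lemma closed_snd_le (x : R) : closed [set p : R * R | p.2 <= x].
Proof.
apply: (@closed_comp _ _ snd [set t | t <= x]); last exact: closed_le.
by move=> p _; exact: cvg_snd.
Qed.

Lemma closed_snd_ge (x : R) : closed [set p : R * R | x <= p.2].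
Proof.
apply: (@closed_comp _ _ snd [set t | x <= t]); last exact: closed_ge.
by move=> p _; exact: cvg_snd.
Qed.

Definition btw_closed (a b t : R) : bool := (a <= t <= b) || (b <= t <= a).

Lemma closed_btw (a b : R) : closed [set p : R * R | btw_closed a b p.1].
Proof.
have -> : [set p : R * R | btw_closed a b p.1] =
   ([set p | a <= p.1] `&` [set p | p.1 <= b]) `|`
   ([set p | b <= p.1] `&` [set p | p.1 <= a]).
  apply/seteqP; split=> p /=; first by case/orP => /andP[]; [left|right].
  by case=> -[h1 h2]; apply/orP; [left|right]; apply/andP.
by apply: closedU; apply: closedI;
  by [exact: closed_fst_ge|exact: closed_fst_le].
Qed.

Lemma btw_closedE a b t : btw_closed a b t = [|| btw a b t, t == a | t == b].
Proof.
rewrite /btw_closed /btw; apply/idP/or3P.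
  case/orP=> /andP[]; rewrite !le_eqVlt eq_sym => /orP[/eqP<-|h1];
   rewrite ?[t == _]eq_sym => /orP[/eqP h2|h2]; subst=> //; rewrite ?eqxx;
   by [constructor 2|constructor 3|constructor 1; rewrite h1 h2 ?orbT].
case=> [/orP[]/andP[h1 h2]|/eqP->|/eqP->]; rewrite ?lexx ?andbT ?le_total //.
- by rewrite (ltW h1) (ltW h2).
- by rewrite (ltW h1) (ltW h2) orbT.
Qed.

Section Facts.
Variables (K : set (R * R)) (G : graph).
Variables (xv : vertex G -> R) (lab : R * R -> vertex G + edge G).
Hypothesis L : layout K xv lab.

(** Inside the closed preimage of an edge, the vertex is cut out by an
    abscissa, because the two ends of the edge have different ones. *)
Lemma layout_vertex_closed v e : incident e v ->
  closed [set p | K p /\ lab p = inl v].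
Proof.
move=> ev.
have -> : [set p | K p /\ lab p = inl v] =
    [set p | K p /\ closed_edge e (lab p)] `&` [set p | p.1 = xv v].
  apply/seteqP; split=> p /=.
    case=> Kp lp; split; last exact: (lay_vx L Kp lp).
    split=> //; rewrite /closed_edge lp.
    by case/orP: ev => /eqP ->; rewrite eqxx ?orbT.
  case=> -[Kp /or3P[]/eqP lp px]; split=> //.
  - have := btw_neq (lay_ex L Kp lp); rewrite px.
    by case/orP: ev => /eqP ->; rewrite eqxx ?andbF.
  - have := lay_vx L Kp lp; rewrite px; case/orP: ev => /eqP ev; rewrite -ev // => xx;
      by move: (lay_ends L e); rewrite xx eqxx.
  - have := lay_vx L Kp lp; rewrite px; case/orP: ev => /eqP ev; rewrite -ev // => xx;
      by move: (lay_ends L e); rewrite xx eqxx.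
by apply: closedI; [exact: (lay_closed L)|exact: closed_fst].
Qed.

End Facts.

(** Nothing changes in the graph when the region shrinks, as long as its slices
    are neither emptied nor disconnected. *)
Lemma layout_restrict K K' G (xv : vertex G -> R) lab :
  layout K xv lab -> K' `<=` K -> closed K' ->
  (forall v, exists p, K' p /\ lab p = inl v) ->
  (forall e t, btw (xv (src e)) (xv (tgt e)) t ->
    exists p, [/\ K' p, lab p = inr e & p.1 = t]) ->
  (forall p q y, K' p -> K' q -> lab p = lab q -> p.1 = q.1 ->
    p.2 <= y <= q.2 -> K (p.1, y) -> lab (p.1, y) = lab p -> K' (p.1, y)) ->
  layout K' xv lab.
Proof.
move=> L sub cl hv he hc; split=> //.
- exact: (lay_ends L).
- by move=> p v /sub Kp; exact: (lay_vx L Kp).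
- by move=> p v /sub Kp; exact: (lay_ex L Kp).
- move=> p q y Kp Kq lpq pq y_pq.
  have [Ky ly] := lay_convex L (sub _ Kp) (sub _ Kq) lpq pq y_pq.
  by split=> //; exact: hc Kp Kq lpq pq y_pq Ky ly.
- move=> e; have -> : [set p | K' p /\ closed_edge e (lab p)] =
     K' `&` [set p | K p /\ closed_edge e (lab p)].
    by apply/seteqP; split=> p /=; [case=> /[dup] /sub|case=> ? []].
  by apply: closedI => //; exact: (lay_closed L).
Qed.

Section Split.
Variables (K : set (R * R)) (G : graph).
Variables (xv : vertex G -> R) (lab : R * R -> vertex G + edge G).
Variables (e : edge G) (x : R).

Definition split_xv (v : vertex (split_edge e)) : R :=
  if v is Some w then xv w else x.

Definition split_lab (p : R * R) : vertex (split_edge e) + edge (split_edge e) :=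
  match lab p with
  | inl v => inl (Some v)
  | inr f => if f == e then
               if p.1 == x then inl None
               else inr (if btw (xv (src e)) x p.1 then Some e else None)
             else inr (Some f)
  end.

(** Any abscissa in the range of an edge may be declared a vertex. *)
Lemma layout_split : layout K xv lab -> btw (xv (src e)) (xv (tgt e)) x ->
  layout K split_xv split_lab.
Proof.
move=> L xe; have [Ex Ey] := andP (btw_neq xe).
have splitE p : K p -> lab p = inr e ->
    [|| btw (xv (src e)) x p.1, p.1 == x | btw x (xv (tgt e)) p.1].
  by move=> Kp lp; rewrite -btw_split //; exact: (lay_ex L Kp lp).
have lab1 p : btw (xv (src e)) x p.1 -> lab p = inr e ->
    split_lab p = inr (Some e).
  move=> px lp; rewrite /split_lab lp eqxx px.
  by have /andP[_ /negbTE ->] := btw_neq px.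
have lab2 p : p.1 = x -> lab p = inr e -> split_lab p = inl None.
  by move=> px lp; rewrite /split_lab lp eqxx px eqxx.
have lab3 p : btw x (xv (tgt e)) p.1 -> lab p = inr e ->
    split_lab p = inr None.
  move=> px lp; rewrite /split_lab lp eqxx.
  have /andP[/negbTE -> _] := btw_neq px.
  case: ifP => // px'; by rewrite (btw_disjoint xe px') in px.
split.
- case=> [f|] /=; last by [].
  have [->|_] := eqVneq f e => /=; last exact: (lay_ends L f).
  by rewrite eq_sym.
- move=> p [v|] Kp; rewrite /split_lab; destruct (lab p) as [w|f] eqn:lp => //=.
  + by move=> [<-]; exact: (lay_vx L Kp lp).
  + by case: ifP => // _; case: ifP.
  + by case: ifP => // _; case: eqP.
- move=> p f Kp; rewrite /split_lab; destruct (lab p) as [w|g] eqn:lp => //=.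
  case: eqP => [ge|/eqP ge]; last first.
    by case=> <-; rewrite /= (negbTE ge); exact: (lay_ex L Kp lp).
  case: eqP => // /eqP px [<-]; subst g.
  case: ifP => [pe|/negbT pe]; first by rewrite /= eqxx.
  by have := splitE p Kp lp; rewrite (negbTE pe) (negbTE px).
- case=> [v|]; last first.
    by have [p [Kp lp px]] := lay_e L xe; exists p; rewrite lab2.
  by have [p [Kp lp]] := lay_v L v; exists p; rewrite /split_lab lp.
- case=> [f|] t /=; last first.
    move=> te; have [|p [Kp lp pt]] := lay_e L (e := e) (t := t).
      by rewrite (btw_split _ xe) te !orbT.
    by exists p; rewrite lab3 // pt.
  case: eqP => [-> /= te|/eqP fe te].
    have [|p [Kp lp pt]] := lay_e L (e := e) (t := t).
      by rewrite (btw_split _ xe) te.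
    by exists p; rewrite lab1 // pt.
  have [p [Kp lp pt]] := lay_e L te; exists p.
  by rewrite /split_lab lp (negbTE fe).
- move=> p q y Kp Kq lpq pq y_pq.
  have lpq' : lab p = lab q.
    move: lpq; rewrite /split_lab.
    case: (lab p) => [v|f]; case: (lab q) => [w|g] //.
    + by move=> [->].
    + by case: ifP => // _; case: ifP.
    + by case: ifP => // _; case: ifP.
    + have [->|fe] := eqVneq f e; have [->|ge] := eqVneq g e => //.
      * by case: (p.1 == x); case: btw => // -[] ge'; rewrite -ge' eqxx in ge.
      * by case: (q.1 == x); case: btw => // -[] fe'; rewrite fe' eqxx in fe.
      * by case=> ->.
  have [Ky ly] := lay_convex L Kp Kq lpq' pq y_pq.
  by split=> //; rewrite /split_lab ly.
- case=> [f|].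
    have [->|fe] := eqVneq f e.
      have -> : [set p | K p /\ closed_edge (Some e : edge (split_edge e)) (split_lab p)]
        = [set p | K p /\ closed_edge e (lab p)] `&`
          [set p | btw_closed (xv (src e)) x p.1].
        apply/seteqP; split=> p /=; rewrite /closed_edge /= eqxx btw_closedE.
          case=> Kp; rewrite /split_lab; destruct (lab p) as [w|g] eqn:lp => //=.
            by case/orP => // /eqP [w_src]; rewrite (lay_vx L Kp lp) w_src !eqxx ?orbT.
          have [ge|ge] := eqVneq g e; last first.
            by case/or3P => // /eqP // [ge']; rewrite ge' eqxx in ge.
          subst g; rewrite eqxx => H; split=> //; move: H.
          have [px|px] := eqVneq p.1 x; rewrite ?orbT //.
          by case: (btw (xv (src e)) x p.1).
        case=> -[Kp lp] px; split=> //; move: lp => /or3P[] /eqP lp.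
        + have := splitE p Kp lp; case/or3P=> h.
          * by rewrite (lab1 _ h) ?eqxx.
          * by rewrite (lab2 _ (eqP h)) ?eqxx ?orbT.
          * exfalso; have hn := btw_neq h; case/or3P: px => h'.
            - by rewrite (btw_disjoint xe h') in h.
            - by move: h; rewrite (eqP h') /btw; move: xe; rewrite /btw; lra.
            - by rewrite h' in hn.
        + by rewrite /split_lab lp eqxx ?orbT.
        + exfalso; have := lay_vx L Kp lp => pe; move: px; rewrite pe.
          rewrite [xv _ == x]eq_sym (negbTE Ey) orbF => /orP[h|].
            by move: h xe; rewrite /btw; lra.
          by rewrite eq_sym (negbTE (lay_ends L e)).
      by apply: closedI; [exact: (lay_closed L)|exact: closed_btw].
    have -> : [set p | K p /\ closed_edge (Some f : edge (split_edge e)) (split_lab p)]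
        = [set p | K p /\ closed_edge f (lab p)].
      apply/funext => p /=; congr (_ /\ is_true _).
      rewrite /closed_edge /split_lab /= (negbTE fe); case: (lab p) => [w|g] //.
      have [->|ge] := eqVneq g e; last by [].
      have efr : (inr e == inr f :> vertex G + edge G) = false.
        by apply/negbTE; apply: contra fe => /eqP[->].
      have esf : (inr (Some e) == inr (Some f) :> option (vertex G) + option (edge G)) = false.
        by apply/negbTE; apply: contra fe => /eqP[->].
      by case: (p.1 == x); case: (btw _ _ _); rewrite ?efr ?esf.
    exact: (lay_closed L).
  have -> : [set p | K p /\ closed_edge (None : edge (split_edge e)) (split_lab p)]
        = [set p | K p /\ closed_edge e (lab p)] `&`
          [set p | btw_closed x (xv (tgt e)) p.1].
    apply/seteqP; split=> p /=; rewrite /closed_edge /= btw_closedE.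
      case=> Kp; rewrite /split_lab; destruct (lab p) as [w|g] eqn:lp => //=.
        by move=> /eqP [w_tgt]; rewrite (lay_vx L Kp lp) w_tgt !eqxx ?orbT.
      have [ge|ge] := eqVneq g e; last by case/or3P.
      subst g; have [px|px] := eqVneq p.1 x; first by rewrite !eqxx /= ?orbT.
      rewrite eqxx => H.
      split=> //; have := splitE p Kp lp; rewrite (negbTE px) /=.
      by case: (btw (xv (src e)) x p.1) H => //= _ ->.
    case=> -[Kp lp] px; split=> //; move: lp => /or3P[] /eqP lp.
    + have := splitE p Kp lp; case/or3P=> h.
      * exfalso; have hn := btw_neq h; case/or3P: px => h'.
        - by rewrite (btw_disjoint xe h) in h'.
        - by rewrite h' andbF in hn.
        - by move: h; rewrite (eqP h') /btw; move: xe; rewrite /btw; lra.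
      * by rewrite (lab2 _ (eqP h)) ?eqxx ?orbT.
      * by rewrite (lab3 _ h) ?eqxx.
    + exfalso; have := lay_vx L Kp lp => pe; move: px; rewrite pe.
      rewrite [xv _ == x]eq_sym (negbTE Ex) /= => /orP[h|].
        by move: h xe; rewrite /btw; lra.
      by rewrite (negbTE (lay_ends L e)).
    + by rewrite /split_lab lp eqxx ?orbT.
  by apply: closedI; [exact: (lay_closed L)|exact: closed_btw].
Qed.

End Split.

Section Leaf.
Variables (K A : set (R * R)) (G : graph).
Variables (xv : vertex G -> R) (lab : R * R -> vertex G + edge G).
Variables (v : vertex G) (x : R).

Definition leaf_xv (w : vertex (add_leaf v)) : R := if w is Some u then xv u else x.

Definition leaf_lab (p : R * R) : vertex (add_leaf v) + edge (add_leaf v) :=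
  if `[< A p >] && (p.1 != xv v) then
    if p.1 == x then inl None else inr None
  else match lab p with inl w => inl (Some w) | inr f => inr (Some f) end.

(** The horn [A] meets [K] along a part of the slice of [v], and its other slices
    are connected: the quotient grows by a segment attached at [v]. *)
Lemma layout_leaf : layout K xv lab -> x != xv v ->
  closed [set p | K p /\ lab p = inl v] -> closed A ->
  (forall p, A p -> btw_closed (xv v) x p.1) ->
  (forall p, A p -> K p <-> p.1 = xv v) ->
  (forall p, A p -> p.1 = xv v -> lab p = inl v) ->
  (forall t, btw_closed (xv v) x t -> t != xv v -> exists2 p, A p & p.1 = t) ->
  (forall p q y, A p -> A q -> p.1 = q.1 -> p.1 != xv v -> p.2 <= y <= q.2 ->
    A (p.1, y)) ->
  layout (K `|` A) leaf_xv leaf_lab.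
Proof.
move=> L xn clF clA Ax AK Al Ane Aconv.
have labA p : A p -> p.1 != xv v ->
    leaf_lab p = if p.1 == x then inl None else inr None.
  by move=> Ap pv; rewrite /leaf_lab asboolT // pv.
have labK p : K p ->
    leaf_lab p = match lab p with inl w => inl (Some w) | inr f => inr (Some f) end.
  move=> Kp; rewrite /leaf_lab; case: asboolP => //= Ap.
  by move/(AK _ Ap): Kp => ->; rewrite eqxx.
have KA p : (K `|` A) p -> K p \/ (A p /\ p.1 != xv v).
  case=> [|Ap]; first by left.
  have [pv|pv] := eqVneq p.1 (xv v); last by right.
  by left; apply/(AK _ Ap).
split.
- case=> [f|] /=; first exact: (lay_ends L).
  by rewrite eq_sym.
- move=> p w /KA[Kp|[Ap pv]].
    rewrite labK //; destruct (lab p) as [u|f] eqn:lp => // -[<-].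
    exact: (lay_vx L Kp lp).
  by rewrite labA //; have [-> [<-]|] := eqVneq p.1 x.
- move=> p f /KA[Kp|[Ap pv]].
    rewrite labK //; destruct (lab p) as [u|g] eqn:lp => // -[<-].
    exact: (lay_ex L Kp lp).
  rewrite labA //; have [//|px [<-] /=] := eqVneq p.1 x.
  by have := Ax p Ap; rewrite btw_closedE (negbTE pv) (negbTE px) !orbF.
- case=> [w|].
    have [p [Kp lp]] := lay_v L w; exists p; split; first by left.
    by rewrite labK // lp.
  have [||p Ap px] := Ane x; first by rewrite btw_closedE eqxx !orbT.
    by [].
  by exists p; split; [right|rewrite labA ?px ?eqxx].
- case=> [f|] t /= ht.
    have [p [Kp lp pt]] := lay_e L ht; exists p; split=> //; first by left.
    by rewrite labK // lp.
  have /andP[tv tx] := btw_neq ht.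
  have [||p Ap pt] := Ane t; first by rewrite btw_closedE ht.
    by [].
  exists p; split=> //; first by right.
  by rewrite labA ?pt ?(negbTE tx).
- move=> p q y /KA[Kp|[Ap pv]] /KA[Kq|[Aq qv]] lpq pq y_pq.
  + have lpq' : lab p = lab q.
      by move: lpq; rewrite !labK //; case: (lab p) (lab q) => [u|f] [w|g] // -[->].
    have [Ky ly] := lay_convex L Kp Kq lpq' pq y_pq.
    by split; [left|rewrite !labK // ly].
  + move: lpq; rewrite labK // labA //; case: ifP => _; case: (lab p) => //.
  + move: lpq; rewrite labA // labK //; case: ifP => _; case: (lab q) => //.
  + have Ay := Aconv _ _ _ Ap Aq pq pv y_pq.
    by split; [right|rewrite !labA].
- case=> [f|].
    have -> : [set p | (K `|` A) p /\ closed_edge (Some f : edge (add_leaf v)) (leaf_lab p)]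
        = [set p | K p /\ closed_edge f (lab p)].
      apply/seteqP; split=> p /=.
        case=> /KA[Kp|[Ap pv]].
          rewrite labK // => lp; split=> //; move: lp; rewrite /closed_edge /=.
          by case: (lab p).
        by rewrite labA // /closed_edge /=; case: ifP.
      case=> Kp lp; split; first by left.
      by rewrite labK //; move: lp; rewrite /closed_edge /=; case: (lab p).
    exact: (lay_closed L).
  have -> : [set p | (K `|` A) p /\ closed_edge (None : edge (add_leaf v)) (leaf_lab p)]
        = [set p | K p /\ lab p = inl v] `|` A.
    apply/seteqP; split=> p /=.
      case=> /KA[Kp|[Ap pv]] lp; last by right.
      left; split=> //; move: lp; rewrite labK // /closed_edge /=.
      by case: (lab p) => [w|g] // /or3P[] // /eqP[->].
    case=> [[Kp lp]|Ap].
      by split; [left|rewrite labK // lp /closed_edge /= eqxx ?orbT].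
    split; first by right.
    have [pv|pv] := eqVneq p.1 (xv v).
      have Kp : K p by apply/(AK _ Ap).
      by rewrite labK // (Al _ Ap pv) /closed_edge /= eqxx ?orbT.
    by rewrite labA //; case: ifP.
  exact: closedU.
Qed.

End Leaf.

Lemma layout_iso K G H (f : giso G H) (xv : vertex G -> R) lab :
  layout K xv lab ->
  layout K (xv \o invV f)
    (fun p => match lab p with inl v => inl (isoV f v) | inr e => inr (isoE f e) end).
Proof.
move=> L; pose h := fun x : vertex G + edge G =>
  match x with inl v => inl (isoV f v) | inr e => inr (isoE f e) end
    : vertex H + edge H.
have h_inj : injective h.
  move=> [u|e] [w|g] //= [].
    by move/(can_inj (isoVK f)) => ->.
  by move/(can_inj (isoEK f)) => ->.
have srcH e : invV f (src e) = src (invE f e).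
  by rewrite -{1}(invEK f e) iso_src isoVK.
have tgtH e : invV f (tgt e) = tgt (invE f e).
  by rewrite -{1}(invEK f e) iso_tgt isoVK.
have labV p w : h (lab p) = inl w -> lab p = inl (invV f w).
  by case: (lab p) => [u|e] //= [<-]; rewrite isoVK.
have labE p e : h (lab p) = inr e -> lab p = inr (invE f e).
  by case: (lab p) => [u|g] //= [<-]; rewrite isoEK.
split.
- by move=> e /=; rewrite srcH tgtH; exact: (lay_ends L).
- by move=> p w Kp /labV; exact: (lay_vx L Kp).
- by move=> p e Kp /labE lp /=; rewrite srcH tgtH; exact: (lay_ex L Kp lp).
- move=> w; have [p [Kp lp]] := lay_v L (invV f w); exists p.
  by rewrite lp invVK.
- move=> e t /=; rewrite srcH tgtH => ht.
  have [p [Kp lp pt]] := lay_e L ht; exists p.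
  by rewrite lp invEK.
- move=> p q y Kp Kq /h_inj lpq pq y_pq.
  by have [Ky ->] := lay_convex L Kp Kq lpq pq y_pq.
- move=> e; have -> : [set p | K p /\ closed_edge e (h (lab p))]
        = [set p | K p /\ closed_edge (invE f e) (lab p)].
    apply/funext => p /=; congr (_ /\ is_true _); rewrite /closed_edge -srcH -tgtH.
    have -> : inr e = h (inr (invE f e)) by rewrite /h /= invEK.
    have -> : inl (src e) = h (inl (invV f (src e))) by rewrite /h /= invVK.
    have -> : inl (tgt e) = h (inl (invV f (tgt e))) by rewrite /h /= invVK.
    by rewrite !(inj_eq h_inj).
  exact: (lay_closed L).
Qed.

End Layout.

(** * The Reeb graph of a layout *)

Lemma cvg_pair_nbhs (T U V : topologicalType) (f : T -> U) (g : T -> V) (x : T) :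
  {for x, continuous f} -> {for x, continuous g} ->
  {for x, continuous (fun y => (f y, g y))}.
Proof.
by move=> cf cg; exact: (@cvg_pair _ _ _ (nbhs x) (nbhs (f x)) (nbhs (g x)) _ _ _ f g cf cg).
Qed.

(** In a straight realization two edges with the same ends would coincide, and
    the closed edges have to cover the graph. *)
Definition simple_graph (G : graph) :=
  (forall v : vertex G, exists e : edge G, incident e v) /\
  (forall e f : edge G,
     (src e = src f /\ tgt e = tgt f) \/ (src e = tgt f /\ tgt e = src f) ->
     e = f).

Section Reeb.
Variable R : realType.
Variables (X : ss_pair R) (G : graph).
Local Notation K := (closure (dom X)).
Variables (xv : vertex G -> R) (lab : R * R -> vertex G + edge G).
Hypothesis L : layout K xv lab.
Hypothesis simpleG : simple_graph G.
Hypothesis cptK : compact K.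
Hypothesis sing_vertex : forall p, singular fst X p -> exists v, lab p = inl v.
Hypothesis vertex_sing : forall v, exists2 p, singular fst X p & lab p = inl v.

Local Notation vpt := (@vertex_pt R G).

Lemma vertex_ptE (v w : vertex G) : vpt v 0 (enum_rank w) = (v == w)%:R.
Proof. by rewrite mxE eqxx (inj_eq enum_rank_inj) eq_sym. Qed.

Lemma vertex_pt_inj : injective vpt.
Proof.
move=> v w /(congr1 (fun u : 'rV[R]_#|vertex G| => u 0 (enum_rank w))).
rewrite !vertex_ptE eqxx; have [//|_] := eqVneq v w.
by move/esym/eqP; rewrite oner_eq0.
Qed.

(** The label and the abscissa of a point determine its image: along an edge, it
    is the affine function of the abscissa with the right values at the ends. *)
Definition edge_par (e : edge G) (x : R) : R :=
  (x - xv (src e)) / (xv (tgt e) - xv (src e)).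

Definition edge_pt (e : edge G) (x : R) : 'rV[R]_#|vertex G| :=
  (1 - edge_par e x) *: vpt (src e) + edge_par e x *: vpt (tgt e).

Lemma edge_dne e : xv (tgt e) - xv (src e) != 0.
Proof. by rewrite subr_eq0 eq_sym (lay_ends L). Qed.

Lemma edge_par_src e : edge_par e (xv (src e)) = 0.
Proof. by rewrite /edge_par subrr mul0r. Qed.

Lemma edge_par_tgt e : edge_par e (xv (tgt e)) = 1.
Proof. by rewrite /edge_par divff // edge_dne. Qed.

Lemma edge_par_btw e x : btw (xv (src e)) (xv (tgt e)) x = (0 < edge_par e x < 1).
Proof.
rewrite /btw /edge_par; have := edge_dne e.
have [h|h|->] := ltgtP (xv (src e)) (xv (tgt e)); last by rewrite subrr eqxx.
- move=> _; have d0 : 0 < xv (tgt e) - xv (src e) by rewrite subr_gt0.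
  rewrite pmulr_lgt0 ?invr_gt0 // ltr_pdivrMr // mul1r subr_gt0 ltrD2r.
  by case: (ltgtP x) => //=; lra.
- move=> _; have d0 : xv (tgt e) - xv (src e) < 0 by rewrite subr_lt0.
  rewrite nmulr_lgt0 ?invr_lt0 // ltr_ndivrMr // mul1r subr_lt0 ltrD2r.
  apply/orP/andP; lra.
Qed.

Lemma edge_par_inj e x y : edge_par e x = edge_par e y -> x = y.
Proof.
have d := edge_dne e; rewrite /edge_par.
by move/(mulIf (invr_neq0 d))/addIr.
Qed.

Definition reeb_map (p : R * R) : 'rV[R]_#|vertex G| :=
  match lab p with inl v => vpt v | inr e => edge_pt e p.1 end.

Lemma reeb_map_edge e p : K p -> closed_edge e (lab p) ->
  reeb_map p = edge_pt e p.1.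
Proof.
move=> Kp; rewrite /reeb_map /closed_edge; destruct (lab p) as [v|f] eqn:lp.
  move=> /or3P[//|/eqP[ve]|/eqP[ve]]; rewrite (lay_vx L Kp lp) /edge_pt ve.
    by rewrite edge_par_src subr0 scale1r scale0r addr0.
  by rewrite edge_par_tgt subrr scale1r scale0r add0r.
by move=> /or3P[/eqP[->]||].
Qed.

Lemma edge_pt_continuous e : continuous (fun p : R * R => edge_pt e p.1).
Proof.
move=> p; have cp : (edge_par e \o fst) q @[q --> p] --> edge_par e p.1.
  apply: cvgM; last exact: cvg_cst.
  by apply: cvgB; [exact: cvg_fst|exact: cvg_cst].
apply: cvgD; apply: cvgZr_tmp.
  by apply: cvgB => //; exact: cvg_cst.
exact: cp.
Qed.

Lemma edge_cover p : K p -> exists e, closed_edge e (lab p).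
Proof.
move=> Kp; destruct (lab p) as [v|e] eqn:lp.
  have [e /orP[]/eqP ev] := simpleG.1 v; exists e;
    by rewrite /closed_edge ev eqxx ?orbT.
by exists e; rewrite /closed_edge eqxx.
Qed.

(** The closed preimages of the edges are finitely many and cover [K], so it is
    enough to have continuity on each of them. *)
Lemma reeb_map_continuous : {within K, continuous reeb_map}.
Proof.
pose Z (e : edge G) := [set p | K p /\ closed_edge e (lab p)].
have -> : K = \big[setU/set0]_(e <- enum (edge G)) Z e.
  rewrite -bigcup_seq; apply/seteqP; split=> p /=; last by case=> e _ [].
  by move=> Kp; have [e ep] := edge_cover Kp; exists e => //=; rewrite mem_enum.
suff : closed (\big[setU/set0]_(e <- enum (edge G)) Z e) /\
    {within \big[setU/set0]_(e <- enum (edge G)) Z e, continuous reeb_map} by case.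
apply: (big_ind (fun A => closed A /\ {within A, continuous reeb_map})).
- by split; [exact: closed0|exact: continuous_subspace0].
- move=> A B [cA fA] [cB fB]; split; first exact: closedU.
  exact: withinU_continuous.
- move=> e _; split; first exact: (lay_closed L).
  apply: (@subspace_eq_continuous _ _ _ (fun p => edge_pt e p.1)).
    by move=> p /set_mem[Kp ep]; exact/esym/reeb_map_edge.
  exact/continuous_subspaceT/edge_pt_continuous.
Qed.

Lemma edge_pt_coord e x w : edge_pt e x 0 (enum_rank w) =
  (1 - edge_par e x) * (src e == w)%:R + edge_par e x * (tgt e == w)%:R.
Proof.
rewrite mxE [X in X + _]mxE [X in _ + X]mxE.
by rewrite -!/(vertex_pt R _) !vertex_ptE.
Qed.

Lemma src_neq_tgt (e : edge G) : (src e == tgt e) = false.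
Proof. by apply/negbTE/negP => /eqP E; have := lay_ends L e; rewrite E eqxx. Qed.

Lemma edge_pt_vertex e x v : btw (xv (src e)) (xv (tgt e)) x ->
  edge_pt e x <> vpt v.
Proof.
rewrite edge_par_btw => /andP[t0 t1] E.
have := edge_pt_coord e x (src e); rewrite E vertex_ptE eqxx [tgt e == _]eq_sym src_neq_tgt mulr1 mulr0 addr0.
have := edge_pt_coord e x (tgt e); rewrite E vertex_ptE eqxx src_neq_tgt mulr1 mulr0 add0r.
by case: eqP; case: eqP => _ _ /=; lra.
Qed.

Lemma edge_pt_inj e f x y : btw (xv (src e)) (xv (tgt e)) x ->
  btw (xv (src f)) (xv (tgt f)) y -> edge_pt e x = edge_pt f y ->
  e = f /\ x = y.
Proof.
rewrite !edge_par_btw => /andP[t0 t1] /andP[s0 s1] E.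
have C w := congr1 (fun u : 'rV[R]_#|vertex G| => u 0 (enum_rank w)) E.
have Cs := C (src e); have Ct := C (tgt e).
rewrite !edge_pt_coord !eqxx src_neq_tgt [tgt e == src e]eq_sym src_neq_tgt in Cs Ct.
have ef : e = f.
  have He : src e <> tgt e by move/eqP; rewrite src_neq_tgt.
  have Hf : src f <> tgt f by move/eqP; rewrite src_neq_tgt.
  apply: simpleG.2; move: Cs Ct.
  case: (src f =P src e) => a; case: (tgt f =P src e) => b;
    case: (src f =P tgt e) => c; case: (tgt f =P tgt e) => d /= Cs Ct;
    try (exfalso; lra); try (exfalso; congruence).
  - by left; split; congruence.
  - by right; split; congruence.
split=> //; subst f; apply: (@edge_par_inj e).
by move: Cs; rewrite eqxx [tgt e == src e]eq_sym src_neq_tgt /=; lra.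
Qed.

Lemma reeb_map_inj p q : K p -> K q -> reeb_map p = reeb_map q ->
  lab p = lab q /\ p.1 = q.1.
Proof.
move=> Kp Kq; rewrite /reeb_map.
destruct (lab p) as [v|e] eqn:lp; destruct (lab q) as [w|f] eqn:lq.
- move/vertex_pt_inj => vw; rewrite (lay_vx L Kp lp) (lay_vx L Kq lq).
  by rewrite vw.
- by move/esym/edge_pt_vertex; case; exact: (lay_ex L Kq lq).
- by move/edge_pt_vertex; case; exact: (lay_ex L Kp lp).
- case/edge_pt_inj; [exact: (lay_ex L Kp lp)|exact: (lay_ex L Kq lq)|].
  by move=> -> ->.
Qed.

Lemma reeb_map_realization p : K p -> realization R G (reeb_map p).
Proof.
rewrite /reeb_map => Kp; destruct (lab p) as [v|e] eqn:lp; first by left; exists v.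
right; exists e, (edge_par e p.1); split=> //.
by have := lay_ex L Kp lp; rewrite edge_par_btw => /andP[/ltW -> /ltW ->].
Qed.

Lemma reeb_map_onto u : realization R G u -> exists2 p, K p & reeb_map p = u.
Proof.
have onV v : exists2 p, K p & reeb_map p = vpt v.
  by have [p [Kp lp]] := lay_v L v; exists p => //; rewrite /reeb_map lp.
case=> [[v ->]|[e [t [/andP[t0 t1] ->]]]]; first exact: onV.
move: t0 t1; rewrite !le_eqVlt => /orP[/eqP <- _|t0].
  by rewrite subr0 scale1r scale0r addr0; exact: onV.
case/orP => [/eqP ->|t1].
  by rewrite subrr scale1r scale0r add0r; exact: onV.
pose x := xv (src e) + t * (xv (tgt e) - xv (src e)).
have tx : edge_par e x = t by rewrite /edge_par addrC addKr mulfK // edge_dne.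
have [|p [Kp lp px]] := lay_e L (e := e) (t := x).
  by rewrite edge_par_btw tx t0 t1.
by exists p => //; rewrite /reeb_map lp px /edge_pt tx.
Qed.

Definition slice (l : vertex G + edge G) (t : R) : set (R * R) :=
  [set p | [/\ K p, lab p = l & p.1 = t]].

Lemma slice_closed l t : closed (slice l t).
Proof.
case: l => [v|e].
  have [e ev] := simpleG.1 v.
  have -> : slice (inl v) t = [set p | K p /\ lab p = inl v] `&` [set p | p.1 = t].
    by apply/seteqP; split=> p /= [] // [].
  by apply: closedI; [exact: (layout_vertex_closed L ev)|exact: closed_fst].
case bt: (btw (xv (src e)) (xv (tgt e)) t); last first.
  have -> : slice (inr e) t = set0; last exact: closed0.
  by rewrite -subset0 => p [Kp lp px]; have := lay_ex L Kp lp; rewrite px bt.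
have -> : slice (inr e) t = [set p | K p /\ closed_edge e (lab p)] `&` [set p | p.1 = t].
  apply/seteqP; split=> p /=.
    by case=> Kp lp px; rewrite /closed_edge lp eqxx.
  case=> -[Kp ep] px; split=> //; move: ep => /or3P[]/eqP lp //.
    by have := btw_neq bt; rewrite -px (lay_vx L Kp lp) eqxx.
  by have := btw_neq bt; rewrite -px (lay_vx L Kp lp) eqxx andbF.
by apply: closedI; [exact: (lay_closed L)|exact: closed_fst].
Qed.

Lemma vertical_connected (x a b : R) : connected [set p : R * R | p.1 = x /\ a <= p.2 <= b].
Proof.
have -> : [set p : R * R | p.1 = x /\ a <= p.2 <= b] = (fun y => (x, y)) @` `[a, b]%classic.
  apply/seteqP; split=> [[p1 p2] /= [-> ab]|p /= [y]].
    by exists p2 => //=; rewrite in_itv.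
  by rewrite in_itv /= => ab <-.
apply: connected_continuous_connected; first exact: segment_connected.
apply: continuous_subspaceT => y.
by apply: cvg_pair_nbhs; [exact: cvg_cst|exact: cvg_id].
Qed.

(** A fiber is the disjoint union of finitely many closed slices, one for each
    label, so a component cannot meet two of them; and a slice is an interval. *)
Lemma same_componentP (p q : R * R) : K p -> K q ->
  connected_component (fiber fst X p.1) p q <-> lab p = lab q /\ p.1 = q.1.
Proof.
move=> Kp Kq; split=> [pq|[lpq pq]].
  have Cfib : connected_component (fiber fst X p.1) p `<=` fiber fst X p.1.
    exact: connected_component_sub.
  have [_ /= qp] := Cfib _ pq.
  split=> //; pose C := connected_component (fiber fst X p.1) p.
  have Cp : C p by apply: connected_component_refl; split.
  have conC : connected C by exact: component_connected.
  have /conC : (C `&` slice (lab p) p.1) !=set0 by exists p; split.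
  have /[swap] /[apply] : exists2 D, closed D & C `&` slice (lab p) p.1 = C `&` D.
    by exists (slice (lab p) p.1) => //; exact: slice_closed.
  have : exists2 D, open D & C `&` slice (lab p) p.1 = C `&` D.
    pose F := \bigcup_(l in [set l | l <> lab p]) slice l p.1.
    have clF : closed F.
      by apply: closed_bigcup => [|l _]; [exact: finite_finset|exact: slice_closed].
    exists (~` F); first by rewrite openC.
    apply/seteqP; split=> r /= [Cr]; [move=> [Kr lr rp]|move=> nFr]; split=> //.
      by case=> l /= ll [_ lr' _]; apply: ll; rewrite -lr'.
    have [Kr /= rp] := Cfib _ Cr; split=> //.
    apply: contrapT => lr; apply: nFr; by exists (lab r).
  move=> /[swap] /[apply] E.
  have : C q by []. rewrite -/C.
  by rewrite -E => -[_ [_ -> _]].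
have main a b : K a -> K b -> lab a = lab b -> a.1 = b.1 -> a.2 <= b.2 ->
    connected_component (fiber fst X a.1) a b.
  move=> Ka Kb lab_ab ab ab2.
  apply: (connected_component_max (B := [set r | r.1 = a.1 /\ a.2 <= r.2 <= b.2])).
  - by split=> //; rewrite lexx ab2.
  - move=> [r1 r2] /= [-> r_ab]; split=> //.
    by have [] := lay_convex L Ka Kb lab_ab ab r_ab.
  - exact: vertical_connected.
  - by split; [exact: esym|rewrite ab2 lexx].
have [le|/ltW le] := leP p.2 q.2; first exact: main.
by rewrite pq; apply: connected_component_sym; apply: main.
Qed.

Lemma same_component_map (x y : K) :
  same_component fst x y = (reeb_map (val x) == reeb_map (val y)).
Proof.
have Kx := set_mem (valP x); have Ky := set_mem (valP y).
apply/asboolP/eqP.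
  by case/(same_componentP Kx Ky) => lxy xy; rewrite /reeb_map lxy xy.
by move/(reeb_map_inj Kx Ky)/(same_componentP Kx Ky).
Qed.

Lemma reeb_pi_eq (x y : K) :
  reeb_pi fst x = reeb_pi fst y <-> reeb_map (val x) = reeb_map (val y).
Proof.
rewrite /reeb_pi; split=> [/eqmodP /=|E].
  by rewrite same_component_map => /eqP.
by apply/eqmodP; rewrite /= same_component_map E eqxx.
Qed.

Definition to_realization (x : K) : realization R G :=
  exist _ (reeb_map (val x)) (mem_set (reeb_map_realization (set_mem (valP x)))).

Lemma to_realization_continuous : continuous to_realization.
Proof.
apply: (@continuous_comp_initial _ _ _ (set_val : realization R G -> _)).
have /subspace_sigL_continuousP := reeb_map_continuous.
exact.
Qed.

Definition of_realization_pt (u : realization R G) : K :=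
  let h := cid2 (reeb_map_onto (set_mem (valP u))) in
  exist _ (s2val h) (mem_set (s2valP h)).

Lemma of_realization_ptK u : reeb_map (val (of_realization_pt u)) = val u.
Proof. by rewrite /of_realization_pt /=; case: cid2. Qed.

(** [reeb_map] induces a continuous bijection from the quotient of [K] onto the
    realization. Its inverse is continuous because [reeb_map] maps the closed,
    hence compact, subsets of [K] to closed sets. *)
Theorem layout_reeb_isomorphic : reeb_isomorphic fst X G.
Proof.
pose f : reeb fst X -> realization R G := to_realization \o repr.
pose g : realization R G -> reeb fst X := fun u => reeb_pi fst (of_realization_pt u).
have reprE (q : reeb fst X) : reeb_pi fst (repr q) = q by exact: reprK.
have fE x : val (f (reeb_pi fst x)) = reeb_map (val x).
  by rewrite /f /=; apply/reeb_pi_eq; rewrite reprE.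
exists f, g; split.
- apply: repr_comp_continuous; first exact: to_realization_continuous.
  move=> x y /eqP /reeb_pi_eq E; apply/eqP/val_inj; exact: E.
- apply/continuous_closedP => A clA.
  have [C clC EC] : exists2 C, closed C &
      @reeb_pi R fst X @^-1` A = set_val @^-1` C.
    have /continuous_closedP/(_ _ clA) : continuous (@reeb_pi R fst X).
      exact: pi_continuous.
    rewrite -openC => -[U oU EU]; exists (~` U); first by rewrite closedC.
    by rewrite -[LHS]setCK -EU.
  have cB : compact (K `&` C) by exact: compact_closedI.
  have cI : compact (reeb_map @` (K `&` C)).
    apply: continuous_compact cB; apply: continuous_subspaceW reeb_map_continuous.
    exact: subIsetl.
  have := compact_closed (@norm_hausdorff _ _) cI.
  have -> : g @^-1` A = set_val @^-1` (reeb_map @` (K `&` C)).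
    apply/seteqP; split=> u /=.
      move=> gu; exists (val (of_realization_pt u)); last exact: of_realization_ptK.
      split; first exact: set_mem (valP _).
      by have : (@reeb_pi R fst X @^-1` A) (of_realization_pt u) by []; rewrite EC.
    case=> p [Kp Cp] pu.
    pose x : K := exist _ p (mem_set Kp).
    have : (@reeb_pi R fst X @^-1` A) x by rewrite EC.
    suff -> : g u = reeb_pi fst x by [].
    by apply/reeb_pi_eq; rewrite of_realization_ptK /= pu.
  move=> clI; have /continuous_closedP := @initial_continuous _ _ (set_val : realization R G -> _).
  exact.
- move=> q; rewrite -[RHS]reprE; apply/reeb_pi_eq.
  by rewrite of_realization_ptK.
- by move=> u; apply: val_inj; rewrite fE of_realization_ptK.
- move=> q; rewrite -(reprE q) fE; split.
    case=> x [sx /reeb_pi_eq <-]; have [v lv] := sing_vertex sx.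
    by exists v; rewrite /reeb_map lv.
  case=> v Ev; have [p sp lp] := vertex_sing v.
  have Kp : K p by case: sp => -[].
  exists (exist _ p (mem_set Kp)); split=> //.
  by apply/reeb_pi_eq; rewrite Ev /= /reeb_map lp.
Qed.

End Reeb.

(** * Punctured disks *)

Lemma comb_connected (T : topologicalType) (A B : set T) :
  connected B -> B `<=` A ->
  (forall p, A p -> exists C, [/\ connected C, C `<=` A, C p & C `&` B !=set0]) ->
  connected A.
Proof.
move=> cB BA hA.
have [[b Bb]|B0] := pselect (B !=set0); last first.
  suff -> : A = set0 by exact: connected0.
  rewrite -subset0 => p /hA[C [_ _ _ [q [_ Bq]]]]; apply: B0; by exists q.
pose F (p : T) : set T := \bigcup_(C in [set C | [/\ connected C, C `<=` A, C p & C `&` B !=set0]]) (C `|` B).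
have -> : A = \bigcup_(p in A) F p.
  apply/seteqP; split=> p.
    move=> Ap; exists p => //; have [C HC] := hA p Ap.
    by exists C => //; left; case: HC.
  by case=> q Aq [C [_ CA _ _]] [/CA|/BA].
apply: bigcup_connected.
  exists b => q Aq; have [C HC] := hA q Aq; by exists C => //; right.
move=> q Aq; apply: bigcup_connected.
  by exists b => C HC; right.
move=> C [cC CA Cq [r [Cr Br]]]; apply: connectedU => //.
by exists r.
Qed.

(** [D'] is obtained by cutting a piece out of [D]. If [B] is clopen in [D'], the
    connected set [N `&` D'] lies in [B] or in its complement; whichever of the
    two misses [N] is then clopen in [D] as well, since it stays away from the
    piece. So only what happens near the piece matters. *)
Lemma connected_cut (T : topologicalType) (D D' N : set T) :
  connected D -> open D' -> D' `<=` D -> open N ->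
  D `\` D' `<=` N -> connected (N `&` D') -> connected D'.
Proof.
move=> cD oD' D'D oN cut cN.
have key B : B !=set0 -> B `<=` D' -> B `&` N = set0 ->
    (exists2 C, open C & B = D' `&` C) -> (exists2 C, closed C & B = D' `&` C) ->
    B = D'.
  move=> B0 BD' BN [U oU BU] [C clC BC].
  suff BD : B = D by apply/seteqP; split=> // p /D'D; rewrite BD.
  apply: cD => //.
    exists (D' `&` U); first exact: openI.
    by rewrite BU; apply/seteqP; split=> p /=; [case=> /[dup] /D'D|case=> _ []].
  exists (closure B); first exact: closed_closure.
  apply/seteqP; split=> p.
    by move=> Bp; split; [apply/D'D/BD'|exact: subset_closure].
  case=> Dp clp.
  have [D'p|nD'p] := pselect (D' p).
    rewrite BC; split=> //; apply: clC; move: clp.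
    by apply: closure_subset; rewrite BC; exact: subIsetr.
  have Np : nbhs p N by apply: open_nbhs_nbhs; split=> //; apply: cut.
  have [q [Bq Nq]] := clp _ Np.
  by have : (B `&` N) q by []; rewrite BN.
move=> B B0 [U oU BU] [C clC BC].
have BD' : B `<=` D' by rewrite BU; exact: subIsetl.
pose B' := D' `\` B.
have oB' : exists2 V, open V & B' = D' `&` V.
  exists (~` C); first by rewrite openC.
  rewrite /B' BC; apply/seteqP; split=> p /=; case=> D'p nC; split=> //.
    by move=> Cp; apply: nC.
  by case.
have clB' : exists2 V, closed V & B' = D' `&` V.
  exists (~` U); first by rewrite closedC.
  rewrite /B' BU; apply/seteqP; split=> p /=; case=> D'p nC; split=> //.
    by move=> Cp; apply: nC.
  by case.
(* either [B] or its complement in [D'] misses [N] *)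
have [BN|/set0P BN] := eqVneq (B `&` N) set0.
  by apply: key => //; [exists U|exists C].
have NB : N `&` D' `<=` B.
  have E : (N `&` D') `&` B = N `&` D'.
    apply: cN.
    - by case: BN => p [Bp Np]; exists p; split=> //; split=> //; exact: BD'.
    - by exists U => //; rewrite BU setIA -[N `&` D' `&` D']setIA setIid.
    - by exists C => //; rewrite BC setIA -[N `&` D' `&` D']setIA setIid.
  by rewrite -E; exact: subIsetr.
apply: contrapT => nBD'.
have B'0 : B' !=set0.
  apply: contrapT => B'0; apply: nBD'; apply/seteqP; split=> // p D'p.
  by apply: contrapT => nBp; apply: B'0; exists p.
have B'D' : B' = D'.
  apply: key => //; first by move=> p [].
  rewrite -subset0 => p [[D'p nBp] Np]; apply: nBp; exact: NB.
case: B0 => p Bp; have : D' p by exact: BD'.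
by rewrite -B'D' => -[].
Qed.

Section Punctured.
Variable R : realType.
Implicit Types (S C : circle R) (p q : R * R) (cs : seq (circle R)).

(** The power of a point with respect to a circle. *)
Definition pow S p : R :=
  (p.1 - (center S).1) ^+ 2 + (p.2 - (center S).2) ^+ 2 - radius S ^+ 2.

Lemma radius_gt0 S : 0 < radius S.
Proof. exact: valP S. Qed.

Lemma enorm_ge0 p : 0 <= enorm p.
Proof. exact: sqrtr_ge0. Qed.

Lemma enorm_sqr p : enorm p ^+ 2 = p.1 ^+ 2 + p.2 ^+ 2.
Proof.
by rewrite /enorm /dot -!expr2 sqr_sqrtr // addr_ge0 // sqr_ge0.
Qed.

Lemma enorm_pow S p : enorm (p - center S) ^+ 2 = pow S p + radius S ^+ 2.
Proof. by rewrite enorm_sqr /pow /= subrK. Qed.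

Lemma open_diskP S p : open_disk S p <-> pow S p < 0.
Proof.
rewrite /open_disk /=; have r0 := radius_gt0 S; have n0 := enorm_ge0 (p - center S).
by have := enorm_pow S p; split=> h; nra.
Qed.

Lemma closed_diskP S p : closed_disk S p <-> pow S p <= 0.
Proof.
rewrite /closed_disk /=; have r0 := radius_gt0 S; have n0 := enorm_ge0 (p - center S).
by have := enorm_pow S p; split=> h; nra.
Qed.

Lemma circle_setP S p : circle_set S p <-> pow S p = 0.
Proof.
rewrite /circle_set /=; have r0 := radius_gt0 S; have n0 := enorm_ge0 (p - center S).
have := enorm_pow S p; split=> h; first by nra.
have : (enorm (p - center S) - radius S) * (enorm (p - center S) + radius S) = 0 by nra.
move/eqP; rewrite mulf_eq0 => /orP[|]/eqP; lra.
Qed.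

Lemma pow_continuous S : continuous (pow S).
Proof.
move=> p.
have c1 : (fun q : R * R => q.1 - (center S).1) q @[q --> p] --> p.1 - (center S).1.
  by apply: cvgB; [exact: cvg_fst|exact: cvg_cst].
have c2 : (fun q : R * R => q.2 - (center S).2) q @[q --> p] --> p.2 - (center S).2.
  by apply: cvgB; [exact: cvg_snd|exact: cvg_cst].
apply: cvgB; last exact: cvg_cst.
by apply: cvgD; [exact: (cvgM c1 c1)|exact: (cvgM c2 c2)].
Qed.

Lemma pow_unit p : pow (unit_circle R) p = p.1 ^+ 2 + p.2 ^+ 2 - 1.
Proof. by rewrite /pow /center /radius /= !subr0 expr1n. Qed.

(** The regions to be constructed are the unit disk minus finitely many closed
    disks. *)
Definition open_region cs : set (R * R) :=
  [set p | pow (unit_circle R) p < 0 /\ forall S, S \in cs -> 0 < pow S p].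

Definition closed_region cs : set (R * R) :=
  [set p | pow (unit_circle R) p <= 0 /\ forall S, S \in cs -> 0 <= pow S p].

Definition punctured cs : ss_pair R :=
  SSPair (open_region cs) (unit_circle R :: cs).

Lemma pow_open_lt S : open [set p | pow S p < 0].
Proof.
apply: (@open_comp _ _ (pow S) [set t | t < 0]); last exact: open_lt.
by move=> p _; exact: pow_continuous.
Qed.

Lemma pow_open_gt S : open [set p | 0 < pow S p].
Proof.
apply: (@open_comp _ _ (pow S) [set t | 0 < t]); last exact: open_gt.
by move=> p _; exact: pow_continuous.
Qed.

Lemma pow_closed_le S : closed [set p | pow S p <= 0].
Proof.
apply: (@closed_comp _ _ (pow S) [set t | t <= 0]); last exact: closed_le.
by move=> p _; exact: pow_continuous.
Qed.

Lemma pow_closed_ge S : closed [set p | 0 <= pow S p].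
Proof.
apply: (@closed_comp _ _ (pow S) [set t | 0 <= t]); last exact: closed_ge.
by move=> p _; exact: pow_continuous.
Qed.

Lemma open_region_rcons cs S :
  open_region (rcons cs S) = open_region cs `&` [set p | 0 < pow S p].
Proof.
apply/seteqP; split=> p /=.
  case=> up hp; split; last by apply: hp; rewrite mem_rcons mem_head.
  by split=> // C Ccs; apply: hp; rewrite mem_rcons inE Ccs orbT.
case=> -[up hp] Sp; split=> // C; rewrite mem_rcons inE => /orP[/eqP -> //|].
exact: hp.
Qed.

Lemma closed_region_rcons cs S :
  closed_region (rcons cs S) = closed_region cs `&` [set p | 0 <= pow S p].
Proof.
apply/seteqP; split=> p /=.
  case=> up hp; split; last by apply: hp; rewrite mem_rcons mem_head.
  by split=> // C Ccs; apply: hp; rewrite mem_rcons inE Ccs orbT.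
case=> -[up hp] Sp; split=> // C; rewrite mem_rcons inE => /orP[/eqP -> //|].
exact: hp.
Qed.

Lemma open_region_open cs : open (open_region cs).
Proof.
elim/last_ind: cs => [|cs S IH].
  have -> : open_region [::] = [set p | pow (unit_circle R) p < 0].
    by apply/seteqP; split=> p /=; [case|].
  exact: pow_open_lt.
by rewrite open_region_rcons; apply: openI => //; exact: pow_open_gt.
Qed.

Lemma closed_region_closed cs : closed (closed_region cs).
Proof.
elim/last_ind: cs => [|cs S IH].
  have -> : closed_region [::] = [set p | pow (unit_circle R) p <= 0].
    by apply/seteqP; split=> p /=; [case|].
  exact: pow_closed_le.
by rewrite closed_region_rcons; apply: closedI => //; exact: pow_closed_ge.
Qed.

Lemma open_region_sub cs : open_region cs `<=` closed_region cs.
Proof. by move=> p [up hp]; split=> [|S /hp]; exact: ltW. Qed.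

Lemma remove_disk_punctured cs S :
  remove_disk (punctured cs) S = punctured (rcons cs S).
Proof.
rewrite /remove_disk /punctured /= open_region_rcons; congr SSPair.
apply/seteqP; split=> p /= [Dp]; move=> h; split=> //.
  by rewrite ltNge; apply/negP => /closed_diskP.
by move/closed_diskP; rewrite leNgt h.
Qed.

Lemma unit_disk_punctured : unit_disk R = punctured [::].
Proof.
congr SSPair; apply/seteqP; split=> p; first by move/open_diskP => ?; split.
by case=> up _; apply/open_diskP.
Qed.

(** It is closed and contained in the square of side 2. *)
Lemma closed_region_compact cs : compact (closed_region cs).
Proof.
have cB := compact_setX (@segment_compact R (-1) 1) (@segment_compact R (-1) 1).
apply: subclosed_compact cB _; first exact: closed_region_closed.
move=> p [+ _]; rewrite pow_unit => up.
by split; rewrite /= in_itv /=; apply/andP; split; nra.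
Qed.

Lemma region_boundary cs p : closed_region cs p ->
  ~ open_region cs p <-> exists2 S, S \in unit_circle R :: cs & pow S p = 0.
Proof.
move=> [up hp]; split; last first.
  case=> S; rewrite inE => /orP[/eqP ->|Scs] Sp [up' hp'].
    by rewrite Sp ltxx in up'.
  by have := hp' S Scs; rewrite Sp ltxx.
move=> nD; apply: contrapT => nS; apply: nD; split.
  rewrite lt_neqAle up andbT; apply/eqP => up0.
  by apply: nS; exists (unit_circle R); rewrite ?mem_head.
move=> S Scs; rewrite lt_neqAle hp // andbT eq_sym; apply/eqP => Sp0.
by apply: nS; exists S; rewrite // inE Scs orbT.
Qed.

Lemma bd_punctured cs p : closure (open_region cs) = closed_region cs ->
  bd (punctured cs) p <->
  closed_region cs p /\ exists2 S, S \in unit_circle R :: cs & pow S p = 0.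
Proof.
move=> clE; rewrite /bd /= clE; split=> -[Kp h]; split=> //.
  exact/(region_boundary Kp).
exact/(region_boundary Kp).
Qed.

End Punctured.

(** * Removing one more disk *)

Section Removal.
Variable R : realType.
Implicit Types (S C : circle R) (p q : R * R) (cs : seq (circle R)).

Definition in_box (xl xr yl yu : R) p : bool :=
  (xl < p.1 < xr) && (yl < p.2 < yu).

(** In the box, the region lies under the graph of [z], which is an arc of [S];
    [sg] tells on which side of [S] it lies. *)
Record local_graph cs S (sg xl xr yl yu : R) (z : R -> R) : Prop := LocalGraph {
  lg_in : S \in unit_circle R :: cs;
  lg_only : forall C p, C \in unit_circle R :: cs -> C != S ->
    in_box xl xr yl yu p -> pow C p != 0;
  lg_sg : sg = 1 \/ sg = -1;
  lg_closed : forall p, in_box xl xr yl yu p ->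
    closed_region cs p <-> p.2 <= z p.1;
  lg_open : forall p, in_box xl xr yl yu p ->
    open_region cs p <-> p.2 < z p.1;
  lg_le : forall p, in_box xl xr yl yu p -> (p.2 <= z p.1) = (sg * pow S p <= 0);
  lg_lt : forall p, in_box xl xr yl yu p -> (p.2 < z p.1) = (sg * pow S p < 0);
  lg_z : forall x, xl < x < xr -> yl < z x < yu }.

Lemma open_box (xl xr yl yu : R) : open [set p | in_box xl xr yl yu p].
Proof.
have o1 (a : R) : open [set p : R * R | a < p.1].
  apply: (@open_comp _ _ fst [set t | a < t]); last exact: open_gt.
  by move=> p _; exact: cvg_fst.
have o2 (a : R) : open [set p : R * R | p.1 < a].
  apply: (@open_comp _ _ fst [set t | t < a]); last exact: open_lt.
  by move=> p _; exact: cvg_fst.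
have o3 (a : R) : open [set p : R * R | a < p.2].
  apply: (@open_comp _ _ snd [set t | a < t]); last exact: open_gt.
  by move=> p _; exact: cvg_snd.
have o4 (a : R) : open [set p : R * R | p.2 < a].
  apply: (@open_comp _ _ snd [set t | t < a]); last exact: open_lt.
  by move=> p _; exact: cvg_snd.
have -> : [set p | in_box xl xr yl yu p] =
  ([set p | xl < p.1] `&` [set p | p.1 < xr]) `&` ([set p | yl < p.2] `&` [set p | p.2 < yu]).
  apply/seteqP; split=> p; rewrite /in_box /=; first by move=> /andP[/andP[? ?] /andP[? ?]].
  by case=> -[-> ->] [-> ->].
by apply: openI; apply: openI.
Qed.

(** Nonzero exactly when the normals, hence the tangents, are transversal. *)
Definition cross (u v : R * R) : R := u.1 * v.2 - u.2 * v.1.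

Lemma transversal_direct_sum S C p : cross (p - center S) (p - center C) != 0 ->
  direct_sum_plane (tangent S p) (tangent C p).
Proof.
rewrite /cross /tangent /dot /=.
set g1 := p.1 - (center S).1; set g2 := p.2 - (center S).2.
set h1 := p.1 - (center C).1; set h2 := p.2 - (center C).2 => D0.
split.
  move=> [w1 w2].
  pose k := (h1 * w1 + h2 * w2) / (g1 * h2 - g2 * h1).
  exists (- g2 * k, g1 * k), (w1 + g2 * k, w2 - g1 * k); split=> /=.
  - by ring.
  - by rewrite /k; field.
  - by congr pair; rewrite /=; ring.
move=> [v1 v2] /= e1 e2; congr pair; apply: (mulfI D0); rewrite mulr0.
  have -> : (g1 * h2 - g2 * h1) * v1 =
    h2 * (g1 * v1 + g2 * v2) - g2 * (h1 * v1 + h2 * v2) by ring.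
  by rewrite e1 e2 !mulr0 subrr.
have -> : (g1 * h2 - g2 * h1) * v2 =
  g1 * (h1 * v1 + h2 * v2) - h1 * (g1 * v1 + g2 * v2) by ring.
by rewrite e1 e2 !mulr0 subrr.
Qed.

(** The normals of [S] and [C] are independent, so that some direction has
    prescribed scalar products with both; to first order, these are the
    variations of the two powers. *)
Lemma transversal_step S C p (s : R) : cross (p - center S) (p - center C) != 0 ->
  pow S p = 0 -> pow C p = 0 -> s = 1 \/ s = -1 ->
  exists v : R * R, exists2 d : R, 0 < d & forall t, 0 < t < d ->
    s * pow S (p + t *: v) < 0 /\ 0 < pow C (p + t *: v).
Proof.
rewrite /cross /pow /=.
set g1 := p.1 - (center S).1; set g2 := p.2 - (center S).2.
set h1 := p.1 - (center C).1; set h2 := p.2 - (center C).2 => D0 pS pC hs.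
pose D := g1 * h2 - g2 * h1.
pose v1 := (- s * h2 - g2) / D; pose v2 := (g1 + s * h1) / D.
have e1 : g1 * v1 + g2 * v2 = - s by rewrite /v1 /v2 /D; field.
have e2 : h1 * v1 + h2 * v2 = 1 by rewrite /v1 /v2 /D; field.
pose n := v1 ^+ 2 + v2 ^+ 2.
have n0 : 0 <= n by rewrite addr_ge0 // sqr_ge0.
have n1 : 0 < n + 1 by lra.
exists (v1, v2), (2 / (n + 1)); first by rewrite divr_gt0.
move=> t /andP[t0]; rewrite ltr_pdivlMr // => tn.
rewrite -[t *: (v1, v2).1]/(t * v1) -[t *: (v1, v2).2]/(t * v2).
have -> : p.1 + t * v1 - (center S).1 = g1 + t * v1 by rewrite /g1; ring.
have -> : p.2 + t * v2 - (center S).2 = g2 + t * v2 by rewrite /g2; ring.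
have -> : p.1 + t * v1 - (center C).1 = h1 + t * v1 by rewrite /h1; ring.
have -> : p.2 + t * v2 - (center C).2 = h2 + t * v2 by rewrite /h2; ring.
have -> : (g1 + t * v1) ^+ 2 + (g2 + t * v2) ^+ 2 - radius S ^+ 2 =
   (g1 ^+ 2 + g2 ^+ 2 - radius S ^+ 2) + 2 * t * (g1 * v1 + g2 * v2) + t * (t * n).
  by rewrite /n; ring.
have -> : (h1 + t * v1) ^+ 2 + (h2 + t * v2) ^+ 2 - radius C ^+ 2 =
   (h1 ^+ 2 + h2 ^+ 2 - radius C ^+ 2) + 2 * t * (h1 * v1 + h2 * v2) + t * (t * n).
  by rewrite /n; ring.
rewrite pS pC e1 e2.
have tn2 : t * n < 2 by nra.
have tn0 : 0 <= t * n by rewrite mulr_ge0 // ltW.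
by split; [case: hs => -> ; nra|nra].
Qed.

Lemma open_region_off cs p D : open_region cs p ->
  D \in unit_circle R :: cs -> pow D p <> 0.
Proof.
move=> [up hp]; rewrite inE => /orP[/eqP ->|/hp Dp] E; first by rewrite E ltxx in up.
by rewrite E ltxx in Dp.
Qed.

Section Fresh.
Variables (cs : seq (circle R)) (S C : circle R) (a b : R * R).
Variables (sg xl xr yl yu : R) (z : R -> R).
Local Notation Q := (in_box xl xr yl yu).
Hypothesis lg : local_graph cs S sg xl xr yl yu z.
Hypothesis clE : closure (open_region cs) = closed_region cs.
Hypothesis ssX : is_ss_region (punctured cs).
Hypothesis disk_box : forall p, closed_region cs p -> pow C p <= 0 -> Q p.
Hypothesis Qa : Q a.
Hypothesis Qb : Q b.
Hypothesis (Sa : pow S a = 0) (Ca : pow C a = 0).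
Hypothesis (Sb : pow S b = 0) (Cb : pow C b = 0).
Hypothesis meet : forall p, Q p -> pow S p = 0 -> pow C p = 0 -> p = a \/ p = b.
Hypothesis trans : forall p, p = a \/ p = b ->
  cross (p - center S) (p - center C) != 0.
Hypothesis conn : connected (open_region (rcons cs C)).

Lemma on_graph p : Q p -> pow S p = 0 <-> p.2 = z p.1.
Proof.
move=> Qp; have h1 := lg_le lg Qp; have h2 := lg_lt lg Qp.
split=> [e0|e].
  rewrite e0 mulr0 lexx in h1; rewrite e0 mulr0 ltxx in h2.
  by apply/eqP; rewrite eq_le h1 leNgt h2.
rewrite e lexx in h1; rewrite e ltxx in h2.
have : sg * pow S p = 0 by apply/eqP; rewrite eq_le -h1 leNgt -h2.
by case: (lg_sg lg) => ->; lra.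
Qed.

Lemma ab_closed p : p = a \/ p = b -> closed_region cs p.
Proof.
by case=> ->; [apply/(lg_closed lg Qa)|apply/(lg_closed lg Qb)];
   rewrite (on_graph _).1.
Qed.

Lemma box_other_circle D p : D \in unit_circle R :: cs -> Q p -> pow D p = 0 -> D = S.
Proof.
move=> Dcs Qp Dp; apply/eqP; apply: contraT => DS.
by have := lg_only lg Dcs DS Qp; rewrite Dp eqxx.
Qed.

Lemma C_fresh : C \notin unit_circle R :: cs.
Proof.
apply/negP => Ccs; have CS := box_other_circle Ccs Qa Ca.
by have := trans (or_introl erefl : a = a \/ a = b); rewrite CS /cross mulrC subrr eqxx.
Qed.

Lemma C_neq_S : C != S.
Proof.
by apply: contra C_fresh => /eqP ->; exact: lg_in lg.
Qed.

Lemma in_circles D : (D \in unit_circle R :: rcons cs C) = (D == C) || (D \in unit_circle R :: cs).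
Proof. by rewrite -rcons_cons mem_rcons inE. Qed.

Lemma shift_near (p v : R * R) (U : set (R * R)) (d : R) : 0 < d -> nbhs p U ->
  exists2 t : R, 0 < t < d & U (p + t *: v).
Proof.
move=> d0 Up.
have : (fun t : R => p + t *: v) t @[t --> (0 : R)] --> p + 0 *: v.
  apply: cvgD; first exact: cvg_cst.
  by apply: cvgZr_tmp; exact: cvg_id.
rewrite scale0r addr0 => /(_ _ Up); rewrite nbhs_simpl /=.
move=> /nbhs_ballP[e /= e0 He].
exists (Num.min (e / 2) (d / 2)).
  by rewrite lt_min !divr_gt0 //= gt_min; apply/orP; right; lra.
apply: He; rewrite /ball /= sub0r normrN ger0_norm; last first.
  by rewrite le_min !divr_ge0 // ltW.
by rewrite gt_min; apply/orP; left; lra.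
Qed.

(** Removing the new open disk from the closure does not leave more than the
    closure of what remains: a point of [C] in the open region can be pushed
    radially outside the disk, and a corner is in the closure of one of the four
    angles made by [S] and [C]. *)
Lemma fresh_closure :
  closure (open_region (rcons cs C)) = closed_region (rcons cs C).
Proof.
apply/seteqP; split=> p.
  have := @closed_region_closed R (rcons cs C).
  by move/closure_id => ->; apply: closure_subset; exact: open_region_sub.
rewrite closed_region_rcons => -[Kp]; rewrite /= le_eqVlt => /orP[/eqP/esym Cp|Cp] U Up.
  have Qp : Q p by apply: disk_box => //; rewrite Cp.
  have [Sp|Sp] := eqVneq (pow S p) 0.
    have pab := meet Qp Sp Cp.
    (* a corner: enter the angle that is inside the region and outside [C] *)
    have [v [d d0 hv]] := transversal_step (trans pab) Sp Cp (lg_sg lg).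
    have [|t td [Ut Qt]] := @shift_near p v (U `&` [set p | Q p]) d d0.
      apply: filterI => //; apply: open_nbhs_nbhs; split=> //; exact: open_box.
    have [h1 h2] := hv t td.
    exists (p + t *: v); split=> //; rewrite open_region_rcons; split=> //.
    by apply/(lg_open lg Qt); rewrite (lg_lt lg Qt).
  have Dp : open_region cs p.
    apply/(lg_open lg Qp); rewrite lt_neqAle (lg_closed lg Qp).1 // andbT.
    by apply: contra Sp => /eqP/(on_graph Qp) ->.
  have [|t /andP[t0 _] [Ut Dt]] :=
    @shift_near p (p - center C) (U `&` open_region cs) 1 ltr01.
    by apply: filterI => //; apply: open_nbhs_nbhs; split=> //; exact: open_region_open.
  exists (p + t *: (p - center C)); split=> //; rewrite open_region_rcons; split=> //=.
  move: Cp (radius_gt0 C); rewrite /pow /=.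
  set u1 := p.1 - _; set u2 := p.2 - _ => Cp r0.
  have -> : p.1 + t * u1 - (center C).1 = (1 + t) * u1 by rewrite /u1; ring.
  have -> : p.2 + t * u2 - (center C).2 = (1 + t) * u2 by rewrite /u2; ring.
  have -> : ((1 + t) * u1) ^+ 2 + ((1 + t) * u2) ^+ 2 - radius C ^+ 2 =
    (1 + t) ^+ 2 * (u1 ^+ 2 + u2 ^+ 2 - radius C ^+ 2) + (2 * t + t * t) * radius C ^+ 2.
    by ring.
  by rewrite Cp mulr0 add0r mulr_gt0 ?exprn_gt0 //; nra.
have clp : closure (open_region cs) p by rewrite clE.
have : nbhs p (U `&` [set q | 0 < pow C q]).
  by apply: filterI => //; apply: open_nbhs_nbhs; split=> //; exact: pow_open_gt.
move=> /clp [q [Dq [Uq Cq]]]; exists q; split=> //.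
by rewrite open_region_rcons.
Qed.

Lemma bd_old p : bd (punctured (rcons cs C)) p -> closed_region cs p.
Proof.
move/(bd_punctured _ fresh_closure) => [+ _].
by rewrite closed_region_rcons => -[].
Qed.

Lemma bd_box p : bd (punctured (rcons cs C)) p -> pow C p = 0 -> Q p.
Proof. by move=> /bd_old Kp Cp; apply: disk_box => //; rewrite Cp. Qed.

Lemma ab_new p : p = a \/ p = b -> closed_region (rcons cs C) p.
Proof.
move=> pab; rewrite closed_region_rcons; split; first exact: ab_closed.
by case: pab => -> /=; rewrite ?Ca ?Cb.
Qed.

Lemma fresh_ss_region : is_ss_region (punctured (rcons cs C)).
Proof.
have [_ _ _ meets [tr3 no3]] := ssX.
have bdX S1 p : S1 \in unit_circle R :: cs -> pow S1 p = 0 ->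
    bd (punctured (rcons cs C)) p -> bd (punctured cs) p.
  move=> S1cs S1p bp; apply/(bd_punctured _ clE); split; first exact: bd_old.
  by exists S1.
split=> //.
- by split=> //; exact: open_region_open.
- move=> p /(bd_punctured _ fresh_closure)[_ [D Dcs Dp]].
  by exists D => //; exact/circle_setP.
- rewrite /= fresh_closure => D; rewrite in_circles => /orP[/eqP ->|Dcs].
    by exists a; split; [apply: ab_new; left|exact/circle_setP].
  have [->|DS] := eqVneq D S.
    by exists a; split; [apply: ab_new; left|exact/circle_setP].
  have [p [+ Dp]] := meets D Dcs; rewrite /= clE => Kp.
  exists p; split=> //; rewrite closed_region_rcons; split=> //=.
  rewrite leNgt; apply/negP => Cp; have Qp := disk_box Kp (ltW Cp).
  by have := lg_only lg Dcs DS Qp; rewrite ((circle_setP _ _).1 Dp) eqxx.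
- split.
    have sym S1 : S1 \in unit_circle R :: cs -> forall p, bd (punctured (rcons cs C)) p ->
        pow S1 p = 0 -> pow C p = 0 -> S1 = S /\ (p = a \/ p = b).
      move=> S1cs p bp S1p Cp; have Qp := bd_box bp Cp.
      have S1S := box_other_circle S1cs Qp S1p; split=> //.
      by apply: meet; rewrite // -S1S.
    move=> S1 S2; rewrite /= !in_circles.
    move=> /orP[/eqP ->|S1cs] /orP[/eqP ->|S2cs] S12 p bp /circle_setP h1 /circle_setP h2.
    + by rewrite eqxx in S12.
    + have [-> pab] := sym S2 S2cs p bp h2 h1.
      apply: transversal_direct_sum.
      by have := trans pab; rewrite /cross -oppr_eq0 opprB mulrC [X in _ - X]mulrC.
    + have [-> pab] := sym S1 S1cs p bp h1 h2.
      by apply: transversal_direct_sum; exact: trans.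
    + by apply: tr3 => //; [exact: (bdX S1 p S1cs h1 bp)|exact/circle_setP|exact/circle_setP].
  move=> S1 S2 S3; rewrite /= !in_circles => c1 c2 c3 n12 n13 n23 p bp.
  move=> [/circle_setP h1 /circle_setP h2 /circle_setP h3].
  have two T1 T2 : T1 \in unit_circle R :: cs -> T2 \in unit_circle R :: cs ->
      pow C p = 0 -> pow T1 p = 0 -> pow T2 p = 0 -> T1 = T2.
    move=> t1 t2 Cp T1p T2p; have Qp := bd_box bp Cp.
    by rewrite (box_other_circle t1 Qp T1p) (box_other_circle t2 Qp T2p).
  case/orP: c1 => [/eqP E1|c1]; case/orP: c2 => [/eqP E2|c2]; case/orP: c3 => [/eqP E3|c3];
    subst; rewrite ?eqxx // in n12 n13 n23.
  + by rewrite (two S2 S3) ?eqxx in n23.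
  + by rewrite (two S1 S3) ?eqxx in n13.
  + by rewrite (two S1 S2) ?eqxx in n12.
  + apply: (no3 S1 S2 S3 c1 c2 c3 n12 n13 n23 p); first exact: (bdX S1 p c1 h1 bp).
    by split; exact/circle_setP.
Qed.

Lemma fresh_on_circles p D : pow C p != 0 ->
  (D \in unit_circle R :: rcons cs C /\ circle_set D p) <->
  (D \in unit_circle R :: cs /\ circle_set D p).
Proof.
move=> Cp; rewrite in_circles; split=> -[+ Dp]; last by move=> ->; rewrite orbT.
case/orP => [/eqP DC|//]; move: Dp; rewrite DC => /circle_setP Dp.
by rewrite Dp eqxx in Cp.
Qed.

Lemma fresh_bd p : 0 < pow C p ->
  bd (punctured (rcons cs C)) p <-> bd (punctured cs) p.
Proof.
move=> Cp; rewrite /bd /= fresh_closure clE closed_region_rcons open_region_rcons.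
split=> -[]; first by case=> Kp _ nD; split=> // Dp; apply: nD.
by move=> Kp nD; split; [split=> //; exact: ltW|case].
Qed.

(** Outside the closed new disk, neither the circles nor the boundary change. *)
Lemma fresh_singular p : 0 < pow C p ->
  singular fst (punctured (rcons cs C)) p <-> singular fst (punctured cs) p.
Proof.
move=> Cp; have Cp0 : pow C p != 0 by rewrite gt_eqF.
have near_p : \forall q \near p, 0 < pow C q.
  by apply: open_nbhs_nbhs; split=> //; exact: pow_open_gt.
have one D : in_exactly_one (punctured (rcons cs C)) D p <->
             in_exactly_one (punctured cs) D p.
  by split=> h D'; rewrite -h; [apply: iff_sym|]; exact: fresh_on_circles.
rewrite /singular (fresh_bd Cp); split=> -[bp h]; split=> //; case: h => [[S1 [S2 [S12 h]]]|[D [h1 h2 h3]]].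
- by left; exists S1, S2; split=> // D; rewrite -h; apply: iff_sym; exact: fresh_on_circles.
- right; exists D; split=> //; first exact/one.
  near=> q; have Cq : 0 < pow C q by near: q.
  by rewrite -(fresh_bd Cq); near: q.
- by left; exists S1, S2; split=> // D; rewrite -h; exact: fresh_on_circles.
- right; exists D; split=> //; first exact/one.
  near=> q; have Cq : 0 < pow C q by near: q.
  by rewrite (fresh_bd Cq); near: q.
Unshelve. all: by end_near. Qed.

(** Inside the old region, [C] is the only circle nearby, and its tangent is
    vertical only at the level of its center. *)
Lemma singular_on_fresh p : singular fst (punctured (rcons cs C)) p ->
  pow C p = 0 ->
  p = a \/ p = b \/ (open_region cs p /\ p.2 = (center C).2).
Proof.
move=> [bp h] Cp; have Qp := bd_box bp Cp; have Kp := bd_old bp.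
have [Sp|Sp] := eqVneq (pow S p) 0.
  by case: (meet Qp Sp Cp); [left|right; left].
have Dp : open_region cs p.
  apply/(lg_open lg Qp); rewrite lt_neqAle (lg_closed lg Qp).1 // andbT.
  by apply: contra Sp => /eqP/(on_graph Qp) ->.
right; right; split=> //.
have only D : D \in unit_circle R :: rcons cs C -> circle_set D p -> D = C.
  rewrite in_circles => /orP[/eqP //|Dcs] /circle_setP Dp0.
  by case: (open_region_off Dp Dcs).
case: h => [[S1 [S2 [S12 h]]]|[D [h1 h2 h3]]].
  have [S1c S1p] := (h S1).2 (or_introl erefl).
  have [S2c S2p] := (h S2).2 (or_intror erefl).
  by case: S12; rewrite (only _ S1c S1p) (only _ S2c S2p).
have [Dc Dp'] := (h1 D).2 erefl.
have DC := only _ Dc Dp'; subst D.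
have := h3 (- (p.2 - (center C).2), p.1 - (center C).1).
rewrite /tangent /dot /= => /(_ _) H.
have : - (p.2 - (center C).2) = 0 by apply: H; ring.
by move=> E; lra.
Qed.

Lemma fresh_corner p : p = a \/ p = b -> singular fst (punctured (rcons cs C)) p.
Proof.
move=> pab; have Kp := ab_new pab.
have [Qp Sp Cp] : [/\ Q p, pow S p = 0 & pow C p = 0] by case: pab => ->.
split.
  apply/(bd_punctured _ fresh_closure); split=> //.
  by exists C => //; rewrite in_circles eqxx.
left; exists C, S; split; first exact/eqP/C_neq_S.
move=> D; rewrite /= in_circles; split.
  case=> /orP[/eqP -> _|Dcs /circle_setP Dp]; first by left.
  by right; exact: box_other_circle Dp.
case=> ->; first by split; [rewrite eqxx|exact/circle_setP].
by split; [rewrite (lg_in lg) orbT|exact/circle_setP].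
Qed.

Lemma fresh_extreme p : open_region cs p -> pow C p = 0 -> p.2 = (center C).2 ->
  singular fst (punctured (rcons cs C)) p.
Proof.
move=> Dp Cp pc; have Kp := open_region_sub Dp.
have K'p : closed_region (rcons cs C) p by rewrite closed_region_rcons; split=> //=; rewrite Cp.
split.
  apply/(bd_punctured _ fresh_closure); split=> //.
  by exists C => //; rewrite in_circles eqxx.
right; exists C; split.
- move=> D; rewrite /= in_circles; split.
    case=> /orP[/eqP //|Dcs /circle_setP Dp0].
    by case: (open_region_off Dp Dcs).
  by move=> ->; rewrite eqxx; split=> //; exact/circle_setP.
- have near_p : \forall q \near p, open_region cs q.
    by apply: open_nbhs_nbhs; split=> //; exact: open_region_open.
  near=> q; have Dq : open_region cs q by near: q.
  rewrite /bd /= fresh_closure closed_region_rcons open_region_rcons; split.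
    case=> -[_ /= Cq] nD; apply/circle_setP/eqP; rewrite eq_le Cq andbT leNgt.
    by apply/negP => Cq'; apply: nD.
  move/circle_setP => Cq; split; first by split; [exact: open_region_sub|rewrite /= Cq].
  by case=> _; rewrite /= Cq ltxx.
- move=> [v1 v2]; rewrite /tangent /dot /= pc subrr mul0r addr0 => /eqP.
  rewrite mulf_eq0 => /orP[/eqP pc1|/eqP //].
  by have := radius_gt0 C; move: Cp; rewrite /pow pc pc1; nra.
Unshelve. all: by end_near. Qed.

End Fresh.

End Removal.

(** * Pencils of circles through two points *)

Section Pencil.
Variable R : realType.
Implicit Types (a b p : R * R) (h k : R) (C : circle R).

Definition line a b p : R := (b.1 - a.1) * (p.2 - a.2) - (b.2 - a.2) * (p.1 - a.1).

(** The powers of [p] with respect to the circles through [a] and [b]; the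
    center moves along the bisector of [a] and [b] as [h] varies. *)
Definition pencil a b h p : R :=
  (p.1 - a.1) * (p.1 - b.1) + (p.2 - a.2) * (p.2 - b.2) - h * line a b p.

Definition pencil_center a b h : R * R :=
  ((a.1 + b.1 - h * (b.2 - a.2)) / 2, (a.2 + b.2 + h * (b.1 - a.1)) / 2).

Definition slope a b : R := (b.2 - a.2) / (b.1 - a.1).

Lemma pencil_circle a b h : a.1 < b.1 -> exists C, [/\ center C = pencil_center a b h,
   radius C ^+ 2 = ((b.1 - a.1) ^+ 2 + (b.2 - a.2) ^+ 2) * (1 + h ^+ 2) / 4 &
   forall p, pow C p = pencil a b h p].
Proof.
move=> ab; pose r2 := ((b.1 - a.1) ^+ 2 + (b.2 - a.2) ^+ 2) * (1 + h ^+ 2) / 4.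
have r20 : 0 < r2.
  rewrite /r2 divr_gt0 // mulr_gt0 //.
    by rewrite ltr_wpDr ?sqr_ge0 // exprn_gt0 // subr_gt0.
  by rewrite ltr_wpDr ?sqr_ge0.
have r0 : 0 < Num.sqrt r2 by rewrite sqrtr_gt0.
exists (exist _ (pencil_center a b h, Num.sqrt r2) r0).
have E : Num.sqrt r2 ^+ 2 = r2 by rewrite sqr_sqrtr // ltW.
split=> // p; rewrite /pow /center /radius /= E /r2 /pencil /line.
by field.
Qed.

(** Every circle through [a] and [b] is in the pencil. *)
Lemma pow_pencil C a b p : a.1 < b.1 -> pow C a = 0 -> pow C b = 0 ->
  let h := (2 * (center C).2 - a.2 - b.2) / (b.1 - a.1) in
  center C = pencil_center a b h /\ pow C p = pencil a b h p.
Proof.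
move=> ab Ca Cb h; have d0 : b.1 - a.1 != 0 by rewrite subr_eq0 gt_eqF.
have hx : h * (b.1 - a.1) = 2 * (center C).2 - a.2 - b.2 by rewrite /h divfK.
have hy : h * (b.2 - a.2) = a.1 + b.1 - 2 * (center C).1.
  apply: (mulIf d0); rewrite mulrAC hx.
  move: Ca Cb; rewrite /pow => Ca Cb.
  have : ((a.1 - (center C).1) ^+ 2 + (a.2 - (center C).2) ^+ 2 - radius C ^+ 2) -
     ((b.1 - (center C).1) ^+ 2 + (b.2 - (center C).2) ^+ 2 - radius C ^+ 2) = 0
    by rewrite Ca Cb subrr.
  by move=> E; apply/eqP; rewrite -subr_eq0 -E; apply/eqP; ring.
split.
  rewrite /pencil_center hx hy [LHS]surjective_pairing.
  by congr pair; field.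
rewrite -[LHS]subr0 -Ca.
rewrite /pencil /line.
have -> : h * ((b.1 - a.1) * (p.2 - a.2) - (b.2 - a.2) * (p.1 - a.1)) =
   (h * (b.1 - a.1)) * (p.2 - a.2) - (h * (b.2 - a.2)) * (p.1 - a.1) by ring.
by rewrite hx hy /pow; ring.
Qed.

Lemma pencil_diff a b h k p : pencil a b h p - pencil a b k p = (k - h) * line a b p.
Proof. by rewrite /pencil; ring. Qed.

(** The power is affine in the parameter of the pencil. *)
Lemma pencil_mid a b h h' k p : h <= k <= h' ->
  pencil a b h p <= 0 -> pencil a b h' p <= 0 -> pencil a b k p <= 0.
Proof.
move=> /andP[hk kh] ph ph'.
have := pencil_diff a b h k p; have := pencil_diff a b h' k p.
by have [l0|l0] := leP 0 (line a b p); nra.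
Qed.

Lemma slopeK a b : a.1 < b.1 -> slope a b * (b.1 - a.1) = b.2 - a.2.
Proof. by move=> ab; rewrite /slope divfK // subr_eq0 gt_eqF. Qed.

(** In the pencil, these are the circles of which [a], respectively [b], is the
    leftmost, respectively rightmost, point. *)
Lemma pencil_left a b p : a.1 < b.1 -> pencil a b (- slope a b) p <= 0 ->
  a.1 <= p.1 /\ (p.1 = a.1 -> p = a).
Proof.
move=> ab; have := slopeK ab; rewrite /pencil /line.
case: a b p ab => a1 a2 [b1 b2] [p1 p2] /= ab.
move: (slope _ _) => m hm hp.
have hb : b2 = a2 + m * (b1 - a1) by rewrite hm; ring.
have d0 : 0 < b1 - a1 by rewrite subr_gt0.
have E : (b1 - a1) * (((p1 - a1) * (p1 - b1) + (p2 - a2) * (p2 - b2) -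
    - m * ((b1 - a1) * (p2 - a2) - (b2 - a2) * (p1 - a1)))) =
    (b1 - a1) * ((p1 - a1) ^+ 2 + (p2 - a2) ^+ 2) -
    (p1 - a1) * ((b1 - a1) ^+ 2 + (b2 - a2) ^+ 2).
  by rewrite hb; ring.
have d2 : 0 < (b1 - a1) ^+ 2 + (b2 - a2) ^+ 2.
  by rewrite ltr_wpDr ?sqr_ge0 // exprn_gt0.
have s1 := sqr_ge0 (p1 - a1); have s2 := sqr_ge0 (p2 - a2).
have hE : (b1 - a1) * ((p1 - a1) ^+ 2 + (p2 - a2) ^+ 2) <=
    (p1 - a1) * ((b1 - a1) ^+ 2 + (b2 - a2) ^+ 2) by nra.
split.
  rewrite -subr_ge0 -(pmulr_lge0 _ d2); apply: le_trans hE.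
  by apply: mulr_ge0; [exact: ltW|exact: addr_ge0].
move=> e1; rewrite e1 subrr mul0r expr0n /= add0r pmulr_rle0 // in hE.
have : (p2 - a2) ^+ 2 = 0 by apply/eqP; rewrite eq_le hE s2.
by move/eqP; rewrite sqrf_eq0 subr_eq0 => /eqP ->; rewrite e1.
Qed.

Lemma pencil_right a b p : a.1 < b.1 -> pencil a b (slope a b) p <= 0 ->
  p.1 <= b.1 /\ (p.1 = b.1 -> p = b).
Proof.
move=> ab; have := slopeK ab; rewrite /pencil /line.
case: a b p ab => a1 a2 [b1 b2] [p1 p2] /= ab.
move: (slope _ _) => m hm hp.
have hb : b2 = a2 + m * (b1 - a1) by rewrite hm; ring.
have d0 : 0 < b1 - a1 by rewrite subr_gt0.
have E : (b1 - a1) * (((p1 - a1) * (p1 - b1) + (p2 - a2) * (p2 - b2) -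
    m * ((b1 - a1) * (p2 - a2) - (b2 - a2) * (p1 - a1)))) =
    (b1 - a1) * ((p1 - b1) ^+ 2 + (p2 - b2) ^+ 2) -
    (b1 - p1) * ((b1 - a1) ^+ 2 + (b2 - a2) ^+ 2).
  by rewrite hb; ring.
have d2 : 0 < (b1 - a1) ^+ 2 + (b2 - a2) ^+ 2.
  by rewrite ltr_wpDr ?sqr_ge0 // exprn_gt0.
have s1 := sqr_ge0 (p1 - b1); have s2 := sqr_ge0 (p2 - b2).
have hE : (b1 - a1) * ((p1 - b1) ^+ 2 + (p2 - b2) ^+ 2) <=
    (b1 - p1) * ((b1 - a1) ^+ 2 + (b2 - a2) ^+ 2) by nra.
split.
  rewrite -subr_ge0 -(pmulr_lge0 _ d2); apply: le_trans hE.
  by apply: mulr_ge0; [exact: ltW|exact: addr_ge0].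
move=> e1; rewrite e1 subrr mul0r expr0n /= add0r pmulr_rle0 // in hE.
have : (p2 - b2) ^+ 2 = 0 by apply/eqP; rewrite eq_le hE s2.
by move/eqP; rewrite sqrf_eq0 subr_eq0 => /eqP ->; rewrite e1.
Qed.

(** Two members of the pencil cannot be tangent at [a] or [b]. *)
Lemma pencil_trans C C' a b h h' : a.1 < b.1 -> h != h' ->
  center C = pencil_center a b h -> center C' = pencil_center a b h' ->
  forall p, p = a \/ p = b -> cross (p - center C) (p - center C') != 0.
Proof.
move=> ab hh' -> -> p; pose n := (b.1 - a.1) ^+ 2 + (b.2 - a.2) ^+ 2.
have n0 : n != 0 by rewrite gt_eqF // ltr_wpDr ?sqr_ge0 // exprn_gt0 // subr_gt0.
have hd : (h' - h) * n / 4 != 0.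
  apply: mulf_neq0; last by rewrite invr_eq0 pnatr_eq0.
  by apply: mulf_neq0 => //; rewrite subr_eq0 eq_sym.
case=> ->; rewrite /cross /pencil_center /=.
  have -> // : (a.1 - (a.1 + b.1 - h * (b.2 - a.2)) / 2) *
    (a.2 - (a.2 + b.2 + h' * (b.1 - a.1)) / 2) -
    (a.2 - (a.2 + b.2 + h * (b.1 - a.1)) / 2) *
    (a.1 - (a.1 + b.1 - h' * (b.2 - a.2)) / 2) = (h' - h) * n / 4.
  by rewrite /n; field.
rewrite -oppr_eq0.
have -> // : - ((b.1 - (a.1 + b.1 - h * (b.2 - a.2)) / 2) *
    (b.2 - (a.2 + b.2 + h' * (b.1 - a.1)) / 2) -
    (b.2 - (a.2 + b.2 + h * (b.1 - a.1)) / 2) *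
    (b.1 - (a.1 + b.1 - h' * (b.2 - a.2)) / 2)) = (h' - h) * n / 4.
by rewrite /n; field.
Qed.

(** On a vertical line, the power is a convex function of the height. *)
Lemma pow_between C (x y1 y2 y : R) : y1 <= y <= y2 ->
  pow C (x, y) <= pow C (x, y1) \/ pow C (x, y) <= pow C (x, y2).
Proof.
rewrite /pow /= => /andP[h1 h2]; have [yc|cy] := leP y (center C).2.
  by left; nra.
by right; nra.
Qed.

End Pencil.

Lemma simple_split (G : graph) (e : edge G) : loopless G ->
  simple_graph G -> simple_graph (split_edge e).
Proof.
move=> noloop [noiso simp]; split.
  case=> [v|]; last by exists (Some e); rewrite /incident /= ?eqxx ?orbT.
  have [f /orP[/eqP fv|/eqP fv]] := noiso v.
    by exists (Some f); rewrite /incident /= fv eqxx.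
  have [fe|fe] := eqVneq f e.
    by exists None; rewrite /incident /= -fe fv ?eqxx ?orbT.
  by exists (Some f); rewrite /incident /= (negbTE fe) fv ?eqxx ?orbT.
have nl := noloop e.
case=> [f|] [g|] //=.
- have [->|fe] := eqVneq f e; have [->|ge] := eqVneq g e => //.
  + by case=> -[].
  + by case=> -[].
  + by case=> -[[h1] [h2]]; congr Some; apply: simp; [left|right].
- have [->|fe] := eqVneq f e; case=> -[] // [h1] // h2.
  by rewrite h1 eqxx in nl.
- have [->|ge] := eqVneq g e; case=> -[] // h1 [h2].
  by rewrite h2 eqxx in nl.
Qed.

Lemma simple_leaf (G : graph) (v : vertex G) :
  simple_graph G -> simple_graph (add_leaf v).
Proof.
move=> [noiso simp]; split.
  case=> [w|]; last by exists None; rewrite /incident /= ?eqxx ?orbT.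
  have [f /orP[/eqP fv|/eqP fv]] := noiso w.
    by exists (Some f); rewrite /incident /= fv eqxx.
  by exists (Some f); rewrite /incident /= fv ?eqxx ?orbT.
case=> [f|] [g|] //=; try by case=> -[].
by case=> -[[h1] [h2]]; congr Some; apply: simp; [left|right].
Qed.

Lemma simple_iso (G H : graph) (f : giso G H) : simple_graph G -> simple_graph H.
Proof.
move=> [noiso simp]; split.
  move=> v; have [e ev] := noiso (invV f v); exists (isoE f e).
  rewrite /incident iso_src iso_tgt; case/orP: ev => /eqP ->;
    by rewrite invVK eqxx ?orbT.
move=> e e'; rewrite -(invEK f e) -(invEK f e') !iso_src !iso_tgt => h.
by congr isoE; apply: simp; case: h => -[/(can_inj (isoVK f)) h1 /(can_inj (isoVK f)) h2];
   [left|right].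
Qed.

(** * Cutting off a cap *)

Section SplitLab.
Variables (R : realType) (G : graph).
Variables (xv : vertex G -> R) (lab : R * R -> vertex G + edge G).
Variables (e : edge G) (x : R) (p : R * R).

Lemma split_lab_vertex v : lab p = inl v -> split_lab xv lab e x p = inl (Some v).
Proof. by rewrite /split_lab => ->. Qed.

Lemma split_lab_other f : lab p = inr f -> f != e ->
  split_lab xv lab e x p = inr (Some f).
Proof. by rewrite /split_lab => -> /negbTE ->. Qed.

Lemma split_lab_at : lab p = inr e -> p.1 = x -> split_lab xv lab e x p = inl None.
Proof. by rewrite /split_lab => -> ->; rewrite !eqxx. Qed.

Lemma split_lab_src : lab p = inr e -> btw (xv (src e)) x p.1 ->
  split_lab xv lab e x p = inr (Some e).
Proof.
by rewrite /split_lab => -> h; have /andP[_ /negbTE ->] := btw_neq h; rewrite eqxx h.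
Qed.

Lemma split_lab_tgt : btw (xv (src e)) (xv (tgt e)) x -> lab p = inr e ->
  btw x (xv (tgt e)) p.1 -> split_lab xv lab e x p = inr None.
Proof.
rewrite /split_lab => hx -> h; have /andP[/negbTE -> _] := btw_neq h; rewrite eqxx.
by case: ifP => // h'; rewrite (btw_disjoint hx h') in h.
Qed.

End SplitLab.

Section Drawing.
Variable R : realType.

(** The state of the construction. An edge is active when its part of the region
    touches the upper half of the unit circle, where [branch_twice] can be
    realized. *)
Record drawing (cs : seq (circle R)) (G : graph) (act : edge G -> bool)
    (xv : vertex G -> R) (lab : R * R -> vertex G + edge G) : Prop := Drawing {
  dr_ss : is_ss_region (punctured cs);
  dr_closure : closure (open_region cs) = closed_region cs;
  dr_layout : layout (closed_region cs) xv lab;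
  dr_simple : simple_graph G;
  dr_sing : forall p, singular fst (punctured cs) p -> exists v, lab p = inl v;
  dr_vertex : forall v, exists2 p, singular fst (punctured cs) p & lab p = inl v;
  dr_act : forall e, act e -> exists p,
    [/\ closed_region cs p, lab p = inr e, pow (unit_circle R) p = 0 & 0 < p.2] }.

Lemma drawing_iso cs (G H : graph) (f : giso G H) (act : edge G -> bool)
    (act' : edge H -> bool) (xv : vertex G -> R) lab :
  (forall e, act' (isoE f e) -> act e) -> drawing cs act xv lab ->
  drawing cs act' (xv \o invV f)
    (fun p => match lab p with inl v => inl (isoV f v) | inr e => inr (isoE f e) end).
Proof.
move=> hact D; split.
- exact: (dr_ss D).
- exact: (dr_closure D).
- exact: layout_iso (dr_layout D).
- exact: simple_iso f (dr_simple D).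
- by move=> p /(dr_sing D)[v ->]; exists (isoV f v).
- move=> v; have [p sp lp] := dr_vertex D (invV f v); exists p => //.
  by rewrite lp invVK.
- move=> e; rewrite -(invEK f e) => /hact/(dr_act D)[p [Kp lp Up p2]].
  by exists p; rewrite lp.
Qed.

Lemma drawing_loopless cs (G : graph) (act : edge G -> bool) xv lab :
  drawing cs act xv lab -> loopless G.
Proof.
move=> D e; apply/negP => /eqP E; have := lay_ends (dr_layout D) e.
by rewrite E eqxx.
Qed.

(** A box where the boundary is the graph of [z] and all the region belongs to
    the edge [e]; the base line at height [yb] is under the graph, and serves to
    join points of the box inside the region. *)
Record plot (cs : seq (circle R)) (G : graph) (lab : R * R -> vertex G + edge G)
    (e : edge G) (S : circle R) (sg xl xr yl yu yb : R) (z : R -> R) : Prop := Plot {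
  pl_lg : local_graph cs S sg xl xr yl yu z;
  pl_lab : forall p, in_box xl xr yl yu p -> closed_region cs p -> lab p = inr e;
  pl_yb : yl < yb;
  pl_base : forall x, xl < x < xr -> yb < z x }.

Section InPlot.
Variables (cs : seq (circle R)) (G : graph) (act : edge G -> bool).
Variables (xv : vertex G -> R) (lab : R * R -> vertex G + edge G) (e : edge G).
Hypothesis dr : drawing cs act xv lab.
Variables (S : circle R) (sg xl xr yl yu yb : R) (z : R -> R).
Hypothesis pl : plot cs lab e S sg xl xr yl yu yb z.
Local Notation Q := (in_box xl xr yl yu).
Local Notation K := (closed_region cs).

Lemma plot_x p : Q p -> xl < p.1 < xr.
Proof. by case/andP. Qed.

Lemma plot_graph x : xl < x < xr -> Q (x, z x).
Proof. by move=> hx; rewrite /in_box /= hx (lg_z (pl_lg pl) hx). Qed.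

Lemma plot_graph_closed x : xl < x < xr -> K (x, z x).
Proof.
by move=> hx; apply/(lg_closed (pl_lg pl) (plot_graph hx)).
Qed.

Lemma plot_graph_pow x : xl < x < xr -> pow S (x, z x) = 0.
Proof.
by move=> hx; apply/(on_graph (pl_lg pl) (plot_graph hx)).
Qed.

Lemma plot_basepoint x : xl < x < xr -> Q (x, yb).
Proof.
move=> hx; rewrite /in_box /= hx /= (pl_yb pl).
have := pl_base pl hx; have /andP[] := lg_z (pl_lg pl) hx; lra.
Qed.

(** The slice through [q] contains the point of the graph with the same
    abscissa, and would contain points just above that one. *)
Lemma plot_top q : K q -> lab q = inr e -> xl < q.1 < xr -> q.2 <= z q.1.
Proof.
move=> Kq lq hx; rewrite leNgt; apply/negP => zq.
have /andP[yz zy] := lg_z (pl_lg pl) hx.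
pose y := z q.1 + Num.min (q.2 - z q.1) (yu - z q.1) / 2.
have hm : 0 < Num.min (q.2 - z q.1) (yu - z q.1) by rewrite lt_min; apply/andP; lra.
have m1 : Num.min (q.2 - z q.1) (yu - z q.1) <= q.2 - z q.1 by rewrite ge_min lexx.
have m2 : Num.min (q.2 - z q.1) (yu - z q.1) <= yu - z q.1 by rewrite ge_min lexx orbT.
have Kz := plot_graph_closed hx.
have lz := pl_lab pl (plot_graph hx) Kz.
have [||||//|Ky _] := lay_convex (dr_layout dr) (p := (q.1, z q.1)) (q := q) (y := y) => //.
- by rewrite lz.
- by rewrite /y; apply/andP; rewrite /=; lra.
have Qy : Q (q.1, y) by rewrite /in_box /= hx /=; apply/andP; rewrite /y; lra.
by have /= := (lg_closed (pl_lg pl) Qy).1 Ky; rewrite /y; lra.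
Qed.

Lemma plot_btw x : xl < x < xr -> btw (xv (src e)) (xv (tgt e)) x.
Proof.
move=> hx; have Kz := plot_graph_closed hx.
by have := lay_ex (dr_layout dr) Kz (pl_lab pl (plot_graph hx) Kz).
Qed.

(** The ends of [e] may be placed in either order on the axis. *)
Lemma btw_order (x0 x1 : R) : x0 < x1 ->
  btw (xv (src e)) (xv (tgt e)) x0 -> btw (xv (src e)) (xv (tgt e)) x1 ->
  exists y0 y1, [/\ (y0 = x0 /\ y1 = x1) \/ (y0 = x1 /\ y1 = x0),
    btw (xv (src e)) (xv (tgt e)) y0 & btw y0 (xv (tgt e)) y1].
Proof.
move=> x01 b0 b1; have := lay_ends (dr_layout dr) e.
have [lt|gt|//] := ltgtP (xv (src e)) (xv (tgt e)) => _.
  exists x0, x1; split=> //; first by left.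
  by move: b0 b1; rewrite /btw; lra.
exists x1, x0; split=> //; first by right.
by move: b0 b1; rewrite /btw; lra.
Qed.

End InPlot.

(** Removing from the region a disk [C] that covers the arc of [S] from [a] to [b]
    and whose trace on the region stays between the abscissae of [a] and [b].
    Every slice keeps its lower part, so the quotient does not change; the only
    new singular points are [a] and [b], which become vertices. *)
Section FlatCut.
Variables (cs : seq (circle R)) (G : graph) (act : edge G -> bool).
Variables (xv : vertex G -> R) (lab : R * R -> vertex G + edge G) (e : edge G).
Hypothesis dr : drawing cs act xv lab.
Variables (S : circle R) (sg xl xr yl yu yb : R) (z : R -> R).
Hypothesis pl : plot cs lab e S sg xl xr yl yu yb z.
Local Notation Q := (in_box xl xr yl yu).
Local Notation K := (closed_region cs).
Variables (C : circle R) (a b : R * R) (h0 h1 : R).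
Hypotheses (ab : a.1 < b.1) (Qa : Q a) (Qb : Q b) (h01 : h0 != h1).
Hypotheses (Sa : pow S a = 0) (Sb : pow S b = 0).
Hypotheses (cS : center S = pencil_center a b h0).
Hypotheses (cC : center C = pencil_center a b h1).
Hypothesis Ch : forall p, pow C p = pencil a b h1 p.
Hypothesis flat : forall p, K p -> pow C p <= 0 ->
  forall k, `|k| <= `|slope a b| -> pencil a b k p <= 0.
Hypothesis top : forall p, Q p -> pow S p = 0 -> a.1 < p.1 < b.1 -> pow C p < 0.
Hypothesis small : forall p, pencil a b 0 p <= 0 -> Q p /\ yb < p.2.
Hypotheses (aC : a.2 < (center C).2) (bC : b.2 < (center C).2).
Local Notation K' := (closed_region (rcons cs C)).

Let Ca : pow C a = 0.
Proof. by rewrite Ch /pencil /line; ring. Qed.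
Let Cb : pow C b = 0.
Proof. by rewrite Ch /pencil /line; ring. Qed.

Lemma flat_box p : K p -> pow C p <= 0 -> Q p /\ yb < p.2.
Proof. by move=> Kp Cp; apply/small/flat; rewrite ?normr0. Qed.

(** The hypothesis [flat] applied to the two members of the pencil for which [a]
    is leftmost and [b] is rightmost. *)
Lemma flat_between p : K p -> pow C p <= 0 ->
  [/\ a.1 <= p.1 <= b.1, p.1 = a.1 -> p = a & p.1 = b.1 -> p = b].
Proof.
move=> Kp Cp.
have [|l1 l2] := @pencil_left _ a b p ab; first by apply: flat; rewrite ?normrN.
have [|r1 r2] := @pencil_right _ a b p ab; first by apply: flat.
by split=> //; rewrite l1 r1.
Qed.

Lemma flat_strict p : K p -> pow C p < 0 -> a.1 < p.1 < b.1.
Proof.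
move=> Kp Cp; have [/andP[l r] la rb] := flat_between Kp (ltW Cp).
rewrite !lt_neqAle l r !andbT; apply/andP; split; apply/eqP => E.
  by rewrite (la (esym E)) Ca ltxx in Cp.
by rewrite (rb E) Cb ltxx in Cp.
Qed.

Lemma flat_meet p : Q p -> pow S p = 0 -> pow C p = 0 -> p = a \/ p = b.
Proof.
move=> Qp Sp Cp.
have Kp : K p by apply/(lg_closed (pl_lg pl) Qp); rewrite (on_graph (pl_lg pl) Qp).1.
have [|/andP[l r] la rb] := flat_between Kp; first by rewrite Cp.
have [E|na] := eqVneq p.1 a.1; first by left; exact: la.
have [E|nb] := eqVneq p.1 b.1; first by right; exact: rb.
have : pow C p < 0 by apply: top => //; rewrite !lt_neqAle l r eq_sym na nb.
by rewrite Cp ltxx.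
Qed.

Lemma flat_top x : a.1 < x < b.1 -> xl < x < xr -> pow C (x, z x) < 0.
Proof.
move=> hx hx'; apply: top => //; first exact: (plot_graph pl).
exact: (plot_graph_pow pl).
Qed.

Lemma flat_base x : xl < x < xr -> K (x, yb) /\ 0 < pow C (x, yb).
Proof.
move=> hx; have Kb : K (x, yb).
  apply/(lg_closed (pl_lg pl) (plot_basepoint pl hx)) => /=.
  exact/ltW/(pl_base pl).
split=> //; rewrite ltNge; apply/negP => /(flat_box Kb)[_ /=].
by rewrite ltxx.
Qed.

(** In the box, a vertical segment from a remaining point down to the base line
    avoids the disk: if the disk met it, it would also contain the point of the
    graph above, hence the remaining point itself, by convexity. *)
Lemma flat_connected : connected (open_region (rcons cs C)).
Proof.
have [_ [oD cD] _ _ _] := dr_ss dr.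
rewrite open_region_rcons.
apply: (@connected_cut _ (open_region cs) _ ([set p | Q p] `&` open_region cs)).
- exact: cD.
- by apply: openI; [exact: open_region_open|exact: pow_open_gt].
- exact: subIsetl.
- by apply: openI; [exact: open_box|exact: open_region_open].
- move=> p [Dp nC]; split=> //.
  have Cp : pow C p <= 0 by rewrite leNgt; apply/negP => Cp; apply: nC.
  by have [] := flat_box (open_region_sub Dp) Cp.
apply: (@comb_connected _ _ ((fun x : R => (x, yb)) @` `]xl, xr[%classic)).
- apply: connected_continuous_connected; first exact/connected_intervalP/interval_is_interval.
  apply: continuous_subspaceT => y.
  by apply: cvg_pair_nbhs; [exact: cvg_id|exact: cvg_cst].
- move=> _ /= [x + <-]; rewrite in_itv /= => hx.
  have Qb' := plot_basepoint pl hx; have [_ Cp] := flat_base hx.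
  have Db : open_region cs (x, yb) by apply/(lg_open (pl_lg pl) Qb')/(pl_base pl).
  by split.
move=> p [[/= Qp _] [Dp /= Cp]].
have hx := plot_x Qp; have pz := (lg_open (pl_lg pl) Qp).1 Dp.
have yz := pl_base pl hx.
have Qb' := plot_basepoint pl hx.
pose m := Num.min p.2 yb; pose M := Num.max p.2 yb.
exists [set q | q.1 = p.1 /\ m <= q.2 <= M]; split.
- exact: vertical_connected.
- move=> q /= [qp /andP[mq qM]].
  have qz : q.2 < z q.1.
    by rewrite qp; apply: le_lt_trans qM _; rewrite gt_max pz yz.
  have Qq : Q q.
    rewrite /in_box qp hx /=; have /andP[_ /andP[h1' h2]] := Qp.
    have /andP[_ /= /andP[h3 h4]] := Qb'.
    move: mq qM; rewrite /m /M ge_min le_max; lra.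
  have Dq : open_region cs q by apply/(lg_open (pl_lg pl) Qq).
  have Kq := open_region_sub Dq.
  split; split=> //=; rewrite ltNge; apply/negP => Cq.
  have [_ ybq] := flat_box Kq Cq.
  have qp2 : q.2 <= p.2 by move: qM; rewrite le_max => /orP[//|]; rewrite leNgt ybq.
  have [/andP[l r] la rb] := flat_between Kq Cq.
  have [E|na] := eqVneq q.1 a.1.
    have qa := la E; move: pz qp2; rewrite -qp qa.
    by rewrite (on_graph (pl_lg pl) Qa).1 //; lra.
  have [E|nb] := eqVneq q.1 b.1.
    have qa := rb E; move: pz qp2; rewrite -qp qa.
    by rewrite (on_graph (pl_lg pl) Qb).1 //; lra.
  have hx2 : a.1 < p.1 < b.1 by rewrite -qp !lt_neqAle l r eq_sym na nb.
  have Ct := flat_top hx2 hx.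
  have := @pow_between _ C p.1 q.2 (z p.1) p.2.
  rewrite qp2 (ltW pz) -{2}qp -!surjective_pairing => /(_ isT)[]; lra.
- by split=> //; rewrite /m /M ge_min lexx /= le_max lexx.
exists (p.1, yb); split=> /=; last by exists p.1; rewrite // in_itv.
by split=> //; rewrite /m /M ge_min lexx orbT le_max lexx orbT.
Qed.

Let trans : forall p, p = a \/ p = b -> cross (p - center S) (p - center C) != 0.
Proof. exact: pencil_trans ab h01 cS cC. Qed.

Let disk_box : forall p, K p -> pow C p <= 0 -> Q p.
Proof. by move=> p Kp Cp; have [] := flat_box Kp Cp. Qed.

Let lg := pl_lg pl.
Let clE := dr_closure dr.

Lemma flat_keep p : K p -> ~ Q p -> K' p /\ 0 < pow C p.
Proof.
move=> Kp nQ; have Cp : 0 < pow C p.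
  by rewrite ltNge; apply/negP => Cp; apply: nQ; exact: disk_box.
by split=> //; rewrite closed_region_rcons; split=> //; exact: ltW.
Qed.

Lemma flat_layout : layout K' xv lab.
Proof.
have L := dr_layout dr.
apply: (layout_restrict L).
- by rewrite closed_region_rcons; exact: subIsetl.
- exact: closed_region_closed.
- move=> v; have [p [Kp lp]] := lay_v L v; exists p; split=> //.
  have [|//] := @flat_keep p Kp.
  by move=> Qp; have := pl_lab pl Qp Kp; rewrite lp.
- move=> f t ft; have [p [Kp lp pt]] := lay_e L ft.
  have [Qp|nQ] := pselect (Q p); last by exists p; have [] := flat_keep Kp nQ.
  have hx := plot_x Qp; have [Kb Cb'] := flat_base hx.
  exists (p.1, yb); split=> //.
    by rewrite closed_region_rcons; split=> //; exact: ltW.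
  by rewrite (pl_lab pl (plot_basepoint pl hx) Kb) -lp (pl_lab pl Qp Kp).
- move=> p q y; rewrite closed_region_rcons => -[Kp _] [Kq /= Cq] lpq pq /andP[py yq] Ky ly.
  split=> //=; rewrite leNgt; apply/negP => Cy.
  have Qy := disk_box Ky (ltW Cy); have hx := plot_x Qy.
  have hx2 := flat_strict Ky Cy.
  have lq : lab q = inr e by rewrite -lpq -ly (pl_lab pl Qy Ky).
  have qz : q.2 <= z q.1 by apply: (plot_top dr pl); rewrite // -pq.
  have Ct := flat_top hx2 hx.
  rewrite /= pq in Ct Cy; have := @pow_between _ C q.1 y (z q.1) q.2.
  by rewrite yq qz -surjective_pairing => /(_ isT)[]; lra.
Qed.

Theorem flat_cut : exists xv' lab',
  drawing (rcons cs C) (fun _ : edge (split_twice e) => false) xv' lab'.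
Proof.
have L := flat_layout.
have ax := plot_btw dr pl (plot_x Qa); have bx := plot_btw dr pl (plot_x Qb).
have [y0 [y1 [y01 by0 by1]]] := btw_order dr ab ax bx.
have L1 := layout_split L by0.
have L2 := @layout_split _ _ _ _ _ (None : edge (split_edge e)) y1 L1 by1.
pose lab1 := split_lab xv lab e y0.
pose lab2 := split_lab (split_xv xv y0) lab1 (None : edge (split_edge e)) y1.
have old p v : lab p = inl v -> lab2 p = inl (Some (Some v)).
  by move=> lp; do 2 apply: split_lab_vertex.
have lab_y0 p : lab p = inr e -> p.1 = y0 -> lab2 p = inl (Some None).
  by move=> lp py; apply: split_lab_vertex; exact: split_lab_at.
have lab_y1 p : lab p = inr e -> p.1 = y1 -> lab2 p = inl None.
  move=> lp py; apply: split_lab_at => //.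
  by apply: split_lab_tgt; rewrite // py.
have lab_ab p : p = a \/ p = b -> exists v, lab2 p = inl v.
  move=> pab.
  have Kp := ab_closed lg Qa Qb Sa Sb pab.
  have Qp : Q p by case: pab => ->.
  have lp := pl_lab pl Qp Kp.
  have : p.1 = y0 \/ p.1 = y1.
    by case: pab => ->; case: y01 => -[-> ->]; [left|right|right|left].
  case=> py; [exists (Some None); exact: lab_y0|exists None; exact: lab_y1].
have clC := fresh_closure lg clE disk_box flat_meet trans.
exists (split_xv (split_xv xv y0) y1), lab2; split=> //.
- exact: (fresh_ss_region lg clE (dr_ss dr) disk_box Qa Qb Sa Ca Sb Cb flat_meet trans flat_connected).
- apply: simple_split; last exact/simple_split/(dr_simple dr)/(drawing_loopless dr).
  by move=> f; apply/negP => /eqP E; have := lay_ends L1 f; rewrite E eqxx.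
- move=> p sp.
  have K'p : K' p by move: sp => [/(bd_punctured _ clC)[]].
  move: (K'p); rewrite closed_region_rcons => -[Kp /=].
  rewrite le_eqVlt => /orP[/eqP/esym Cp|Cp].
    have := singular_on_fresh lg clE disk_box flat_meet trans sp Cp.
    case=> [pa|[pb|[_ p2]]]; first by apply: lab_ab; left.
      by apply: lab_ab; right.
    (* The extreme points of [C] are at the level of its center, above [a] and
       [b]: their abscissae are beyond those of [a] and [b]. *)
    exfalso; have [|/andP[l r] _ _] := flat_between Kp; first by rewrite Cp.
    move: Cp Ca Cb aC bC (radius_gt0 C); rewrite /pow p2.
    set c := center C => Cp' Ca' Cb' aC' bC' r0.
    have hb : 0 < (b.2 - c.2) ^+ 2 by rewrite exprn_even_gt0 //= subr_eq0 lt_eqF.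
    have ha : 0 < (a.2 - c.2) ^+ 2 by rewrite exprn_even_gt0 //= subr_eq0 lt_eqF.
    have [P0|P0] := leP 0 (p.1 - c.1).
      have : (p.1 - c.1) ^+ 2 <= (b.1 - c.1) ^+ 2 by rewrite ler_sqr ?nnegrE; lra.
      by move: Cp'; rewrite subrr expr0n /=; lra.
    have : (p.1 - c.1) ^+ 2 <= (a.1 - c.1) ^+ 2.
      by rewrite -sqrrN -[X in _ <= X]sqrrN ler_sqr ?nnegrE; lra.
    by move: Cp'; rewrite subrr expr0n /=; lra.
  have := (fresh_singular lg clE disk_box flat_meet trans Cp).1 sp.
  by move/(dr_sing dr) => [v /old]; exists (Some (Some v)).
- have corner p : p = a \/ p = b -> singular fst (punctured (rcons cs C)) p.
    exact: (fresh_corner lg clE disk_box Qa Qb Sa Ca Sb Cb flat_meet trans).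
  have newp y : y = y0 \/ y = y1 -> exists2 p, p = a \/ p = b & p.1 = y.
    by case: y01 => -[e0 e1] [] ->; [exists a|exists b|exists b|exists a];
      rewrite // ?e0 ?e1; by [left|right].
  case=> [[v|]|].
  + have [p sp lp] := dr_vertex dr v; exists p; last exact: old.
    have Kp : K p by case: sp => /(bd_punctured _ clE)[].
    have [|_ Cp] := @flat_keep p Kp.
      by move=> Qp; have := pl_lab pl Qp Kp; rewrite lp.
    exact: (fresh_singular lg clE disk_box flat_meet trans Cp).2 sp.
  + have [p pab py] := newp y0 (or_introl erefl).
    exists p; first exact: corner.
    apply: lab_y0 => //; apply: (pl_lab pl); first by case: pab => ->.
    exact: (ab_closed lg Qa Qb Sa Sb pab).
  + have [p pab py] := newp y1 (or_intror erefl).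
    exists p; first exact: corner.
    apply: lab_y1 => //; apply: (pl_lab pl); first by case: pab => ->.
    exact: (ab_closed lg Qa Qb Sa Sb pab).
Qed.

End FlatCut.
End Drawing.

(** * Biting a disk that makes two branches *)

Section LeafLab.
Variables (R : realType) (G : graph) (A : set (R * R)).
Variables (xv : vertex G -> R) (lab : R * R -> vertex G + edge G).
Variables (v : vertex G) (x : R) (p : R * R).

Definition leaf_old (l : vertex G + edge G) : vertex (add_leaf v) + edge (add_leaf v) :=
  match l with inl w => inl (Some w) | inr f => inr (Some f) end.

Lemma leaf_lab_out : ~ A p -> leaf_lab A xv lab v x p = leaf_old (lab p).
Proof. by move=> nA; rewrite /leaf_lab asboolF. Qed.

Lemma leaf_lab_base : p.1 = xv v -> leaf_lab A xv lab v x p = leaf_old (lab p).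
Proof. by move=> pv; rewrite /leaf_lab pv eqxx andbF. Qed.

Lemma leaf_lab_tip : A p -> x != xv v -> p.1 = x -> leaf_lab A xv lab v x p = inl None.
Proof. by move=> Ap xn px; rewrite /leaf_lab asboolT // px xn eqxx. Qed.

Lemma leaf_lab_edge : A p -> p.1 != xv v -> p.1 != x ->
  leaf_lab A xv lab v x p = inr None.
Proof. by move=> Ap pv px; rewrite /leaf_lab asboolT // pv (negbTE px). Qed.

End LeafLab.

Lemma strip_connected (R : realType) (f g : R -> R) (x0 x1 : R) :
  continuous f -> continuous g -> (forall x, x0 < x < x1 -> f x < g x) ->
  connected [set q : R * R | x0 < q.1 < x1 /\ f q.1 < q.2 < g q.1].
Proof.
move=> cf cg fg; pose m := fun x : R => (f x + g x) / 2.
have cm : continuous m.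
  by move=> x; apply: cvgM; [apply: cvgD; [exact: cf|exact: cg]|exact: cvg_cst].
apply: (@comb_connected _ _ ((fun x => (x, m x)) @` `]x0, x1[%classic)).
- apply: connected_continuous_connected; first exact/connected_intervalP/interval_is_interval.
  apply: continuous_subspaceT => y.
  by apply: cvg_pair_nbhs; [exact: cvg_id|exact: cm].
- move=> _ /= [x + <-]; rewrite in_itv /= => hx; split=> //.
  by have := fg x hx; rewrite /m; lra.
move=> p /= [hx hy]; have hm := fg _ hx.
exists [set q | q.1 = p.1 /\ Num.min p.2 (m p.1) <= q.2 <= Num.max p.2 (m p.1)]; split.
- exact: vertical_connected.
- move=> q /= [-> +]; rewrite ge_min le_max => h; split=> //.
  by move: h; rewrite /m; lra.
- by split=> //; rewrite ge_min lexx le_max lexx.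
exists (p.1, m p.1); split=> /=; last by exists p.1; rewrite // in_itv.
by split=> //; rewrite ge_min lexx orbT le_max lexx orbT.
Qed.

Lemma sqrt_sub_continuous (R : realType) (k c : R) :
  continuous (fun x : R => Num.sqrt (k - (x - c) ^+ 2)).
Proof.
move=> x; apply: (@continuous_comp _ _ _ (fun x : R => k - (x - c) ^+ 2) Num.sqrt).
  apply: cvgB; first exact: cvg_cst.
  have c1 : (fun y : R => y - c) y @[y --> x] --> x - c.
    by apply: cvgB; [exact: cvg_id|exact: cvg_cst].
  exact: (cvgM c1 c1).
exact: sqrt_continuous.
Qed.

(** Abscissae that witness which edges still reach the upper arc of the unit
    circle: [u] and [u'] are taken beyond the disk, on its two sides, whose
    extreme abscissae are [L] and [M]. *)
Lemma branch_marks (R : realType) (s t xL xR L M A B y0 y1 w0 w1 : R) :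
  xL < L -> M < xR -> L < A -> A < B -> B < M ->
  (y0 = L /\ y1 = M) \/ (y0 = M /\ y1 = L) ->
  (y0 = L /\ w0 = A) \/ (y0 = M /\ w0 = B) ->
  (y1 = L /\ w1 = A) \/ (y1 = M /\ w1 = B) ->
  btw y0 t y1 ->
  btw s t ((xL + L) / 2) -> btw s t ((M + xR) / 2) ->
  exists u u', [/\ btw s y0 u, btw y1 t u',
      xL < u < xR /\ xL < u' < xR, (u < A \/ B < u) /\ (u' < A \/ B < u') &
      (~ btw_closed y0 w0 u /\ ~ btw_closed y1 w1 u) /\
      (~ btw_closed y0 w0 u' /\ ~ btw_closed y1 w1 u')].
Proof.
move=> h1 h2 h3 h4 h5 y01 s0 s1 b1 bL bR; rewrite /btw_closed /btw in b1 bL bR *.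
pose m := (xL + L) / 2; pose n := (M + xR) / 2.
have mx : xL < m < L by rewrite /m; lra.
have nx : M < n < xR by rewrite /n; lra.
rewrite -/m -/n in bL bR; move: m n mx nx bL bR => m n mx nx bL bR.
case: y01 => -[y0E y1E].
  have w0E : w0 = A by case: s0 => // -[]; lra.
  have w1E : w1 = B by case: s1 => // -[]; lra.
  rewrite y0E y1E w0E w1E in b1 *.
  clear s0 s1 w0E w1E y0E y1E w0 w1 y0 y1.
  have st : s < t by case: leP b1 bL bR => //; lra.
  exists m, n; split; [lra|lra|lra|split; [left|right]; lra|].
  by split; split; apply/negP; rewrite negb_or; apply/andP; split; lra.
have w0E : w0 = B by case: s0 => // -[]; lra.
have w1E : w1 = A by case: s1 => // -[]; lra.
rewrite y0E y1E w0E w1E in b1 *.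
clear s0 s1 w0E w1E y0E y1E w0 w1 y0 y1.
have st : t < s by case: leP b1 bL bR => //; lra.
exists n, m; split; [lra|lra|lra|split; [right|left]; lra|].
by split; split; apply/negP; rewrite negb_or; apply/andP; split; lra.
Qed.

Lemma middles (R : realType) (x y u : R) : x < y -> y < u ->
  x < (x + y) / 2 < u /\ x < (y + u) / 2 < u.
Proof. by move=> xy yu; split; lra. Qed.

Lemma horn_mark (R : realType) (xL xR L M A B y w : R) :
  xL < L -> M < xR -> L < A -> A < B -> B < M ->
  (y = L /\ w = A) \/ (y = M /\ w = B) ->
  exists t, [/\ btw y w t, xL < t < xR & t < A \/ B < t].
Proof.
move=> h1 h2 h3 h4 h5; case=> -[-> ->].
  by exists ((L + A) / 2); split; [rewrite /btw; lra|lra|left; lra].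
by exists ((M + B) / 2); split; [rewrite /btw; lra|lra|right; lra].
Qed.

Lemma marks_out (R : realType) (L M A B y y' w : R) :
  L < A -> A < B -> B < M -> (y = L /\ y' = M) \/ (y = M /\ y' = L) ->
  (y = L /\ w = A) \/ (y = M /\ w = B) -> ~ btw_closed y w y'.
Proof.
move=> h3 h4 h5; rewrite /btw_closed => -[[-> ->]|[-> ->]] [[E ->]|[E ->]]; lra.
Qed.

Lemma abscissa_at (R : realType) (x c r : R) :
  (x - c - r) * (x - c + r) = 0 -> x = c - r \/ x = c + r.
Proof.
by move/eqP; rewrite mulf_eq0 => /orP[]/eqP E; [right|left]; lra.
Qed.

(** Removing a disk [C] that covers the arc of the unit circle from [a] to [b] and
    has its leftmost and rightmost points inside the region. Between its
    leftmost point and [a] there remains a horn above the disk, between the disk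
    and the unit circle, and likewise on the right. Without the horns the slices
    stay connected and the quotient is the old one; each horn is attached along
    the slice of an extreme point of [C] and ends in a tip, at [a] or [b]. *)
Section BranchCut.
Variable R : realType.
Local Notation U := (unit_circle R).
Variables (cs : seq (circle R)) (G : graph) (act : edge G -> bool).
Variables (xv : vertex G -> R) (lab : R * R -> vertex G + edge G) (e : edge G).
Hypothesis dr : drawing cs act xv lab.
Variables (xl xr yl yu yb : R) (z : R -> R).
Hypothesis pl : plot cs lab e U 1 xl xr yl yu yb z.
Hypothesis yb0 : 0 < yb.
Local Notation Q := (in_box xl xr yl yu).
Local Notation K := (closed_region cs).
Variables (C : circle R) (a b : R * R) (h0 h1 : R).
Hypotheses (ab : a.1 < b.1) (Qa : Q a) (Qb : Q b) (h01 : h0 != h1).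
Hypotheses (Sa : pow U a = 0) (Sb : pow U b = 0).
Hypotheses (cS : center U = pencil_center a b h0).
Hypotheses (cC : center C = pencil_center a b h1).
Hypothesis Ch : forall p, pow C p = pencil a b h1 p.
Hypothesis ball : forall p, pow C p <= 0 -> Q p /\ yb < p.2.
Hypothesis top : forall p, Q p -> pow U p = 0 -> a.1 < p.1 < b.1 -> pow C p < 0.
Hypothesis out : forall p, Q p -> pow U p = 0 -> p.1 < a.1 \/ b.1 < p.1 -> 0 < pow C p.
Local Notation c1 := (center C).1.
Local Notation c2 := (center C).2.
Local Notation r := (radius C).
Hypothesis inL : pow U (c1 - r, c2) < 0.
Hypothesis inR : pow U (c1 + r, c2) < 0.
Local Notation K' := (closed_region (rcons cs C)).

Let lg := pl_lg pl.
Let clE := dr_closure dr.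
Let r0 : 0 < r. Proof. exact: radius_gt0. Qed.
Let Ca : pow C a = 0. Proof. by rewrite Ch /pencil /line; ring. Qed.
Let Cb : pow C b = 0. Proof. by rewrite Ch /pencil /line; ring. Qed.

Let za : z a.1 = a.2. Proof. by rewrite (on_graph lg Qa).1. Qed.
Let zb : z b.1 = b.2. Proof. by rewrite (on_graph lg Qb).1. Qed.

Let trans : forall p, p = a \/ p = b -> cross (p - center U) (p - center C) != 0.
Proof. exact: pencil_trans ab h01 cS cC. Qed.

Let disk_box : forall p, K p -> pow C p <= 0 -> Q p.
Proof. by move=> p _ /ball[]. Qed.

Lemma branch_meet p : Q p -> pow U p = 0 -> pow C p = 0 -> p = a \/ p = b.
Proof.
move=> Qp Up Cp; have pz := (on_graph lg Qp).1 Up.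
have [lt|gt|E] := ltgtP p.1 a.1.
- by have := out Qp Up (or_introl lt); rewrite Cp ltxx.
- have [lt'|gt'|E] := ltgtP p.1 b.1.
  + by have := top Qp Up; rewrite gt lt' Cp ltxx => /(_ isT).
  + by have := out Qp Up (or_intror gt'); rewrite Cp ltxx.
  + by right; rewrite [p]surjective_pairing pz E zb -surjective_pairing.
- by left; rewrite [p]surjective_pairing pz E za -surjective_pairing.
Qed.

Lemma level_pow x : c1 - r <= x <= c1 + r -> pow C (x, c2) <= 0.
Proof. by rewrite /pow /= subrr expr0n addr0 /= => /andP[h1' h2]; nra. Qed.

Lemma level_box x : c1 - r <= x <= c1 + r -> Q (x, c2).
Proof. by move=> /level_pow/ball[]. Qed.

Lemma yb_c2 : yb < c2.
Proof. by have [|_] := ball (p := (c1, c2)); first by apply: level_pow; have := r0; lra. Qed.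

Lemma level_lt x : c1 - r <= x <= c1 + r -> c2 < z x.
Proof.
move=> hx; have := lg_lt lg (level_box hx); rewrite mul1r /= => ->.
move: inL inR hx; rewrite !pow_unit /= => hL hR /andP[h1' h2].
have [x0|x0] := leP 0 x; first by nra.
by nra.
Qed.

Lemma disk_x x : c1 - r <= x <= c1 + r -> xl < x < xr.
Proof. by move=> /level_box/plot_x. Qed.

Lemma corner_x p : p = a \/ p = b -> c1 - r < p.1 < c1 + r.
Proof.
move=> pab; have [Cp zp] : pow C p = 0 /\ z p.1 = p.2 by case: pab => ->.
have h : c1 - r <= p.1 <= c1 + r.
  have s0 := sqr_ge0 (p.2 - c2); have r0' := r0.
  by move: Cp; rewrite /pow => Cp; apply/andP; split; nra.
have := level_lt h; rewrite zp; move: Cp h; rewrite /pow => Cp /andP[h1' h2] h3.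
have h4 : 0 < (p.2 - c2) ^+ 2 by rewrite exprn_even_gt0 //= subr_eq0 gt_eqF.
rewrite !lt_neqAle h1' h2 !andbT; apply/andP; split; apply/eqP => E.
  have : (p.1 - c1) ^+ 2 = r ^+ 2 by rewrite -E; ring.
  lra.
have : (p.1 - c1) ^+ 2 = r ^+ 2 by rewrite E; ring.
lra.
Qed.

Lemma graph_gt0 x : xl < x < xr -> 0 < z x.
Proof. by move=> hx; exact: lt_trans yb0 (pl_base pl hx). Qed.

Lemma graph_sqrt x : xl < x < xr -> z x = Num.sqrt (1 - (x - 0) ^+ 2).
Proof.
move=> hx; have := plot_graph_pow pl hx; rewrite pow_unit /= => E.
have -> : 1 - (x - 0) ^+ 2 = z x ^+ 2 by rewrite subr0; lra.
by rewrite sqrtr_sqr ger0_norm // ltW // graph_gt0.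
Qed.

(** The graph over the interval from [a.1] to [b.1] is inside [C], and the disk is
    convex. *)
Lemma no_roof p : Q p -> K p -> 0 <= pow C p -> c2 < p.2 ->
  p.1 <= a.1 \/ b.1 <= p.1.
Proof.
move=> Qp Kp Cp cp; have [|lt] := leP p.1 a.1; first by left.
have [|lt'] := leP b.1 p.1; first by right.
exfalso; have hx := plot_x Qp; have pz := (lg_closed lg Qp).1 Kp.
have := top (plot_graph pl hx) (plot_graph_pow pl hx); rewrite /= lt lt' => /(_ isT).
by move: Cp; rewrite /pow /=; nra.
Qed.

(** The upper half circle of [C], continued at the level of the center. *)
Definition roof (x : R) : R := c2 + Num.sqrt (r ^+ 2 - (x - c1) ^+ 2).

Lemma roof_pow p : roof p.1 < p.2 -> 0 < pow C p.
Proof.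
rewrite /roof /pow => h; have s0 := sqrtr_ge0 (r ^+ 2 - (p.1 - c1) ^+ 2).
have [h'|h'] := leP 0 (r ^+ 2 - (p.1 - c1) ^+ 2).
  have E := sqr_sqrtr h'; set s := Num.sqrt _ in h s0 E.
  have : s ^+ 2 < (p.2 - c2) ^+ 2 by rewrite ltr_sqr ?nnegrE; lra.
  by rewrite E; lra.
by have := sqr_ge0 (p.2 - c2); lra.
Qed.

Lemma pow_roof p : c2 < p.2 -> 0 < pow C p -> roof p.1 < p.2.
Proof.
rewrite /roof /pow => h Cp; have s0 := sqrtr_ge0 (r ^+ 2 - (p.1 - c1) ^+ 2).
have [h'|h'] := leP 0 (r ^+ 2 - (p.1 - c1) ^+ 2); last first.
  by rewrite ler0_sqrtr ?addr0 // ltW.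
have E := sqr_sqrtr h'; set s := Num.sqrt _ in s0 E *.
have : s ^+ 2 < (p.2 - c2) ^+ 2 by rewrite E; lra.
by rewrite ltr_sqr ?nnegrE; lra.
Qed.

Lemma roof_continuous : continuous roof.
Proof.
move=> x; apply: cvgD; first exact: cvg_cst.
exact: sqrt_sub_continuous.
Qed.

Lemma horn_connected x0 x1 : xl <= x0 -> x1 <= xr ->
  (forall x, x0 < x < x1 -> roof x < z x) ->
  let W := [set q : R * R | x0 < q.1 < x1 /\ roof q.1 < q.2 < z q.1] in
  connected W /\ W `<=` ([set p | Q p] `&` open_region cs) `&`
     (open_region cs `&` [set p | 0 < pow C p]).
Proof.
move=> h0' h1' hW W; have hx x : x0 < x < x1 -> xl < x < xr by lra.
split.
  have -> : W = [set q : R * R | x0 < q.1 < x1 /\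
      roof q.1 < q.2 < Num.sqrt (1 - (q.1 - 0) ^+ 2)].
    by rewrite /W; apply/seteqP; split=> q /= [hq]; rewrite graph_sqrt ?hx //; split.
  apply: (@strip_connected _ roof (fun x => Num.sqrt (1 - (x - 0) ^+ 2))).
    exact: roof_continuous.
    exact: sqrt_sub_continuous.
  by move=> x hx'; rewrite -graph_sqrt ?hx // hW.
move=> q [/= hq /andP[rq qz]].
have Qq : Q q.
  rewrite /in_box hx //=; have /andP[_ zu] := lg_z lg (hx _ hq).
  have := yb_c2; have := pl_yb pl.
  move: rq; rewrite /roof; have := sqrtr_ge0 (r ^+ 2 - (q.1 - c1) ^+ 2); lra.
have Dq : open_region cs q by apply/(lg_open lg Qq).
by split; split=> //=; exact: roof_pow.
Qed.

Lemma base_pow x : 0 < pow C (x, yb).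
Proof. by rewrite ltNge; apply/negP => /ball[_] /=; rewrite ltxx. Qed.

Lemma roof_lt x : xl < x < xr -> pow U (x, c2) < 0 -> Q (x, c2) ->
  x < a.1 \/ b.1 < x -> roof x < z x.
Proof.
move=> hx Ux Qx hab.
have cz : c2 < z x by have := lg_lt lg Qx; rewrite mul1r /= => ->.
have := out (plot_graph pl hx) (plot_graph_pow pl hx) hab.
by move/pow_roof => /= /(_ cz).
Qed.

Lemma level_near x : pow U (x, c2) < 0 -> Q (x, c2) ->
  exists2 d : R, 0 < d & forall y, `|y - x| < d -> pow U (y, c2) < 0 /\ Q (y, c2).
Proof.
move=> Ux Qx.
have : nbhs (x, c2) ([set p | pow U p < 0] `&` [set p | Q p]).
  apply: filterI; apply: open_nbhs_nbhs; split=> //; first exact: pow_open_lt.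
  exact: open_box.
move=> /nbhs_ballP[d d0 Hd]; exists d => // y yd; apply: Hd; split=> /=.
  by rewrite -ball_normE /= distrC.
exact: ballxx.
Qed.

(** Points under the disk or beside it can be joined to the base line by a
    vertical segment; the others are in a horn, along which one can leave the
    strip above the disk. *)
Lemma branch_connected : connected (open_region (rcons cs C)).
Proof.
have [_ [oD cD] _ _ _] := dr_ss dr.
rewrite open_region_rcons.
apply: (@connected_cut _ (open_region cs) _ ([set p | Q p] `&` open_region cs)).
- exact: cD.
- by apply: openI; [exact: open_region_open|exact: pow_open_gt].
- exact: subIsetl.
- by apply: openI; [exact: open_box|exact: open_region_open].
- move=> p [Dp nC]; split=> //.
  have Cp : pow C p <= 0 by rewrite leNgt; apply/negP => Cp; apply: nC.
  by have [] := ball Cp.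
pose N := ([set p | Q p] `&` open_region cs) `&` (open_region cs `&` [set p | 0 < pow C p]).
pose B := (fun x : R => (x, yb)) @` `]xl, xr[%classic.
have inN p : Q p -> p.2 < z p.1 -> 0 < pow C p -> N p.
  move=> Qp pz Cp; have Dp : open_region cs p by apply/(lg_open lg Qp).
  by [].
(* below or beside the disk, nothing separates a point from the base line *)
have low p : N p -> p.2 <= c2 \/ p.1 < c1 - r \/ c1 + r < p.1 ->
    exists A, [/\ connected A, A `<=` N, A p & A `&` B !=set0].
  move=> [[/= Qp _] [Dp /= Cp]] hp.
  have hx := plot_x Qp; have pz := (lg_open lg Qp).1 Dp.
  have yz := pl_base pl hx; have Qb' := plot_basepoint pl hx.
  pose m := Num.min p.2 yb; pose M := Num.max p.2 yb.
  exists [set q | q.1 = p.1 /\ m <= q.2 <= M]; split.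
  - exact: vertical_connected.
  - move=> q /= [qp /andP[mq qM]].
    have qz : q.2 < z q.1.
      by rewrite qp; apply: le_lt_trans qM _; rewrite gt_max pz yz.
    have Qq : Q q.
      rewrite /in_box qp hx /=; have /andP[_ /andP[h1' h2]] := Qp.
      have /andP[_ /= /andP[h3 h4]] := Qb'.
      move: mq qM; rewrite /m /M ge_min le_max; lra.
    apply: inN => //; rewrite ltNge; apply/negP => Cq.
    have [_ ybq] := ball Cq.
    have qp2 : q.2 <= p.2 by move: qM; rewrite le_max => /orP[//|]; rewrite leNgt ybq.
    have s0 := sqr_ge0 (q.2 - c2); have r0' := r0.
    move: Cp Cq; rewrite /pow qp; case: hp => [pc|hp] Cp' Cq; first by nra.
    have : r ^+ 2 < (p.1 - c1) ^+ 2 by case: hp => px; nra.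
    lra.
  - by split=> //; rewrite /m /M ge_min lexx /= le_max lexx.
  exists (p.1, yb); split=> /=; last by exists p.1; rewrite // in_itv.
  by split=> //; rewrite /m /M ge_min lexx orbT le_max lexx orbT.
apply: (@comb_connected _ _ B).
- apply: connected_continuous_connected; first exact/connected_intervalP/interval_is_interval.
  apply: continuous_subspaceT => y.
  by apply: cvg_pair_nbhs; [exact: cvg_id|exact: cvg_cst].
- move=> _ [x + <-]; rewrite /= in_itv /= => hx.
  apply: inN; [exact: (plot_basepoint pl hx)|exact: (pl_base pl hx)|exact: base_pow].
move=> p Np; have [[/= Qp _] [Dp /= Cp]] := Np.
have [|pc] := leP p.2 c2; first by move=> h; apply: low => //; left.
have [|pL] := ltP p.1 (c1 - r); first by move=> h; apply: low => //; right; left.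
have [|pR] := ltP (c1 + r) p.1; first by move=> h; apply: low => //; right; right.
have hx := plot_x Qp; have pz := (lg_open lg Qp).1 Dp.
have rp := pow_roof pc Cp.
(* a horn reaches beyond the disk, where its points see the base line *)
have horn x0 x1 x2 : xl <= x0 -> x1 <= xr -> (forall x, x0 < x < x1 -> roof x < z x) ->
    x0 < p.1 < x1 -> x0 < x2 < x1 -> x2 < c1 - r \/ c1 + r < x2 ->
    exists A, [/\ connected A, A `<=` N, A p & A `&` B !=set0].
  move=> hx0 hx1 hW px hx2 x2o; have [cW WN] := horn_connected hx0 hx1 hW.
  set W := [set q | _] in cW WN.
  pose q : R * R := (x2, (roof x2 + z x2) / 2).
  have Wq : W q by split=> //=; have := hW _ hx2; lra.
  have [A [cA AN Aq [s [As Bs]]]] := low q (WN q Wq) (or_intror x2o).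
  exists (W `|` A); split.
  - by apply: connectedU => //; exists q.
  - by move=> s' [/WN|/AN].
  - by left; split=> //; rewrite rp pz.
  - by exists s; split=> //; right.
have cab : p.1 < a.1 \/ b.1 < p.1.
  case: (no_roof Qp (open_region_sub Dp) (ltW Cp) pc); rewrite le_eqVlt => /orP[/eqP E|]; try by [left|right].
    exfalso; move: Cp Ca pz; rewrite /pow E za => *; nra.
  exfalso; move: Cp Cb pz; rewrite /pow -E zb => *; nra.
case: cab => cab.
  have [d d0 hd] := level_near inL (level_box (x := c1 - r) (ltac:(have := r0; lra))).
  have := disk_x (x := c1 - r) (ltac:(have := r0; lra)) => /andP[xlL _].
  pose d' := Num.min d (c1 - r - xl).
  have d'0 : 0 < d' by rewrite lt_min d0 subr_gt0.
  have d'd : d' <= d by rewrite ge_min lexx.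
  have d'x : d' <= c1 - r - xl by rewrite ge_min lexx orbT.
  have /andP[_ axr] := plot_x Qa.
  apply: (horn (c1 - r - d') a.1 (c1 - r - d' / 2)); try lra.
  move=> x hx'; have [xL|xL] := leP (c1 - r) x.
      have hx2 : c1 - r <= x <= c1 + r by have := corner_x (or_introl erefl : a = a \/ a = b); lra.
      apply: roof_lt; [exact: disk_x| |exact: level_box|left; lra].
      have := level_lt hx2; have := lg_lt lg (level_box hx2).
      by rewrite mul1r /= => -> .
    have [|Ux Qx] := hd x; first by rewrite ltr_norml; lra.
    by apply: roof_lt => //; [exact: plot_x Qx|left; lra].
have [d d0 hd] := level_near inR (level_box (x := c1 + r) (ltac:(have := r0; lra))).
have := disk_x (x := c1 + r) (ltac:(have := r0; lra)) => /andP[_ xrR].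
pose d' := Num.min d (xr - (c1 + r)).
have d'0 : 0 < d' by rewrite lt_min d0 subr_gt0.
have d'd : d' <= d by rewrite ge_min lexx.
have d'x : d' <= xr - (c1 + r) by rewrite ge_min lexx orbT.
have /andP[bxl _] := plot_x Qb.
apply: (horn b.1 (c1 + r + d') (c1 + r + d' / 2)); try lra.
move=> x hx'; have [xR|xR] := leP x (c1 + r).
    have hx2 : c1 - r <= x <= c1 + r by have := corner_x (or_intror erefl : b = a \/ b = b); lra.
    apply: roof_lt; [exact: disk_x| |exact: level_box|right; lra].
    have := level_lt hx2; have := lg_lt lg (level_box hx2).
    by rewrite mul1r /= => -> .
  have [|Ux Qx] := hd x; first by rewrite ltr_norml; lra.
  by apply: roof_lt => //; [exact: plot_x Qx|right; lra].
Qed.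

(** What is above or inside the disk, in the box. *)
Definition shadow : set (R * R) :=
  [set p | [&& in_box xl xr yl yu p, c1 - r < p.1 < c1 + r & (c2 < p.2) || (pow C p < 0)]].

Lemma shadow_open : open shadow.
Proof.
have -> : shadow = ([set p | Q p] `&` [set p | in_box (c1 - r) (c1 + r) (yl - 1) (yu + 1) p])
    `&` ([set p | in_box (c1 - r) (c1 + r) c2 (yu + 1) p] `|` [set p | pow C p < 0]).
  apply/seteqP; split=> p; rewrite /shadow /in_box /=.
    case/and3P=> /andP[hx hy] hr h; split.
      by split; [apply/andP|rewrite hr /=; move: hy; lra].
    by case/orP: h => h; [left; rewrite hr h /=; move: hy; lra|right].
  case=> -[/andP[-> ->] /andP[-> _]] [/andP[_ /andP[-> _]] //|->].
  by rewrite orbT.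
apply: openI; first by apply: openI; exact: open_box.
by apply: openU; [exact: open_box|exact: pow_open_lt].
Qed.

Definition floor : set (R * R) := K `&` ~` shadow.

Lemma floor_closed : closed floor.
Proof.
apply: closedI; first exact: closed_region_closed.
by rewrite closedC; exact: shadow_open.
Qed.

Lemma lab_box p : Q p -> K p -> lab p = inr e.
Proof. exact: (pl_lab pl). Qed.

Lemma not_box_floor p : K p -> ~ Q p -> floor p.
Proof. by move=> Kp nQ; split=> // /and3P[Qp]. Qed.

Lemma base_floor x : xl < x < xr -> floor (x, yb) /\ lab (x, yb) = inr e.
Proof.
move=> hx; have Qb' := plot_basepoint pl hx.
have Kb : K (x, yb) by apply/(lg_closed lg Qb')/ltW/(pl_base pl).
split; last exact: lab_box.
split=> // /and3P[_ _] /=; have := yb_c2; have := base_pow x.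
by move=> h1' h2 /orP[]; lra.
Qed.

Lemma floor_layout : layout floor xv lab.
Proof.
have L := dr_layout dr; apply: (layout_restrict L).
- exact: subIsetl.
- exact: floor_closed.
- move=> v; have [p [Kp lp]] := lay_v L v; exists p; split=> //.
  by apply: not_box_floor => // Qp; move: lp; rewrite lab_box.
- move=> f t ft; have [p [Kp lp pt]] := lay_e L ft.
  have [Qp|nQ] := pselect (Q p); last by exists p; split=> //; exact: not_box_floor.
  have [fb lb] := base_floor (plot_x Qp).
  by exists (p.1, yb); rewrite lb -lp lab_box.
- move=> p q y [Kp nsp] [Kq nsq] lpq pq /andP[py yq] Ky ly.
  split=> // /and3P[Qy xr' h].
  have hx := plot_x Qy; rewrite /= pq in hx xr'.
  have lq : lab q = inr e by rewrite -lpq -ly lab_box.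
  have qz := plot_top dr pl Kq lq hx; have /andP[_ zu] := lg_z lg hx.
  have Qq : Q q by move: Qy; rewrite /in_box /= hx pq hx /=; lra.
  apply: nsq; apply/and3P; split=> //; rewrite /= pq in h *.
  case/orP: h => h; first by apply/orP; left; apply: lt_le_trans yq.
  have [qc|qc] := ltP c2 q.2; first by [].
  by apply/orP; right; move: h; rewrite /pow /=; nra.
Qed.

Section Horn.
Variables (y w : R).
Hypothesis side : (y = c1 - r /\ w = a.1) \/ (y = c1 + r /\ w = b.1).

Definition horn : set (R * R) :=
  [set p | [/\ btw_closed y w p.1, c2 <= p.2, pow U p <= 0 & 0 <= pow C p]].

Lemma horn_x t : btw_closed y w t ->
  [/\ c1 - r <= t <= c1 + r, t <= a.1 \/ b.1 <= t & t != y -> c1 - r < t < c1 + r].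
Proof.
have ha := corner_x (or_introl erefl : a = a \/ a = b).
have hb := corner_x (or_intror erefl : b = a \/ b = b).
rewrite /btw_closed; case: side => -[-> ->] h; split;
  by [lra|left; lra|right; lra|rewrite neq_lt; lra].
Qed.

Lemma horn_side_neq : w != y.
Proof.
have ha := corner_x (or_introl erefl : a = a \/ a = b).
have hb := corner_x (or_intror erefl : b = a \/ b = b).
by rewrite neq_lt; case: side => -[-> ->]; lra.
Qed.

Lemma horn_region p : horn p -> Q p /\ K p.
Proof.
case=> hx cp Up Cp; have [h _ _] := horn_x hx; have hx' := disk_x h.
have pz : p.2 <= z p.1.
  have := plot_graph_pow pl hx'; have := graph_gt0 hx'; move: Up.
  by rewrite !pow_unit /= => h2 h3 h4; have := yb_c2; nra.
have Qp : Q p.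
  rewrite /in_box hx' /=; have /andP[_ zu] := lg_z lg hx'.
  by have := yb_c2; have := pl_yb pl; lra.
by split=> //; apply/(lg_closed lg Qp).
Qed.

Lemma horn_closed : closed horn.
Proof.
have -> : horn = ([set p | btw_closed y w p.1] `&` [set p | c2 <= p.2]) `&`
    ([set p | pow U p <= 0] `&` [set p | 0 <= pow C p]).
  by apply/seteqP; split=> p /=; [case|case=> -[? ?] []].
apply: closedI; apply: closedI.
- exact: closed_btw.
- exact: closed_snd_ge.
- exact: pow_closed_le.
- exact: pow_closed_ge.
Qed.

Lemma horn_floor p : horn p -> floor p <-> p.1 = y.
Proof.
move=> Hp; have [Qp Kp] := horn_region Hp; have [hx cp Up Cp] := Hp.
have [h _ hs] := horn_x hx; split.
  case=> _ ns; apply/eqP; apply: contraT => /hs hr; case: ns.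
  apply/and3P; split=> //; apply/orP; left.
  rewrite lt_neqAle cp andbT; apply/eqP => E.
  by move: Cp; rewrite /pow -E subrr expr0n /= addr0; nra.
move=> py; split=> // /and3P[_ hr _]; move: hr; rewrite py.
by case: side => -[-> _]; rewrite ltxx ?andbF.
Qed.

Lemma horn_graph t : btw_closed y w t -> horn (t, z t).
Proof.
move=> ht; have [h hab _] := horn_x ht; have hx := disk_x h.
split=> //=; first exact/ltW/level_lt.
  by rewrite (plot_graph_pow pl hx).
have Cab : pow C (a.1, z a.1) = 0 /\ pow C (b.1, z b.1) = 0.
  by rewrite za zb -!surjective_pairing.
case: hab; rewrite le_eqVlt => /orP[/eqP E|lt].
- by rewrite E Cab.1.
- by apply/ltW/(out (plot_graph pl hx) (plot_graph_pow pl hx)); left.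
- by rewrite -E Cab.2.
- by apply/ltW/(out (plot_graph pl hx) (plot_graph_pow pl hx)); right.
Qed.

Lemma horn_convex p q t : horn p -> horn q -> p.1 = q.1 -> p.2 <= t <= q.2 ->
  horn (p.1, t).
Proof.
move=> [hx cp Up Cp] [_ cq Uq Cq] pq /andP[pt tq]; split=> //=.
- exact: le_trans cp pt.
- have : t ^+ 2 <= q.2 ^+ 2 by rewrite ler_sqr ?nnegrE; have := lt_trans yb0 yb_c2; lra.
  by move: Uq; rewrite !pow_unit /= pq; lra.
- by move: Cp; rewrite /pow /=; nra.
Qed.

Lemma horn_tip : exists p, [/\ p = a \/ p = b, p.1 = w & horn p].
Proof.
have hw : btw_closed y w w by rewrite btw_closedE eqxx !orbT.
have := horn_graph hw; case: side => -[_ ->].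
  by rewrite za -surjective_pairing => Ha; exists a; split=> //; left.
by rewrite zb -surjective_pairing => Hb; exists b; split=> //; right.
Qed.

End Horn.

Lemma horn_disjoint y w y' w' p :
  (y = c1 - r /\ w = a.1) \/ (y = c1 + r /\ w = b.1) ->
  (y' = c1 - r /\ w' = a.1) \/ (y' = c1 + r /\ w' = b.1) -> y != y' ->
  horn y w p -> ~ btw_closed y' w' p.1.
Proof.
have ha := corner_x (or_introl erefl : a = a \/ a = b).
have hb := corner_x (or_intror erefl : b = a \/ b = b).
by move=> [[-> ->]|[-> ->]] [[-> ->]|[-> ->]]; rewrite ?eqxx // => _ [h _ _ _] h';
   move: h h' ab; rewrite /btw_closed => /orP[] h /orP[] h'; lra.
Qed.

Lemma branch_cover : K' =
  (floor `|` horn (c1 - r) a.1) `|` horn (c1 + r) b.1.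
Proof.
have sL : (c1 - r = c1 - r /\ a.1 = a.1) \/ (c1 - r = c1 + r /\ a.1 = b.1) by left.
have sR : (c1 + r = c1 - r /\ b.1 = a.1) \/ (c1 + r = c1 + r /\ b.1 = b.1) by right.
rewrite closed_region_rcons; apply/seteqP; split=> p /=.
  case=> Kp Cp; have [|sp] := pselect (~ shadow p); first by left; left.
  have {sp} : shadow p by apply: contrapT.
  case/and3P=> Qp /andP[lx rx]; rewrite [pow C p < 0]ltNge Cp orbF => cp.
  have Up : pow U p <= 0 by case: Kp.
  have [pa|pb] := no_roof Qp Kp Cp cp.
    by left; right; split=> //; [rewrite /btw_closed; lra|exact: ltW].
  by right; split=> //; [rewrite /btw_closed; lra|exact: ltW].
case=> [[[Kp ns]|H]|H].
- split=> //; rewrite leNgt; apply/negP => Cp; apply: ns.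
  have [Qp _] := ball (ltW Cp); apply/and3P; split=> //; last by rewrite Cp orbT.
  have := sqr_ge0 (p.2 - c2); have := r0; move: Cp; rewrite /pow => Cp r0' s0.
  by apply/andP; split; nra.
- by have [Qp Kp] := horn_region sL H; case: H.
- by have [Qp Kp] := horn_region sR H; case: H.
Qed.

Let clC := fresh_closure lg clE disk_box branch_meet trans.

Lemma branch_old p : K p -> ~ Q p -> 0 < pow C p.
Proof. by move=> Kp nQ; rewrite ltNge; apply/negP => /ball[]. Qed.

(** The layout is split at the abscissae [y0] and [y1] of the extreme points of
    [C], in their order along the edge, and the horns are glued to the new
    vertices. *)
Theorem branch_cut : exists xv' lab',
  drawing (rcons cs C) (@branch_active G e act) xv' lab'.
Proof.
have ha := corner_x (or_introl erefl : a = a \/ a = b).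
have hb := corner_x (or_intror erefl : b = a \/ b = b).
have hL : c1 - r <= c1 - r <= c1 + r by have := r0; lra.
have hR : c1 - r <= c1 + r <= c1 + r by have := r0; lra.
have LR : c1 - r < c1 + r by have := r0; lra.
have [y0 [y1 [y01 by0 by1]]] := btw_order dr LR (plot_btw dr pl (disk_x hL)) (plot_btw dr pl (disk_x hR)).
have [w0 [w1 [side0 side1 wE]]] : exists w0 w1,
    [/\ (y0 = c1 - r /\ w0 = a.1) \/ (y0 = c1 + r /\ w0 = b.1),
        (y1 = c1 - r /\ w1 = a.1) \/ (y1 = c1 + r /\ w1 = b.1) &
        (floor `|` horn (c1 - r) a.1) `|` horn (c1 + r) b.1 =
        (floor `|` horn y0 w0) `|` horn y1 w1].
  case: y01 => -[-> ->]; first by exists a.1, b.1; split=> //; [left|right].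
  by exists b.1, a.1; split=> //; [right|left|rewrite -!setUA [horn _ b.1 `|` _]setUC].
have y01n : y0 != y1 by case: y01 => -[-> ->]; rewrite neq_lt LR ?orbT.
have y10n : y1 != y0 by rewrite eq_sym.
have L1 := layout_split floor_layout by0.
have L2 := @layout_split _ _ _ _ _ (None : edge (split_edge e)) y1 L1 by1.
set xv1 := split_xv xv y0 in L1 L2 *; set lab1 := split_lab xv lab e y0 in L1 L2 *.
set xv2 := split_xv xv1 y1 in L2 *.
set lab2 := split_lab xv1 lab1 (None : edge (split_edge e)) y1 in L2 *.
have simple2 : simple_graph (split_twice e).
  apply: simple_split; last exact/simple_split/(dr_simple dr)/(drawing_loopless dr).
  by move=> f; apply/negP => /eqP E; have := lay_ends L1 f; rewrite E eqxx.
have lab_y0 p : lab p = inr e -> p.1 = y0 -> lab2 p = inl (Some None).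
  by move=> lp py; apply: split_lab_vertex; exact: split_lab_at.
have lab_y1 p : lab p = inr e -> p.1 = y1 -> lab2 p = inl None.
  move=> lp py; apply: split_lab_at => //.
  by apply: split_lab_tgt; rewrite // py.
have horn_lab y w p : (y = c1 - r /\ w = a.1) \/ (y = c1 + r /\ w = b.1) ->
    horn y w p -> lab p = inr e.
  by move=> sd /(horn_region sd)[]; exact: lab_box.
pose n0 : vertex (split_twice e) := Some None.
have L3 : layout (floor `|` horn y0 w0) (leaf_xv xv2 w0) (leaf_lab (horn y0 w0) xv2 lab2 n0 w0).
  have [f nf] := simple2.1 n0.
  apply: (layout_leaf L2).
  - exact: (horn_side_neq side0).
  - exact: (layout_vertex_closed L2 nf).
  - exact: horn_closed.
  - by move=> p [].
  - by move=> p; exact: (horn_floor side0).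
  - by move=> p Hp; exact/lab_y0/(horn_lab _ _ _ side0 Hp).
  - by move=> t ht _; exists (t, z t) => //; exact: (horn_graph side0).
  - by move=> p q t Hp Hq pq _; exact: (horn_convex Hp Hq).
set xv3 := leaf_xv xv2 w0 in L3 *.
set lab3 := leaf_lab (horn y0 w0) xv2 lab2 n0 w0 in L3 *.
have simple3 : simple_graph (add_leaf n0) by exact: simple_leaf.
pose n1 : vertex (add_leaf n0) := Some None.
have dis01 p : horn y0 w0 p -> ~ btw_closed y1 w1 p.1 by exact: horn_disjoint.
have dis10 p : horn y1 w1 p -> ~ btw_closed y0 w0 p.1 by exact: horn_disjoint.
have out0 p : ~ btw_closed y0 w0 p.1 -> lab3 p = leaf_old n0 (lab2 p).
  by move=> h; apply: leaf_lab_out => -[].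
have out1 p : ~ btw_closed y1 w1 p.1 ->
    leaf_lab (horn y1 w1) xv3 lab3 n1 w1 p = leaf_old n1 (lab3 p).
  by move=> h; apply: leaf_lab_out => -[].
have y1_out0 : ~ btw_closed y0 w0 y1.
  by have [/andP[aL _] /andP[_ bR]] := (ha, hb); exact: (marks_out aL ab bR y01 side0).
have y0_out1 : ~ btw_closed y1 w1 y0.
  have [/andP[aL _] /andP[_ bR]] := (ha, hb); apply: (marks_out aL ab bR _ side1).
  by case: y01 => -[-> ->]; [right|left].
have L4 : layout ((floor `|` horn y0 w0) `|` horn y1 w1) (leaf_xv xv3 w1)
    (leaf_lab (horn y1 w1) xv3 lab3 n1 w1).
  have [f nf] := simple3.1 n1.
  apply: (layout_leaf L3).
  - exact: (horn_side_neq side1).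
  - exact: (layout_vertex_closed L3 nf).
  - exact: horn_closed.
  - by move=> p [].
  - move=> p Hp; split.
      by case=> [/(horn_floor side1 Hp)//|H0]; case: (dis01 _ H0); case: Hp.
    by move=> py; left; apply/(horn_floor side1 Hp).
  - move=> p Hp py; rewrite out0; last exact: dis10.
    by rewrite (lab_y1 _ (horn_lab _ _ _ side1 Hp) py).
  - by move=> t ht _; exists (t, z t) => //; exact: (horn_graph side1).
  - by move=> p q t Hp Hq pq _; exact: (horn_convex Hp Hq).
set xv4 := leaf_xv xv3 w1 in L4 *.
set lab4 := leaf_lab (horn y1 w1) xv3 lab3 n1 w1 in L4 out1 *.
rewrite -wE -branch_cover in L4.
have off_horn y w p : (y = c1 - r /\ w = a.1) \/ (y = c1 + r /\ w = b.1) ->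
    lab p <> inr e -> ~ horn y w p.
  by move=> sd lp /(horn_lab _ _ _ sd).
have lab_off p : lab p <> inr e -> lab4 p = leaf_old n1 (leaf_old n0 (lab2 p)).
  move=> lp; rewrite /lab4 leaf_lab_out; last exact: (off_horn _ _ _ side1 lp).
  by rewrite /lab3 leaf_lab_out //; exact: (off_horn _ _ _ side0 lp).
have old_v p v : lab p = inl v -> lab4 p = inl (Some (Some (Some (Some v)))).
  move=> lp; rewrite lab_off ?lp //.
  have -> // : lab2 p = inl (Some (Some v)).
  by do 2 apply: split_lab_vertex.
have old_e p f : lab p = inr f -> f != e -> lab4 p = inr (Some (Some (Some (Some f)))).
  move=> lp fe; rewrite lab_off ?lp //; last by case=> E; rewrite E eqxx in fe.
  have -> // : lab2 p = inr (Some (Some f)).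
  by apply: split_lab_other => //; exact: split_lab_other.
have new_y0 p : lab p = inr e -> p.1 = y0 -> lab4 p = inl (Some (Some (Some None))).
  move=> lp py; rewrite out1 ?py // /lab3 leaf_lab_base //.
  by rewrite lab_y0.
have new_y1 p : lab p = inr e -> p.1 = y1 -> lab4 p = inl (Some (Some None)).
  move=> lp py; rewrite /lab4 leaf_lab_base // out0 ?py //.
  by rewrite lab_y1.
have w0y0 := horn_side_neq side0; have w1y1 := horn_side_neq side1.
have tip0 p : horn y0 w0 p -> p.1 = w0 -> lab4 p = inl (Some None).
  move=> Hp pw; rewrite out1; last exact: dis01.
  by rewrite /lab3 leaf_lab_tip.
have tip1 p : horn y1 w1 p -> p.1 = w1 -> lab4 p = inl None.
  by move=> Hp pw; rewrite /lab4 leaf_lab_tip.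
have lab_tip p : p = a \/ p = b -> exists v, lab4 p = inl v.
  have [q0 [q0ab q0w H0]] := horn_tip side0; have [q1 [q1ab q1w H1]] := horn_tip side1.
  have q01 : q0 <> q1.
    by move=> E; case: (dis01 _ H0); rewrite E; case: H1.
  have t0 := tip0 _ H0 q0w; have t1 := tip1 _ H1 q1w.
  move=> pab; have [E|E] : p = q0 \/ p = q1.
    by case: pab q0ab q1ab q01 => -> [] -> [] -> //; [left|right|right|left].
  - by exists (Some None); rewrite E.
  - by exists None; rewrite E.
have extreme x : x = c1 - r \/ x = c1 + r -> singular fst (punctured (rcons cs C)) (x, c2)
    /\ lab (x, c2) = inr e.
  move=> xE; have hx : c1 - r <= x <= c1 + r by case: xE => ->.
  have Qx := level_box hx.
  have Dx : open_region cs (x, c2) by apply/(lg_open lg Qx); exact: level_lt.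
  split; last exact/(lab_box Qx)/open_region_sub.
  apply: (fresh_extreme lg clE disk_box branch_meet trans Dx) => //.
  by rewrite /pow /=; case: xE => ->; ring.
have y0E : y0 = c1 - r \/ y0 = c1 + r by case: side0 => -[-> _]; [left|right].
have y1E : y1 = c1 - r \/ y1 = c1 + r by case: side1 => -[-> _]; [left|right].
exists xv4, lab4; split=> //.
- exact: (fresh_ss_region lg clE (dr_ss dr) disk_box Qa Qb Sa Ca Sb Cb branch_meet trans branch_connected).
- exact: simple_leaf.
- move=> p sp.
  have K'p : K' p by move: sp => [/(bd_punctured _ clC)[]].
  move: (K'p); rewrite closed_region_rcons => -[Kp /=].
  rewrite le_eqVlt => /orP[/eqP/esym Cp|Cp].
    have := singular_on_fresh lg clE disk_box branch_meet trans sp Cp.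
    case=> [pa|[pb|[_ p2]]]; first by apply: lab_tip; left.
      by apply: lab_tip; right.
    have lp : lab p = inr e by apply: lab_box => //; apply: disk_box; rewrite ?Cp.
    have : p.1 = y0 \/ p.1 = y1.
      have : (p.1 - c1 - r) * (p.1 - c1 + r) = 0.
        by move: Cp; rewrite /pow p2 subrr => <-; ring.
      by move/abscissa_at; case: y01 => -[-> ->] []; by [left|right].
    by case=> py; [exists (Some (Some (Some None))); exact: new_y0
                  |exists (Some (Some None)); exact: new_y1].
  have := (fresh_singular lg clE disk_box branch_meet trans Cp).1 sp.
  by move/(dr_sing dr) => [v /old_v]; exists (Some (Some (Some (Some v)))).
- have corner p : p = a \/ p = b -> singular fst (punctured (rcons cs C)) p.
    exact: (fresh_corner lg clE disk_box Qa Qb Sa Ca Sb Cb branch_meet trans).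
  case=> [[[[v|]|]|]|].
  + have [p sp lp] := dr_vertex dr v; exists p; last exact: old_v.
    have Kp : K p by case: sp => /(bd_punctured _ clE)[].
    apply/(fresh_singular lg clE disk_box branch_meet trans) => //.
    by apply: branch_old => // Qp; move: lp; rewrite lab_box.
  + have [sx lx] := extreme y0 y0E; exists (y0, c2) => //; exact: new_y0.
  + have [sx lx] := extreme y1 y1E; exists (y1, c2) => //; exact: new_y1.
  + have [p [pab pw Hp]] := horn_tip side0; exists p; [exact: corner|exact: tip0].
  + have [p [pab pw Hp]] := horn_tip side1; exists p; [exact: corner|exact: tip1].
- have on_top t : xl < t < xr -> t < a.1 \/ b.1 < t ->
      [/\ K' (t, z t), lab (t, z t) = inr e, pow U (t, z t) = 0 & 0 < z t].
    move=> ht hab; have Qt := plot_graph pl ht; have Ut := plot_graph_pow pl ht.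
    have Kt := plot_graph_closed pl ht; split=> //.
    - rewrite closed_region_rcons; split=> //=.
      exact/ltW/(out Qt Ut).
    - exact: lab_box.
    - exact: graph_gt0.
  have /andP[xlL xLr] := disk_x hL; have /andP[xlR xRr] := disk_x hR.
  have horn_act y w : (y = c1 - r /\ w = a.1) \/ (y = c1 + r /\ w = b.1) ->
      exists t, [/\ btw y w t, xl < t < xr & t < a.1 \/ b.1 < t].
    have [/andP[aL _] /andP[_ bR]] := (ha, hb).
    exact: horn_mark xlL xRr aL ab bR.
  have seg_act : exists t t', [/\ btw (xv (src e)) y0 t, btw y1 (xv (tgt e)) t',
      xl < t < xr /\ xl < t' < xr, (t < a.1 \/ b.1 < t) /\ (t' < a.1 \/ b.1 < t') &
      (~ btw_closed y0 w0 t /\ ~ btw_closed y1 w1 t) /\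
      (~ btw_closed y0 w0 t' /\ ~ btw_closed y1 w1 t')].
    have [/andP[aL _] /andP[_ bR]] := (ha, hb).
    apply: (branch_marks xlL xRr aL ab bR y01 side0 side1 by1).
      by apply: (plot_btw dr pl); exact: (middles xlL xLr).1.
    by apply: (plot_btw dr pl); exact: (middles xlR xRr).2.
  have [t [t' [bt bt' [ht ht'] [hab hab'] [[n0t n1t] [n0t' n1t']]]]] := seg_act.
  case=> [[[[f|]|]|]|] //=.
  + move=> actf; have [p [Kp lp Up p0]] := dr_act dr actf.
    have [fe|fe] := eqVneq f e.
      have [K't lt Ut zt] := on_top t ht hab; exists (t, z t); split=> //.
      rewrite out1 // out0 // /lab2.
      have -> : split_lab xv1 lab1 (None : edge (split_edge e)) y1 (t, z t) = inr (Some (Some e)).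
        by apply: split_lab_other => //; exact: split_lab_src.
      by rewrite fe.
    exists p; split=> //; last exact: old_e.
    rewrite closed_region_rcons; split=> //=; apply/ltW/branch_old => // Qp.
    by move: lp; rewrite lab_box // => -[E]; rewrite E eqxx in fe.
  + move=> _; have [K't lt Ut zt] := on_top t' ht' hab'; exists (t', z t'); split=> //.
    rewrite out1 // out0 // /lab2.
    rewrite split_lab_tgt //; apply: split_lab_tgt => //=.
    by rewrite (btw_split _ by1) bt' !orbT.
  + move=> _; have [s [bs hs sab]] := horn_act y0 w0 side0.
    have [K't lt Ut zt] := on_top s hs sab; exists (s, z s); split=> //.
    have Hs : horn y0 w0 (s, z s) by apply: (horn_graph side0); rewrite btw_closedE bs.
    have /andP[sy sw] := btw_neq bs.
    rewrite out1; last exact: (dis01 _ Hs).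
    by rewrite /lab3 leaf_lab_edge.
  + move=> _; have [s [bs hs sab]] := horn_act y1 w1 side1.
    have [K't lt Ut zt] := on_top s hs sab; exists (s, z s); split=> //.
    have Hs : horn y1 w1 (s, z s) by apply: (horn_graph side1); rewrite btw_closedE bs.
    have /andP[sy sw] := btw_neq bs.
    by rewrite /lab4 leaf_lab_edge.
Qed.

End BranchCut.

(** * Generic boundary points *)

Section Generic.
Variable R : realType.
Implicit Types (S C : circle R) (p q : R * R) (cs : seq (circle R)).

Lemma avoid_finite (T : set R) (a b : R) : finite_set T -> a < b ->
  exists2 t, a < t < b & ~ T t.
Proof.
move=> /finite_seqP[s ->] ab.
suff [a' [b' [h1 h2 h3 hs]]] : exists a' b', [/\ a <= a', a' < b', b' <= b &
    forall t, a' < t < b' -> t \notin s].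
  exists ((a' + b') / 2); first lra.
  by apply/negP/hs; lra.
elim: s => [|x s [a' [b' [h1 h2 h3 hs]]]]; first by exists a, b.
have [/andP[ax xb]|nx] := boolP (a' < x < b').
  exists a', x; split=> //; [lra|].
  by move=> t ht; rewrite inE negb_or hs ?andbT; [rewrite lt_eqF|]; lra.
exists a', b'; split=> // t ht; rewrite inE negb_or hs // andbT.
by apply: contra nx => /eqP <-.
Qed.

Lemma circle_meet_finite S C : S != C ->
  finite_set [set p | pow S p = 0 /\ pow C p = 0].
Proof.
move=> SC; have [[p0 [Sp0 Cp0]]|h0] := pselect ([set p | pow S p = 0 /\ pow C p = 0] !=set0);
  last first.
  suff -> : [set p | pow S p = 0 /\ pow C p = 0] = set0 by exact: finite_set0.
  by rewrite -subset0 => p hp; apply: h0; exists p.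
pose n1 := (center C).1 - (center S).1; pose n2 := (center C).2 - (center S).2.
have n0 : 0 < n1 ^+ 2 + n2 ^+ 2.
  rewrite lt_neqAle addr_ge0 ?sqr_ge0 // andbT eq_sym paddr_eq0 ?sqr_ge0 //.
  rewrite !sqrf_eq0; apply: contra SC => /andP[/eqP e1 /eqP e2].
  have c12 : center S = center C.
    by rewrite [center S]surjective_pairing [center C]surjective_pairing;
       congr pair; apply/eqP; rewrite eq_sym -subr_eq0; apply/eqP.
  have r12 : radius S = radius C.
    have r2 : radius S ^+ 2 = radius C ^+ 2 by move: Sp0 Cp0; rewrite /pow c12; lra.
    by apply/eqP; rewrite -(@eqrXn2 _ 2) ?ltW ?radius_gt0 // r2.
  apply/eqP/val_inj; rewrite [val S]surjective_pairing [val C]surjective_pairing.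
  by congr pair.
pose k := 2 * ((p0.1 - (center S).1) * n2 - (p0.2 - (center S).2) * n1) / (n1 ^+ 2 + n2 ^+ 2).
apply: (@sub_finite_set _ _ [set p0; (p0.1 - k * n2, p0.2 + k * n1)]); last exact: finite_set2.
move=> p /= [Sp Cp].
pose v1 := p.1 - p0.1; pose v2 := p.2 - p0.2.
have hn : v1 * n1 + v2 * n2 = 0.
  have : pow S p - pow S p0 - (pow C p - pow C p0) = 0 by rewrite Sp Sp0 Cp Cp0 !subrr.
  by rewrite /pow /v1 /v2 /n1 /n2; lra.
pose t := (v2 * n1 - v1 * n2) / (n1 ^+ 2 + n2 ^+ 2).
have nn : n1 ^+ 2 + n2 ^+ 2 != 0 by rewrite gt_eqF.
have e1 : v1 = - t * n2.
  apply: (mulIf nn); rewrite /t mulrAC -mulNr divfK //.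
  have -> : v1 * (n1 ^+ 2 + n2 ^+ 2) = (v1 * n1 + v2 * n2) * n1 - (v2 * n1 - v1 * n2) * n2 by ring.
  by rewrite hn; ring.
have e2 : v2 = t * n1.
  apply: (mulIf nn); rewrite /t mulrAC divfK //.
  have -> : v2 * (n1 ^+ 2 + n2 ^+ 2) = (v1 * n1 + v2 * n2) * n2 + (v2 * n1 - v1 * n2) * n1 by ring.
  by rewrite hn; ring.
have hS : 2 * ((p0.1 - (center S).1) * v1 + (p0.2 - (center S).2) * v2) + (v1 ^+ 2 + v2 ^+ 2) = 0.
  have : pow S p - pow S p0 = 0 by rewrite Sp Sp0 subrr.
  by rewrite /pow /v1 /v2; lra.
have kn : k * (n1 ^+ 2 + n2 ^+ 2) =
    2 * ((p0.1 - (center S).1) * n2 - (p0.2 - (center S).2) * n1) by rewrite /k divfK.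
have : t * ((t - k) * (n1 ^+ 2 + n2 ^+ 2)) = 0.
  have -> : (t - k) * (n1 ^+ 2 + n2 ^+ 2) =
    t * (n1 ^+ 2 + n2 ^+ 2) - k * (n1 ^+ 2 + n2 ^+ 2) by ring.
  by move: hS; rewrite kn e1 e2 => <-; ring.
move/eqP; rewrite mulf_eq0 => /orP[/eqP t0|].
  left; rewrite [p]surjective_pairing [p0]surjective_pairing; congr pair.
    by move: e1; rewrite t0 oppr0 mul0r /v1; lra.
  by move: e2; rewrite t0 mul0r /v2; lra.
rewrite mulf_eq0 (negbTE nn) orbF subr_eq0 => /eqP tk; right.
rewrite [p]surjective_pairing; congr pair.
  by move: e1; rewrite tk /v1 mulNr; lra.
by move: e2; rewrite tk /v2; lra.
Qed.

Lemma circle_abscissa_finite S (x : R) : finite_set [set p | pow S p = 0 /\ p.1 = x].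
Proof.
pose s := Num.sqrt (radius S ^+ 2 - (x - (center S).1) ^+ 2).
apply: (@sub_finite_set _ _ [set (x, (center S).2 + s); (x, (center S).2 - s)]);
  last exact: finite_set2.
move=> [p1 p2] /= [Sp px]; subst p1.
have E : radius S ^+ 2 - (x - (center S).1) ^+ 2 = (p2 - (center S).2) ^+ 2.
  by move: Sp; rewrite /pow /=; lra.
rewrite /s E sqrtr_sqr; have [h|h] := leP 0 (p2 - (center S).2).
  by left; rewrite ger0_norm //; congr pair; ring.
by right; rewrite ltr0_norm //; congr pair; ring.
Qed.

Lemma circle_ordinate_finite S (y : R) : finite_set [set p | pow S p = 0 /\ p.2 = y].
Proof.
pose s := Num.sqrt (radius S ^+ 2 - (y - (center S).2) ^+ 2).
apply: (@sub_finite_set _ _ [set ((center S).1 + s, y); ((center S).1 - s, y)]);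
  last exact: finite_set2.
move=> [p1 p2] /= [Sp py]; subst p2.
have E : radius S ^+ 2 - (y - (center S).2) ^+ 2 = (p1 - (center S).1) ^+ 2.
  by move: Sp; rewrite /pow /=; lra.
rewrite /s E sqrtr_sqr; have [h|h] := leP 0 (p1 - (center S).1).
  by left; rewrite ger0_norm //; congr pair; ring.
by right; rewrite ltr0_norm //; congr pair; ring.
Qed.

(** The intersections of two circles and the extreme points of each circle, both
    horizontally and vertically: every singular point is one of them. *)
Definition bad_points (L : seq (circle R)) : set (R * R) :=
  (\bigcup_(S in [set` L]) \bigcup_(C in [set` [seq C <- L | S != C]])
     [set p | pow S p = 0 /\ pow C p = 0]) `|`
  \bigcup_(S in [set` L]) ([set p | pow S p = 0 /\ p.1 = (center S).1] `|`
                          [set p | pow S p = 0 /\ p.2 = (center S).2]).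

Lemma bad_points_finite L : finite_set (bad_points L).
Proof.
rewrite /bad_points finite_setU; split.
  apply: bigcup_finite; first exact: finite_seq.
  move=> S _; apply: bigcup_finite; first exact: finite_seq.
  by move=> C /=; rewrite mem_filter => /andP[SC _]; exact: circle_meet_finite.
apply: bigcup_finite; first exact: finite_seq.
move=> S _; rewrite finite_setU; split.
  exact: circle_abscissa_finite.
exact: circle_ordinate_finite.
Qed.

Lemma singular_bad (proj : R * R -> R) cs p : proj = fst \/ proj = snd ->
  singular proj (punctured cs) p -> bad_points (unit_circle R :: cs) p.
Proof.
move=> hproj [_ [[S1 [S2 [/eqP S12 h]]]|[S [h1 _ h2]]]].
  have [S1L /circle_setP S1p] := (h S1).2 (or_introl erefl).
  have [S2L /circle_setP S2p] := (h S2).2 (or_intror erefl).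
  left; exists S1 => //.
  suff h2 : S2 \in [seq C <- unit_circle R :: cs | S1 != C] by exists S2.
  by rewrite mem_filter S12.
have [SL /circle_setP Sp] := (h1 S).2 erefl.
right; exists S => //.
have /h2 : tangent S p (- (p.2 - (center S).2), p.1 - (center S).1).
  by rewrite /tangent /dot /=; ring.
by case: hproj => -> /= E; [right|left]; split=> //; lra.
Qed.

(** All but finitely many vertical lines meet the boundary in generic points
    only. *)
Definition bad_abscissae (L : seq (circle R)) : set R :=
  fst @` \bigcup_(S in [set` L])
    ((\bigcup_(x in fst @` bad_points L) [set p | pow S p = 0 /\ p.1 = x]) `|`
     (\bigcup_(y in snd @` bad_points L) [set p | pow S p = 0 /\ p.2 = y])).

Lemma bad_abscissae_finite L : finite_set (bad_abscissae L).
Proof.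
apply: finite_image; apply: bigcup_finite; first exact: finite_seq.
move=> S _; rewrite finite_setU; split; apply: bigcup_finite.
- exact/finite_image/bad_points_finite.
- by move=> x _; exact: circle_abscissa_finite.
- exact/finite_image/bad_points_finite.
- by move=> x _; exact: circle_ordinate_finite.
Qed.

Definition generic (L : seq (circle R)) p : Prop :=
  (forall q, bad_points L q -> q.1 != p.1) /\ (forall q, bad_points L q -> q.2 != p.2).

Lemma generic_point L S p : S \in L -> pow S p = 0 -> ~ bad_abscissae L p.1 ->
  generic L p.
Proof.
move=> SL Sp nT; split=> q bq; apply/eqP => E; apply: nT; exists p => //.
  by exists S => //; left; exists p.1 => //; exists q.
by exists S => //; right; exists p.2 => //; exists q.
Qed.

Lemma generic_only L S C p : generic L p -> S \in L -> pow S p = 0 ->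
  C \in L -> C != S -> pow C p != 0.
Proof.
move=> [g1 _] SL Sp CL CS; apply/eqP => Cp.
have : bad_points L p by left; exists C => //; exists S => //=; rewrite mem_filter CS.
by move/g1; rewrite eqxx.
Qed.

Lemma generic_center L S p : generic L p -> S \in L -> pow S p = 0 ->
  p.1 != (center S).1 /\ p.2 != (center S).2.
Proof.
move=> [g1 _] SL Sp; split; apply/eqP => E.
  have : bad_points L p by right; exists S => //; left.
  by move/g1; rewrite eqxx.
have : bad_points L p by right; exists S => //; right.
by move/g1; rewrite eqxx.
Qed.

End Generic.

(** * Local pictures around generic boundary points *)

Section LocalPicture.
Variable R : realType.
Implicit Types (S C : circle R) (p q : R * R) (cs : seq (circle R)).

Lemma nbhs_all (T : topologicalType) (I : eqType) (s : seq I) (P : I -> set T) (x : T) :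
  (forall i, i \in s -> nbhs x (P i)) -> nbhs x [set y | forall i, i \in s -> P i y].
Proof.
elim: s => [|i s IH] h; first by apply: filterS filterT => y _ j.
apply: filterS (filterI (h i (mem_head _ _)) (IH _)).
  by move=> y [Pi Ps] j; rewrite inE => /orP[/eqP ->|/Ps].
by move=> j js; apply: h; rewrite inE js orbT.
Qed.

Lemma layout_other_closed (K : set (R * R)) (G : graph) (xv : vertex G -> R) lab e :
  layout K xv lab -> simple_graph G -> closed [set p | K p /\ lab p <> inr e].
Proof.
move=> L [noiso _].
have -> : [set p | K p /\ lab p <> inr e] =
    (\bigcup_(f in [set f | f <> e]) [set p | K p /\ closed_edge f (lab p)]) `|`
    (\bigcup_(v in [set: vertex G]) [set p | K p /\ lab p = inl v]).
  apply/seteqP; split=> p /=.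
    case=> Kp; destruct (lab p) as [v|f] eqn:lp => ne; first by right; exists v.
    left; exists f => /=; first by move=> fe; apply: ne; rewrite fe.
    by split=> //; rewrite /closed_edge lp eqxx.
  case=> [[f /= fe [Kp]]|[v _ [Kp ->]]] //.
  by rewrite /closed_edge => /or3P[]/eqP ->; split=> // -[].
apply: closedU; apply: closed_bigcup => [|i _]; try exact: finite_finset.
  exact: (lay_closed L).
have [f ev] := noiso i; exact: (layout_vertex_closed L ev).
Qed.

(** Only the unit circle has the region inside. *)
Definition side_sign S (sg : R) : Prop :=
  (S = unit_circle R /\ sg = 1) \/ (S <> unit_circle R /\ sg = -1).

(** The inequalities of the other circles are strict at [a], hence hold nearby,
    and so does membership in the open edge [e]. *)
Lemma side_near cs (G : graph) (act : edge G -> bool) xv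
    (lab : R * R -> vertex G + edge G) e S (sg : R) a :
  drawing cs act xv lab -> closed_region cs a -> lab a = inr e ->
  S \in unit_circle R :: cs -> side_sign S sg ->
  (forall C, C \in unit_circle R :: cs -> C != S -> pow C a != 0) ->
  nbhs a [set q | [/\ closed_region cs q <-> sg * pow S q <= 0,
    open_region cs q <-> sg * pow S q < 0,
    closed_region cs q -> lab q = inr e &
    forall C, C \in unit_circle R :: cs -> C != S -> pow C q != 0]].
Proof.
move=> dr Ka la SL hsg only.
have unit_fresh : unit_circle R \notin cs.
  apply/negP => ucs; have : closure (open_region cs) a by rewrite (dr_closure dr).
  move=> /(_ setT filterT) [q [[uq hq] _]].
  by have := hq _ ucs; have := uq; lra.
pose P1 C : set (R * R) := [set q | C != S ->
  if C == unit_circle R then pow C q < 0 else 0 < pow C q].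
have N1 : nbhs a [set q | forall C, C \in unit_circle R :: cs -> P1 C q].
  apply: nbhs_all => C CL; have [CS|CS] := eqVneq C S.
    by apply: filterS filterT => q _; rewrite /P1 /= CS eqxx.
  have Ca := only C CL CS; case: (eqVneq C (unit_circle R)) => [E|E].
    apply: (@filterS _ _ _ [set q | pow C q < 0]).
      by move=> q /= Cq _; rewrite E eqxx -E.
    apply: open_nbhs_nbhs; split; first exact: pow_open_lt.
    by rewrite /= lt_neqAle Ca; case: Ka => + _; rewrite -E.
  apply: (@filterS _ _ _ [set q | 0 < pow C q]).
    by move=> q /= Cq _; rewrite (negbTE E).
  apply: open_nbhs_nbhs; split; first exact: pow_open_gt.
  rewrite /= lt_neqAle eq_sym Ca; case: Ka => _; apply.
  by move: CL; rewrite inE (negbTE E).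
have N2 : nbhs a (~` [set p | closed_region cs p /\ lab p <> inr e]).
  apply: open_nbhs_nbhs; split; last by case=> _; rewrite la.
  by rewrite openC; exact: (layout_other_closed (dr_layout dr) (dr_simple dr)).
apply: filterS (filterI N1 N2) => q [h1' h2].
have lq : closed_region cs q -> lab q = inr e.
  by move=> Kq; apply: contrapT => lq; apply: h2.
have nz C : C \in unit_circle R :: cs -> C != S -> pow C q != 0.
  move=> CL CS; have := h1' C CL CS.
  by case: eqP => [_ /lt_eqF ->|_ /gt_eqF ->].
suff [hc ho] : (closed_region cs q <-> sg * pow S q <= 0) /\
    (open_region cs q <-> sg * pow S q < 0) by [].
have others C : C \in cs -> C != S -> 0 < pow C q.
  move=> Ccs CS; have := h1' C; rewrite inE Ccs orbT => /(_ isT CS).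
  by case: eqP => // E; rewrite -E Ccs in unit_fresh.
case: hsg => -[hS ->].
  have ne C : C \in cs -> C != S by rewrite hS; apply: contraTneq => ->.
  rewrite mul1r hS; split; split.
  - by case.
  - by move=> uq; split=> // C Ccs; apply/ltW/others/ne.
  - by case.
  - by move=> uq; split=> // C Ccs; apply: others => //; exact: ne.
have Scs : S \in cs by move: SL; rewrite inE => /orP[/eqP|].
have uq : pow (unit_circle R) q < 0.
  have := h1' (unit_circle R) (mem_head _ _); rewrite /P1 /= eqxx; apply.
  by apply/eqP => E; apply: hS.
rewrite mulN1r oppr_le0 oppr_lt0; split; split.
- by case=> _; apply.
- move=> Sq; split=> [|C Ccs]; first exact: ltW.
  by have [->//|CS] := eqVneq C S; exact/ltW/others.
- by case=> _; apply.
- move=> Sq; split=> // C Ccs.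
  by have [->//|CS] := eqVneq C S; exact: others.
Qed.

(** A box around the generic point [a], with the constants that will tell how
    short a chord has to be: [g] and [M] bound the slope of the arc of [S], and
    [eta] is the room around [a]. The arc is monotone, and no fiber that meets
    the box contains a singular point. *)
Record picture cs (G : graph) (lab : R * R -> vertex G + edge G) (e : edge G)
    S (sg : R) (a : R * R) (xl xr yl yu yb : R) (z : R -> R) (g M eta : R) : Prop :=
  Picture {
  pc_plot : plot cs lab e S sg xl xr yl yu yb z;
  pc_g : 0 < g;
  pc_above : forall q, in_box xl xr yl yu q -> g <= sg * (q.2 - (center S).2);
  pc_M : forall q, in_box xl xr yl yu q -> `|q.1 - (center S).1| <= M;
  pc_side : (forall q, in_box xl xr yl yu q -> (center S).1 < q.1) \/
            (forall q, in_box xl xr yl yu q -> q.1 < (center S).1);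
  pc_fst : forall q, singular fst (punctured cs) q -> ~ xl < q.1 < xr;
  pc_snd : forall q, singular snd (punctured cs) q -> ~ yl < q.2 < yu;
  pc_eta : 0 < eta;
  pc_near : forall q, `|q.1 - a.1| <= eta -> `|q.2 - a.2| <= eta ->
    in_box xl xr yl yu q /\ yb < q.2;
  pc_a : pow S a = 0;
  pc_yb : S = unit_circle R -> 0 < yb }.

Lemma ball_plane p (d : R) q : `|q.1 - p.1| < d -> `|q.2 - p.2| < d -> ball p d q.
Proof. by move=> h1 h2; split; rewrite -ball_normE /= distrC. Qed.

Lemma generic_picture cs (G : graph) (act : edge G -> bool) xv
    (lab : R * R -> vertex G + edge G) e S (sg : R) a :
  drawing cs act xv lab -> closed_region cs a -> lab a = inr e ->
  S \in unit_circle R :: cs -> pow S a = 0 -> generic (unit_circle R :: cs) a ->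
  side_sign S sg ->
  0 < sg * (a.2 - (center S).2) ->
  exists xl xr yl yu yb z g M eta,
    picture cs lab e S sg a xl xr yl yu yb z g M eta.
Proof.
move=> dr Ka la SL Sa ga hsg above.
have [sa1 sa2] := generic_center ga SL Sa.
have only C : C \in unit_circle R :: cs -> C != S -> pow C a != 0.
  by move=> CL CS; exact: generic_only ga SL Sa CL CS.
have N1 := side_near dr Ka la SL hsg only.
pose B := bad_points (unit_circle R :: cs).
have finB : finite_set B := bad_points_finite _.
have N3 : nbhs a (~` (fst @^-1` (fst @` B))).
  apply: open_nbhs_nbhs; split.
    rewrite openC; apply: closed_comp.
      by move=> q _; exact: cvg_fst.
    by apply: compact_closed; [exact: Rhausdorff|exact/finite_compact/finite_image].
  by case=> q Bq E; have := ga.1 q Bq; rewrite E eqxx.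
have N4 : nbhs a (~` (snd @^-1` (snd @` B))).
  apply: open_nbhs_nbhs; split.
    rewrite openC; apply: closed_comp.
      by move=> q _; exact: cvg_snd.
    by apply: compact_closed; [exact: Rhausdorff|exact/finite_compact/finite_image].
  by case=> q Bq E; have := ga.2 q Bq; rewrite E eqxx.
have : nbhs a ([set q | [/\ closed_region cs q <-> sg * pow S q <= 0,
    open_region cs q <-> sg * pow S q < 0,
    closed_region cs q -> lab q = inr e &
    forall C, C \in unit_circle R :: cs -> C != S -> pow C q != 0]] `&`
    (~` (fst @^-1` (fst @` B)) `&` ~` (snd @^-1` (snd @` B)))).
  exact: filterI N1 (filterI N3 N4).
move=> /nbhs_ballP[d0 /= d0_gt0 Hd0].
set o := center S in above sa1 sa2 *.
pose h := sg * (a.2 - o.2).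
pose d := Num.min d0 (Num.min (h / 2) (`|a.1 - o.1| / 2)).
have n0 : 0 < `|a.1 - o.1| by rewrite normr_gt0 subr_eq0.
have d_gt0 : 0 < d by rewrite !lt_min d0_gt0 !divr_gt0.
have dd0 : d <= d0 by rewrite ge_min lexx.
have dh : d <= h / 2 by rewrite !ge_min lexx !orbT.
have dn : d <= `|a.1 - o.1| / 2 by rewrite !ge_min lexx !orbT.
have sg1 : sg = 1 \/ sg = -1 by case: hsg => -[_ ->]; [left|right].
have sgn : `|sg| = 1 by case: sg1 => ->; rewrite ?normrN normr1.
have near_h y : `|y - a.2| < d -> h / 2 <= sg * (y - o.2).
  move=> hy; have : `|sg * (y - a.2)| < d by rewrite normrM sgn mul1r.
  rewrite ltr_norml => /andP[h1' _].
  have -> : sg * (y - o.2) = sg * (y - a.2) + h by rewrite /h; ring.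
  lra.
pose yl := a.2 - d / 2; pose yb := a.2 - d / 4; pose yu := a.2 + d / 2.
have pow_at y : sg * pow S (a.1, y) = (y - a.2) * (sg * (y - o.2) + h).
  have E : (a.1 - o.1) ^+ 2 = radius S ^+ 2 - (a.2 - o.2) ^+ 2.
    by move: Sa; rewrite /pow -/o; clear -S; lra.
  by rewrite /pow /= -/o E /h; ring.
have inner y : `|y - a.2| < d -> 0 < sg * (y - o.2) + h.
  by move=> /near_h; clear -above; move: above; rewrite -/h; lra.
have lt_b : sg * pow S (a.1, yb) < 0.
  rewrite pow_at pmulr_llt0; first by rewrite /yb; clear -d_gt0; lra.
  by apply: inner; rewrite /yb ltr_norml; clear -d_gt0; lra.
have gt_u : 0 < sg * pow S (a.1, yu).
  rewrite pow_at mulr_gt0 //; first by rewrite /yu; clear -d_gt0; lra.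
  by apply: inner; rewrite /yu ltr_norml; clear -d_gt0; lra.
have open_sg : open [set q | sg * pow S q < 0] /\ open [set q | 0 < sg * pow S q].
  case: sg1 => ->; split.
  - have -> : [set q | 1 * pow S q < 0] = [set q | pow S q < 0].
      by apply/seteqP; split=> q /=; rewrite mul1r.
    exact: pow_open_lt.
  - have -> : [set q | 0 < 1 * pow S q] = [set q | 0 < pow S q].
      by apply/seteqP; split=> q /=; rewrite mul1r.
    exact: pow_open_gt.
  - have -> : [set q | -1 * pow S q < 0] = [set q | 0 < pow S q].
      by apply/seteqP; split=> q /=; rewrite mulN1r oppr_lt0.
    exact: pow_open_gt.
  - have -> : [set q | 0 < -1 * pow S q] = [set q | pow S q < 0].
      by apply/seteqP; split=> q /=; rewrite mulN1r oppr_gt0.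
    exact: pow_open_lt.
have /nbhs_ballP[d1 /= d1_gt0 Hd1] : nbhs (a.1, yb) [set q | sg * pow S q < 0].
  by apply: open_nbhs_nbhs; split=> //; exact: open_sg.1.
have /nbhs_ballP[d2 /= d2_gt0 Hd2] : nbhs (a.1, yu) [set q | 0 < sg * pow S q].
  by apply: open_nbhs_nbhs; split=> //; exact: open_sg.2.
pose w := Num.min d1 (Num.min d2 (d / 2)).
have w_gt0 : 0 < w by rewrite !lt_min d1_gt0 d2_gt0 divr_gt0.
have wd1 : w <= d1 by rewrite ge_min lexx.
have wd2 : w <= d2 by rewrite !ge_min lexx orbT.
have wd : w <= d / 2 by rewrite !ge_min lexx !orbT.
pose xl := a.1 - w; pose xr := a.1 + w.
pose z := fun x : R => o.2 + sg * Num.sqrt (radius S ^+ 2 - (x - o.1) ^+ 2).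
have hx_norm x : xl < x < xr -> `|x - a.1| < w.
  by rewrite /xl /xr ltr_norml; clear -sg; lra.
have xb x : xl < x < xr -> sg * pow S (x, yb) < 0.
  move=> hx; apply: (Hd1 (x, yb)); apply: ball_plane => /=; last by rewrite subrr normr0.
  exact: lt_le_trans (hx_norm _ hx) wd1.
have xu x : xl < x < xr -> 0 < sg * pow S (x, yu).
  move=> hx; apply: (Hd2 (x, yu)); apply: ball_plane => /=; last by rewrite subrr normr0.
  exact: lt_le_trans (hx_norm _ hx) wd2.
have yb_above : 0 < sg * (yb - o.2).
  have : h / 2 <= sg * (yb - o.2) by apply: near_h; rewrite /yb ltr_norml; clear -d_gt0; lra.
  by clear -above; move: above; rewrite -/h; lra.
have yu_above : 0 < sg * (yu - o.2).
  have : h / 2 <= sg * (yu - o.2) by apply: near_h; rewrite /yu ltr_norml; clear -d_gt0; lra.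
  by clear -above; move: above; rewrite -/h; lra.
pose s := fun x : R => Num.sqrt (radius S ^+ 2 - (x - o.1) ^+ 2).
have s_ge0 x : 0 <= s x by exact: sqrtr_ge0.
have sE x y : xl < x < xr -> pow S (x, y) = (y - o.2) ^+ 2 - s x ^+ 2.
  move=> hx; rewrite /s sqr_sqrtr; first by rewrite /pow /= -/o; ring.
  have := xb x hx; have := xu x hx; rewrite /pow /= -/o.
  have := sqr_ge0 (yb - o.2); have := sqr_ge0 (yu - o.2).
  by clear -sg1; case: sg1 => ->; lra.
(* above the center of [S], up to the sign, the graph of [z] is a half circle *)
have cmp x y : xl < x < xr -> 0 < sg * (y - o.2) ->
    (y <= z x) = (sg * pow S (x, y) <= 0) /\ (y < z x) = (sg * pow S (x, y) < 0).
  move=> hx hy; rewrite (sE _ _ hx) /z -/(s x); have := s_ge0 x; move: (s x) => t t0.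
  case: sg1 hy => ->; rewrite ?mul1r ?mulN1r => hy.
    rewrite subr_le0 subr_lt0 ler_sqr ?nnegrE ?(ltW hy) // ltr_sqr ?nnegrE ?(ltW hy) //.
    by rewrite lerBlDl ltrBlDl.
  rewrite opprB subr_le0 subr_lt0 -[(y - o.2) ^+ 2]sqrrN.
  rewrite ler_sqr ?nnegrE ?(ltW hy) // ltr_sqr ?nnegrE ?(ltW hy) // opprB.
  by clear -t; split; apply/idP/idP; lra.
have zb x : xl < x < xr -> yb < z x < yu.
  move=> hx; rewrite (cmp x yb hx yb_above).2 xb //= ltNge.
  by rewrite (cmp x yu hx yu_above).1 -ltNge xu.
have box_ball q : in_box xl xr yl yu q -> ball a d q.
  move=> /andP[hx hy]; apply: ball_plane.
    by have := hx_norm _ hx; clear -wd d_gt0; lra.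
  by rewrite ltr_norml; move: hy; rewrite /yl /yu; clear -d_gt0; lra.
have box_near q : in_box xl xr yl yu q -> h / 2 <= sg * (q.2 - o.2).
  move=> /andP[_ hy]; apply: near_h; rewrite ltr_norml; move: hy; rewrite /yl /yu.
  by clear -d_gt0; lra.
have box_good q : in_box xl xr yl yu q ->
    [/\ closed_region cs q <-> sg * pow S q <= 0, open_region cs q <-> sg * pow S q < 0,
        closed_region cs q -> lab q = inr e,
        forall C, C \in unit_circle R :: cs -> C != S -> pow C q != 0
      & ~ (fst @` B) q.1 /\ ~ (snd @` B) q.2].
  by move=> /box_ball aq; have [[h1' h2 h3 h4] [h5 h6]] := Hd0 q (le_ball dd0 aq).
have box_cmp q : in_box xl xr yl yu q ->
    (q.2 <= z q.1) = (sg * pow S q <= 0) /\ (q.2 < z q.1) = (sg * pow S q < 0).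
  move=> Qq; rewrite [in pow S q](surjective_pairing q); apply: cmp; first exact: plot_x Qq.
  by have := box_near q Qq; clear -above; move: above; rewrite -/h; lra.
have h_gt0 : 0 < h by [].
exists xl, xr, yl, yu, yb, z, (h / 2), (`|a.1 - o.1| + 1 + d), (Num.min w (d / 4) / 2).
split=> //.
- split.
  + split=> //.
    * by move=> C q CL CS /box_good[_ _ _ + _]; exact.
    * by move=> q Qq; rewrite (box_cmp q Qq).1; have [] := box_good q Qq.
    * by move=> q Qq; rewrite (box_cmp q Qq).2; have [] := box_good q Qq.
    * by move=> q /box_cmp[].
    * by move=> q /box_cmp[].
    * move=> x hx; have := zb x hx; have : yl < yb by rewrite /yl /yb; clear -d_gt0; lra.
      by clear -sg; lra.
  + by move=> q /box_good[].
  + by rewrite /yl /yb; clear -d_gt0; lra.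
  + by move=> x /zb/andP[].
- by rewrite divr_gt0.
- move=> q /andP[/hx_norm hx _]; apply: le_trans (ler_distD a.1 _ _) _.
  by clear -hx wd d_gt0; lra.
- have hq q : in_box xl xr yl yu q -> `|q.1 - a.1| < `|a.1 - o.1|.
    by move=> /andP[/hx_norm hx _]; clear -hx wd dn n0 d_gt0; lra.
  have [lt|gt] := ltP o.1 a.1; [left|right] => q /hq.
    by clear -lt; rewrite [X in _ < X]ger0_norm ?ltr_norml; lra.
  have lt : a.1 < o.1 by rewrite lt_neqAle sa1.
  by clear -lt; rewrite [X in _ < X]ltr0_norm ?ltr_norml; lra.
- move=> q sq hx; have Bq : B q by apply: singular_bad sq; left.
  have : in_box xl xr yl yu (q.1, a.2) by rewrite /in_box /= hx /yl /yu; apply/andP; clear -d_gt0; lra.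
  by move=> /box_good[_ _ _ _ [+ _]]; apply; exists q.
- move=> q sq hy; have Bq : B q by apply: singular_bad sq; right.
  have : in_box xl xr yl yu (a.1, q.2) by rewrite /in_box /= hy /xl /xr andbT; apply/andP; clear -w_gt0; lra.
  by move=> /box_good[_ _ _ _ [_ +]]; apply; exists q.
- by rewrite divr_gt0 // lt_min w_gt0 divr_gt0.
- have m1 : Num.min w (d / 4) <= w by rewrite ge_min lexx.
  have m2 : Num.min w (d / 4) <= d / 4 by rewrite ge_min lexx orbT.
  have m0 : 0 < Num.min w (d / 4) by rewrite lt_min w_gt0 divr_gt0.
  move=> q; rewrite !ler_norml /in_box /xl /xr /yl /yu /yb => hx hy.
  by clear -m0 m1 m2 hx hy d_gt0; split; [apply/andP; split|]; lra.
- move=> SU; case: hsg => -[]; last by rewrite SU.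
  move=> _ sgE; move: yb_above; rewrite sgE mul1r.
  have -> : o.2 = 0 by rewrite /o SU.
  by rewrite subr0.
Qed.

(** A slice is compact and has a highest point, above which the region cannot
    continue. This point is on a circle; the abscissa being generic, on one
    circle only, whose center is below it if it bounds the region from outside
    and above it otherwise. *)
Lemma generic_top cs (G : graph) (act : edge G -> bool) xv
    (lab : R * R -> vertex G + edge G) e : drawing cs act xv lab ->
  exists a S sg, [/\ [/\ closed_region cs a, lab a = inr e & S \in unit_circle R :: cs],
    pow S a = 0, generic (unit_circle R :: cs) a, side_sign S sg &
    0 < sg * (a.2 - (center S).2)].
Proof.
move=> dr; have L := dr_layout dr.
have [t bt nt] : exists2 t, btw (xv (src e)) (xv (tgt e)) t &
    ~ bad_abscissae (unit_circle R :: cs) t.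
  have fin := bad_abscissae_finite (unit_circle R :: cs).
  have [lt|gt|E] := ltgtP (xv (src e)) (xv (tgt e)).
  - by have [t ht nt] := avoid_finite fin lt; exists t; rewrite // /btw ht.
  - by have [t ht nt] := avoid_finite fin gt; exists t; rewrite // /btw ht orbT.
  - by have := lay_ends L e; rewrite E eqxx.
pose F := [set p | [/\ closed_region cs p, lab p = inr e & p.1 = t]].
have clF : closed F.
  have -> : F = [set p | closed_region cs p /\ closed_edge e (lab p)] `&` [set p | p.1 = t].
    apply/seteqP; split=> p /=.
      by case=> Kp lp px; rewrite /closed_edge lp eqxx.
    case=> -[Kp ep] px; split=> //; have /andP[ts tt] := btw_neq bt.
    move: ep => /or3P[]/eqP lp //.
      by rewrite -px (lay_vx L Kp lp) eqxx in ts.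
    by rewrite -px (lay_vx L Kp lp) eqxx in tt.
  by apply: closedI; [exact: (lay_closed L)|exact: closed_fst].
have cptF : compact F.
  apply: (subclosed_compact clF (@closed_region_compact R cs)).
  by move=> p [].
have F0 : F !=set0 by have [p hp] := lay_e L bt; exists p.
have csnd : {within F, continuous (@snd R R)}.
  by apply: continuous_subspaceT => p; exact: cvg_snd.
have [a /set_mem Fa amax] := compact_EVT_max F0 cptF csnd.
have [Ka la at_] := Fa.
have higher eps : 0 < eps -> closed_region cs (a.1, a.2 + eps) ->
    lab (a.1, a.2 + eps) = inr e -> False.
  move=> e0 Kq lq; have := amax (a.1, a.2 + eps).
  by rewrite inE => h; have /h /= : F (a.1, a.2 + eps) by []; lra.
have nD : ~ open_region cs a.
  move=> Da.
  have : nbhs a (open_region cs `&` ~` [set p | closed_region cs p /\ lab p <> inr e]).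
    apply: filterI; apply: open_nbhs_nbhs; split=> //; first exact: open_region_open.
      by rewrite openC; exact: (layout_other_closed L (dr_simple dr)).
    by case=> _; rewrite la.
  move=> /nbhs_ballP[d /= d0 Hd].
  have [Dq lq] : (open_region cs `&` ~` [set p | closed_region cs p /\ lab p <> inr e])
      (a.1, a.2 + d / 2).
    apply: Hd; apply: ball_plane => /=; first by rewrite subrr normr0.
    by rewrite addrAC subrr add0r gtr0_norm; lra.
  have Kq := open_region_sub Dq.
  apply: (higher (d / 2)) => //; first by rewrite divr_gt0.
  by apply: contrapT => nl; apply: lq.
have [S SL Sa] := (region_boundary Ka).1 nD.
have ga : generic (unit_circle R :: cs) a by apply: (generic_point SL Sa); rewrite at_.
pose sg : R := if S == unit_circle R then 1 else -1.
have hsg : side_sign S sg.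
  by rewrite /sg; case: eqP => h; [left|right].
have sg1 : sg = 1 \/ sg = -1 by case: hsg => -[_ ->]; [left|right].
exists a, S, sg; split=> //.
have [_ a2] := generic_center ga SL Sa.
rewrite ltNge; apply/negP => le0.
have lt0 : sg * (a.2 - (center S).2) < 0.
  rewrite lt_neqAle le0 andbT mulf_neq0 ?subr_eq0 //.
  by case: sg1 => ->; rewrite ?oppr_eq0 oner_eq0.
have only C : C \in unit_circle R :: cs -> C != S -> pow C a != 0.
  by move=> CL CS; exact: generic_only ga SL Sa CL CS.
have /nbhs_ballP[d /= d0 Hd] := side_near dr Ka la SL hsg only.
pose eps := Num.min (d / 2) (- (sg * (a.2 - (center S).2))).
have e0 : 0 < eps by rewrite lt_min divr_gt0 // oppr_gt0.
have ed : eps <= d / 2 by rewrite ge_min lexx.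
have ey : eps <= - (sg * (a.2 - (center S).2)) by rewrite ge_min lexx orbT.
have [|h _ hl _] := Hd (a.1, a.2 + eps).
  apply: ball_plane => /=; first by rewrite subrr normr0.
  by rewrite addrAC subrr add0r gtr0_norm; lra.
have Kq : closed_region cs (a.1, a.2 + eps).
  apply/h; have -> : pow S (a.1, a.2 + eps) = eps * (2 * (a.2 - (center S).2) + eps).
    by rewrite -[LHS]subr0 -Sa /pow /=; ring.
  by move: lt0 ey e0; case: sg1 => ->; nra.
exact: higher e0 Kq (hl Kq).
Qed.

(** The upper arc near the given point belongs to the same edge, and all but
    finitely many of its points are generic. *)
Lemma generic_active cs (G : graph) (act : edge G -> bool) xv
    (lab : R * R -> vertex G + edge G) e : drawing cs act xv lab -> act e ->
  exists a, [/\ closed_region cs a, lab a = inr e, pow (unit_circle R) a = 0,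
    generic (unit_circle R :: cs) a & 0 < a.2].
Proof.
move=> dr /(dr_act dr)[p [Kp lp Up p0]].
have clE := dr_closure dr.
have UL : unit_circle R \in unit_circle R :: cs by exact: mem_head.
have bp : bd (punctured cs) p.
  by apply/(bd_punctured _ clE); split=> //; exists (unit_circle R).
have only C : C \in unit_circle R :: cs -> C != unit_circle R -> pow C p != 0.
  move=> CL CU; apply/eqP => Cp.
  have [v] : exists v, lab p = inl v; last by rewrite lp.
  apply: (dr_sing dr); split=> //; left; exists (unit_circle R), C.
  split; first by apply/eqP; rewrite eq_sym.
  have [_ _ _ _ [_ no3]] := dr_ss dr.
  move=> D; split; last by case=> ->; split=> //; exact/circle_setP.
  case=> DL Dp; have [->|DU] := eqVneq D (unit_circle R); first by left.
  have [->|DC] := eqVneq D C; first by right.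
  case: (no3 _ _ _ UL CL DL _ _ _ p bp).
  - by rewrite eq_sym.
  - by rewrite eq_sym.
  - by rewrite eq_sym.
  by split=> //; exact/circle_setP.
have hsg : side_sign (unit_circle R) 1 by left.
have /nbhs_ballP[d /= d0 Hd] := side_near dr Kp lp UL hsg only.
pose f := fun x : R => Num.sqrt (1 - (x - 0) ^+ 2).
have fp : f p.1 = p.2.
  rewrite /f; have -> : 1 - (p.1 - 0) ^+ 2 = p.2 ^+ 2.
    by move: Up; rewrite pow_unit subr0; lra.
  by rewrite sqrtr_sqr gtr0_norm.
have : nbhs p.1 (f @^-1` (ball p.2 (Num.min d p.2))).
  have : nbhs (f p.1) (ball p.2 (Num.min d p.2)).
    by rewrite fp; apply: nbhsx_ballx; rewrite lt_min d0 p0.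
  exact: (@sqrt_sub_continuous R 1 0 p.1).
move=> /nbhs_ballP[d' /= d'0 Hd'].
have dd : 0 < Num.min d d' by rewrite lt_min d0 d'0.
have [t /andP[pt td] nt] := avoid_finite (bad_abscissae_finite (unit_circle R :: cs))
   (ltac:(rewrite ltrDl; exact: dd) : p.1 < p.1 + Num.min d d').
have m1 : Num.min d d' <= d by rewrite ge_min lexx.
have m2 : Num.min d d' <= d' by rewrite ge_min lexx orbT.
have tp : `|t - p.1| < Num.min d d' by rewrite gtr0_norm; lra.
have : ball p.2 (Num.min d p.2) (f t).
  by apply: Hd'; rewrite -ball_normE /= distrC; lra.
rewrite -ball_normE /= distrC lt_min => /andP[fd fp2].
have ft0 : 0 < f t by move: fp2; rewrite ltr_norml; lra.
have Ut : pow (unit_circle R) (t, f t) = 0.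
  rewrite pow_unit /=; have : 0 < 1 - (t - 0) ^+ 2 by rewrite -sqrtr_gt0.
  by move=> /ltW/sqr_sqrtr; rewrite -/(f t) subr0 => ->; ring.
have [|hK _ hl _] := Hd (t, f t); first by apply: ball_plane => //=; lra.
have Kt : closed_region cs (t, f t) by apply/hK; rewrite Ut mulr0.
exists (t, f t); split=> //; first exact: hl.
exact: (generic_point UL Ut).
Qed.

End LocalPicture.

(** * Edges of Poincaré-Reeb graphs, areas and enclosed regions *)

Section Tools.
Variable R : realType.
Implicit Types (S C : circle R) (p q : R * R) (cs : seq (circle R)).

(** The image of [A] in the quotient is connected and avoids the vertices. *)
Lemma same_edge_connected (proj : R * R -> R) (X : ss_pair R)
    (x y : closure (dom X)) (A : set (R * R)) :
  connected A -> A `<=` closure (dom X) -> A (val x) -> A (val y) ->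
  (forall q, singular proj X q -> forall p, A p -> proj p <> proj q) ->
  same_edge proj x y.
Proof.
move=> cA sA Ax Ay ns.
pose r := valL_ (reeb_pi proj x) (@reeb_pi R proj X).
have rE w : r (val w) = reeb_pi proj w.
  have := @valLK _ _ (reeb_pi proj x) (closure (dom X)) (@reeb_pi R proj X).
  by move/(congr1 (fun f => f w)).
have cr : {within closure (dom X), continuous r}.
  by apply/subspace_valL_continuousP'; exact: pi_continuous.
have crA : connected (r @` A).
  apply: connected_continuous_connected cA _.
  exact: continuous_subspaceW sA cr.
rewrite /same_edge -!rE.
suff h : r @` A `<=` ~` @reeb_vertex R proj X.
  by apply: (connected_component_max _ h crA); [exists (val x)|exists (val y)].
move=> _ [p Ap <-] [w [sw]].
have -> : p = val (exist _ p (mem_set (sA p Ap)) : closure (dom X)) by [].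
rewrite rE => /eqmodP/asboolP/connected_component_sub[_ /= E].
by apply: (ns _ sw p Ap).
Qed.

(** Every point can be joined to the base line by a vertical segment. *)
Lemma box_connected cs S (sg xl xr yl yu yb : R) (z : R -> R) :
  local_graph cs S sg xl xr yl yu z -> yl < yb ->
  (forall x, xl < x < xr -> yb < z x) ->
  connected [set q | in_box xl xr yl yu q /\ closed_region cs q].
Proof.
move=> lg ylb hz.
have inQ x y : xl < x < xr -> yl < y -> y <= z x ->
    in_box xl xr yl yu (x, y) /\ closed_region cs (x, y).
  move=> hx hy yz; have /andP[_ zu] := lg_z lg hx.
  have Qq : in_box xl xr yl yu (x, y) by rewrite /in_box /= hx hy (le_lt_trans yz zu).
  by split=> //; apply/(lg_closed lg Qq).
apply: (@comb_connected _ _ ((fun x => (x, yb)) @` `]xl, xr[)).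
- apply: connected_continuous_connected.
    exact/connected_intervalP/interval_is_interval.
  apply: continuous_subspaceT => x.
  by apply: cvg_pair_nbhs; [exact: cvg_id|exact: cvg_cst].
- move=> _ [x hx <-]; rewrite /= in_itv /= in hx.
  by apply: inQ => //; exact/ltW/hz.
move=> p [Qp Kp]; have /andP[px /andP[py1 py2]] := Qp.
have pz : p.2 <= z p.1 by apply/(lg_closed lg Qp).
exists [set q | q.1 = p.1 /\ Num.min p.2 yb <= q.2 <= Num.max p.2 yb]; split.
- exact: vertical_connected.
- move=> [q1 q2] /= [-> ]; rewrite ge_min le_max => /andP[h1 h2]; apply: inQ => //.
    by case/orP: h1; [exact: lt_le_trans|exact: lt_le_trans].
  by have := hz _ px; case/orP: h2; lra.
- by split=> //; rewrite ge_min lexx le_max lexx.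
exists (p.1, yb); split=> /=; last by exists p.1; rewrite //= in_itv.
by split=> //; rewrite ge_min lexx orbT le_max lexx orbT.
Qed.

(** The component of [p] in the complement of [A] contains an unbounded ray. *)
Lemma ray_escape (A : set (R * R)) p v : v != 0 ->
  (forall t : R, 0 <= t -> ~ A (p + t *: v)) -> ~ enclosed A p.
Proof.
move=> v0 hA [Ap]; set Z := connected_component _ _.
have ray : (fun t : R => p + t *: v) @` `[0, +oo[ `<=` Z.
  apply: connected_component_max.
  - by exists 0; rewrite ?scale0r ?addr0 //= in_itv /= lexx.
  - by move=> _ [t ht <-]; apply: hA; move: ht; rewrite /= in_itv /= andbT.
  apply: connected_continuous_connected.
    exact/connected_intervalP/interval_is_interval.
  apply: continuous_subspaceT => t; apply: cvgD; first exact: cvg_cst.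
  by apply: cvgZr_tmp; exact: cvg_id.
case=> M [_ hM]; have nv : 0 < `|v| by rewrite normr_gt0.
pose M1 := `|M| + 1; pose t := (M1 + `|p| + 1) / `|v|.
have M1M : M < M1 by rewrite /M1; have := ler_norm M; lra.
have t0 : 0 <= t by rewrite divr_ge0 // !addr_ge0.
have Zt : Z (p + t *: v) by apply: ray; exists t; rewrite //= in_itv /= t0.
have /= := hM _ M1M _ Zt; apply/negP; rewrite -ltNge.
have : `|t *: v| <= `|p + t *: v| + `|p|.
  by have := ler_normB (p + t *: v) p; rewrite addrAC subrr add0r.
rewrite normrZ ger0_norm // divfK ?gt_eqF //; lra.
Qed.

(** A component of the complement of [A] cannot leave [L] without crossing its
    boundary, which is part of [A]. *)
Lemma open_enclosed (L A : set (R * R)) : open L -> bounded_set L ->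
  (forall p, L p -> ~ A p) -> (forall p, closure L p -> L p \/ A p) ->
  L `<=` enclosed A.
Proof.
move=> oL bL LA clL p Lp; split; first exact: LA.
set Z := connected_component _ _.
have Zp : Z p by apply: connected_component_refl => /=; exact: LA.
have ZA q : Z q -> ~ A q by move/connected_component_sub.
have ZL : Z `&` L = Z.
  apply: (@component_connected _ (~` A) p).
  - by exists p.
  - by exists L.
  - exists (closure L); first exact: closed_closure.
    apply/seteqP; split=> q [Zq Lq]; split=> //; first exact: subset_closure.
    by have [//|/ZA] := clL q Lq.
case: bL => M [Mr hM]; exists M; split=> // M' MM' q Zq; apply: (hM _ MM').
by move: Zq; rewrite -ZL => -[].
Qed.

(** Cavalieri's principle: [l] bounds the length of the vertical sections. The
    factor 2 comes from enclosing a section in an interval centered at one of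
    its points. *)
Lemma area_le (A : set (R * R)) (x0 x1 l : R) : closed A -> x0 <= x1 -> 0 <= l ->
  (forall p, A p -> x0 <= p.1 <= x1) ->
  (forall p q, A p -> A q -> p.1 = q.1 -> q.2 - p.2 <= l) ->
  (area A <= (2 * l * (x1 - x0))%:E)%E.
Proof.
move=> clA x01 l0 hx hl; pose mu := @lebesgue_measure R.
pose f := fun x : R => (mu (xsection A x)).
pose g := ((cst (2 * l)%:E : R -> \bar R) \_ `[x0, x1])%classic.
have fg x : (f x <= g x)%E.
  rewrite /f /g patchE; case: ifPn => xI; last first.
    have -> : xsection A x = set0.
      rewrite -subset0 => y /xsectionP Axy; have := hx _ Axy.
      by move=> /= h; move/negP: xI; apply; rewrite inE /= in_itv.
    by rewrite /mu measure0.
  have [[y /xsectionP Ay]|nA] := pselect (xsection A x !=set0); last first.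
    have -> : xsection A x = set0.
      by rewrite -subset0 => y Ay; apply: nA; exists y.
    by rewrite /mu measure0 lee_fin mulr_ge0.
  have sub : xsection A x `<=` `[y - l, y + l].
    move=> y' /xsectionP Ay'; rewrite /= in_itv /=.
    have /= h1 := hl _ _ Ay Ay' erefl; have /= h2 := hl _ _ Ay' Ay erefl.
    by apply/andP; lra.
  have h : (mu (xsection A x) <= mu `[(y - l)%R, (y + l)%R]%classic)%E.
    apply: le_measure => //; rewrite inE; last exact: measurable_itv.
    apply: measurable_realfun.closed_measurable.
    have -> : xsection A x = (fun y' => (x, y')) @^-1` A.
      by apply/seteqP; split=> y' /xsectionP.
    apply: closed_comp => // y' _.
    by apply: cvg_pair_nbhs; [exact: cvg_cst|exact: cvg_id].
  apply: (le_trans h).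
  rewrite /mu lebesgue_measure_itv /= lte_fin; case: ifP => _.
    by rewrite -EFinB lee_fin; lra.
  by rewrite lee_fin mulr_ge0.
have f0 x : (0 <= f x)%E by exact: measure_ge0.
have g0 x : (0 <= g x)%E by apply: le_trans (fg x); exact: f0.
have -> : area A = (\int[mu]_x f x)%E by [].
have -> : (2 * l * (x1 - x0))%:E = (\int[mu]_x g x)%E.
  rewrite /g -integral_mkcond integral_cst /=; last exact: measurable_itv.
  rewrite /mu lebesgue_measure_itv /= lte_fin; case: ltP => h.
    by rewrite -EFinB -EFinM.
  have -> : x1 = x0 by apply/le_anti; rewrite x01 h.
  by rewrite subrr mulr0 mule0.
rewrite !ge0_integralTE //; apply: le_ereal_sup => _ [h hf <-]; exists h => //= x.
exact: le_trans (hf x) (fg x).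
Qed.

Lemma box_closed (x0 x1 y0 y1 : R) :
  closed [set p : R * R | x0 <= p.1 <= x1 /\ y0 <= p.2 <= y1].
Proof.
have -> : [set p : R * R | x0 <= p.1 <= x1 /\ y0 <= p.2 <= y1] =
    ([set p | x0 <= p.1] `&` [set p | p.1 <= x1]) `&`
    ([set p | y0 <= p.2] `&` [set p | p.2 <= y1]).
  by apply/seteqP; split=> p /= => [[/andP[h1 h2] /andP[h3 h4]]//|[[-> ->] [-> ->]]].
by apply: closedI; apply: closedI;
  [exact: closed_fst_ge|exact: closed_fst_le|exact: closed_snd_ge|exact: closed_snd_le].
Qed.

Lemma enclosed_box (A : set (R * R)) (x0 x1 y0 y1 : R) :
  A `<=` [set p | x0 <= p.1 <= x1 /\ y0 <= p.2 <= y1] ->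
  enclosed A `<=` [set p | x0 <= p.1 <= x1 /\ y0 <= p.2 <= y1].
Proof.
move=> sA p Ep.
have esc (v : R * R) : v != 0 -> (forall t, 0 <= t -> A (p + t *: v) -> False) -> False.
  by move=> v0 h; apply: (ray_escape v0 h Ep).
have E1 (v : R * R) t : (p + t *: v).1 = p.1 + t * v.1 by [].
have E2 (v : R * R) t : (p + t *: v).2 = p.2 + t * v.2 by [].
have v1 s : s != 0 -> (s, 0) != 0 :> R * R.
  by move=> s0; apply/eqP => -[] /eqP; rewrite (negbTE s0).
have v2 s : s != 0 -> (0, s) != 0 :> R * R.
  by move=> s0; apply/eqP => -[] /eqP; rewrite (negbTE s0).
have n1 : (1 : R) != 0 by exact: oner_neq0.
have n2 : (-1 : R) != 0 by rewrite oppr_eq0.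
split; apply/andP; split; rewrite leNgt; apply/negP => hp.
- apply: (esc (-1, 0)) => [|t t0 /sA[]]; first exact: v1.
  by rewrite E1 /=; lra.
- apply: (esc (1, 0)) => [|t t0 /sA[]]; first exact: v1.
  by rewrite E1 /=; lra.
- apply: (esc (0, -1)) => [|t t0 /sA[_]]; first exact: v2.
  by rewrite E2 /=; lra.
apply: (esc (0, 1)) => [|t t0 /sA[_]]; first exact: v2.
by rewrite E2 /=; lra.
Qed.

Lemma chord_closure (W : set (R * R)) a b :
  (forall t : R, 0 < t < 1 -> W ((1 - t) *: a + t *: b)) ->
  chord a b `<=` closure W.
Proof.
move=> hW _ [t /andP[t0 t1] ->].
have aE (s : R) : a + s *: (b - a) = (1 - s) *: a + s *: b.
  by rewrite scalerBr scalerBl scale1r addrA addrAC.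
have bE (s : R) : b + s *: (a - b) = (1 - (1 - s)) *: a + (1 - s) *: b.
  by rewrite subKr scalerBr scalerBl scale1r addrCA.
have [t00|tn0] := eqVneq t 0.
  rewrite t00 subr0 scale0r addr0 scale1r => B nB.
  have [s hs Bs] := shift_near (b - a) (@ltr01 R) nB.
  by exists (a + s *: (b - a)); split=> //; rewrite aE; exact: hW.
have [t11|tn1] := eqVneq t 1.
  rewrite t11 subrr scale0r add0r scale1r => B nB.
  have [s /andP[s0 s1] Bs] := shift_near (a - b) (@ltr01 R) nB.
  by exists (b + s *: (a - b)); split=> //; rewrite bE; apply: hW; lra.
apply: subset_closure; apply: hW.
by rewrite !lt_neqAle t0 t1 eq_sym tn0 tn1.
Qed.

End Tools.

(** * Room for a new circle *)

Section Room.
Variable R : realType.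
Implicit Types (S C : circle R) (p q : R * R) (cs : seq (circle R)).

(** A chord from [a] to [b] with room around it. In the pencil of [a] and [b], the
    parameter of [S] is [h], while parameters of absolute value at most [H] give
    circles that remain in the box; [H] also exceeds the slope of the chord. *)
Record slot S (sg : R) (a b : R * R) (xl xr yl yu yb H h : R) : Prop := Slot {
  sl_ab : a.1 < b.1;
  sl_Qa : in_box xl xr yl yu a;
  sl_Qb : in_box xl xr yl yu b;
  sl_Sa : pow S a = 0;
  sl_Sb : pow S b = 0;
  sl_steep : `|b.2 - a.2| < H * (b.1 - a.1);
  sl_center : center S = pencil_center a b h;
  sl_pow : forall p, pow S p = pencil a b h p;
  sl_h : H < - (sg * h);
  sl_near : forall p,
    (p.1 - a.1) ^+ 2 + (p.2 - a.2) ^+ 2 <= ((1 + H ^+ 2) * (b.1 - a.1)) ^+ 2 ->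
    in_box xl xr yl yu p /\ yb < p.2;
  sl_in : forall p, in_box xl xr yl yu p -> pow S p = 0 -> a.1 < p.1 < b.1 ->
    0 < sg * line a b p;
  sl_out : forall p, in_box xl xr yl yu p -> pow S p = 0 ->
    p.1 < a.1 \/ b.1 < p.1 -> sg * line a b p < 0 }.

Lemma sqr_le_bound (x r : R) : 0 <= r -> x ^+ 2 <= r ^+ 2 -> `|x| <= r.
Proof. by move=> r0 h; rewrite -ler_sqr ?nnegrE // real_normK ?num_real. Qed.

(** As [b] tends to [a] along the arc, the chord gets short compared with the
    radius, so that [S] is far away in the pencil of [a] and [b]. *)
Lemma slot_exists cs (G : graph) (lab : R * R -> vertex G + edge G) (e : edge G)
    S (sg : R) a (xl xr yl yu yb : R) z (g M eta eps : R) :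
  picture cs lab e S sg a xl xr yl yu yb z g M eta -> 0 < eps ->
  exists H b h, [/\ 1 <= H, (1 + H ^+ 2) * (b.1 - a.1) < eps &
    slot S sg a b xl xr yl yu yb H h].
Proof.
move=> pc eps0; have pl := pc_plot pc; have lg := pl_lg pl.
have g0 := pc_g pc; have eta0 := pc_eta pc.
set o := center S.
have [Qa yba] : in_box xl xr yl yu a /\ yb < a.2.
  by apply: (pc_near pc); rewrite subrr normr0 ltW.
have M0 : 0 <= M by apply: le_trans (pc_M pc Qa); exact: normr_ge0.
pose H := M / g + 1.
have H1 : 1 <= H by rewrite /H lerDr divr_ge0 // ltW.
pose L := 1 + H ^+ 2.
have L1 : 1 <= L by rewrite /L lerDl sqr_ge0.
have L0 : 0 < L by lra.
pose d := Num.min (Num.min eps eta / (2 * L)) (g / H).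
have H0 : 0 < H by lra.
have d0 : 0 < d by rewrite !lt_min !divr_gt0 ?lt_min ?eps0 ?eta0 ?mulr_gt0.
have dle1 : d * (2 * L) <= Num.min eps eta.
  by rewrite -ler_pdivlMr ?mulr_gt0 // ge_min lexx.
have deps : L * d < eps.
  have : Num.min eps eta <= eps by rewrite ge_min lexx.
  have := mulr_gt0 L0 d0; lra.
have deta : L * d <= eta.
  have : Num.min eps eta <= eta by rewrite ge_min lexx orbT.
  have := mulr_gt0 L0 d0; lra.
have dg : H * d <= g by rewrite mulrC -ler_pdivlMr // ge_min lexx orbT.
have dd : d <= eta by apply: le_trans deta; rewrite ler_peMl // ltW.
have hx : xl < a.1 + d < xr.
  have [] : in_box xl xr yl yu (a.1 + d, a.2) /\ yb < a.2.
    by apply: (pc_near pc) => /=; rewrite ?subrr ?normr0 ?(ltW eta0) // addrAC subrr add0r gtr0_norm.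
  by case/andP.
pose b := (a.1 + d, z (a.1 + d)).
have Qb : in_box xl xr yl yu b by exact: (plot_graph pl).
have Sb : pow S b = 0 by exact: (plot_graph_pow pl).
have Sa := pc_a pc.
have bd : b.1 - a.1 = d by rewrite /b /= addrAC subrr add0r.
have ab : a.1 < b.1 by rewrite -subr_gt0 bd.
have sg1 := lg_sg lg.
pose Y (q r : R * R) := sg * (q.2 + r.2 - 2 * o.2).
have Yg q r : in_box xl xr yl yu q -> in_box xl xr yl yu r -> 2 * g <= Y q r.
  move=> /(pc_above pc) hq /(pc_above pc) hr; rewrite -/o in hq hr.
  rewrite /Y; have -> : sg * (q.2 + r.2 - 2 * o.2) =
    sg * (q.2 - o.2) + sg * (r.2 - o.2) by ring.
  lra.
have diff q r : pow S q = 0 -> pow S r = 0 ->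
    (q.2 - r.2) * Y q r = - sg * ((q.1 - r.1) * (q.1 + r.1 - 2 * o.1)).
  move=> Sq Sr; have : pow S q - pow S r = 0 by rewrite Sq Sr subrr.
  rewrite /pow -/o /Y => E; apply/eqP; rewrite -subr_eq0; apply/eqP.
  rewrite -[RHS](mulr0 sg) -E; ring.
have sgn : `|sg| = 1 by case: sg1 => ->; rewrite ?normrN normr1.
have sgsg : sg * sg = 1 by case: sg1 => ->; ring.
have steep : `|b.2 - a.2| < H * d.
  have /(congr1 (fun t => `|t|)) := diff b a Sb Sa.
  rewrite [LHS]normrM [RHS]normrM normrN sgn mul1r [RHS]normrM bd (gtr0_norm d0).
  have hY := Yg b a Qb Qa; rewrite (@ger0_norm _ (Y b a)); last by lra.
  have hX : `|b.1 + a.1 - 2 * o.1| <= 2 * M.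
    have -> : b.1 + a.1 - 2 * o.1 = (b.1 - o.1) + (a.1 - o.1) by ring.
    apply: le_trans (ler_normD _ _) _.
    have := pc_M pc Qa; have := pc_M pc Qb; rewrite -/o; lra.
  move=> E; have n0 := normr_ge0 (b.2 - a.2).
  have h1 : `|b.2 - a.2| * (2 * g) <= d * (2 * M).
    apply: (@le_trans _ _ (`|b.2 - a.2| * Y b a)); first exact: ler_wpM2l.
    by rewrite E ler_wpM2l // ltW.
  have h2 : `|b.2 - a.2| <= M / g * d.
    rewrite mulrAC ler_pdivlMr //; lra.
  by rewrite /H; lra.
pose h := (2 * o.2 - a.2 - b.2) / (b.1 - a.1).
have cS : center S = pencil_center a b h by have [] := pow_pencil a ab Sa Sb.
have powE p : pow S p = pencil a b h p by have [] := pow_pencil p ab Sa Sb.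
have hH : H < - (sg * h).
  have -> : - (sg * h) = Y a b / d by rewrite /h bd /Y; field; rewrite gt_eqF.
  rewrite ltr_pdivlMr //; have := Yg a b Qa Qb; lra.
(* As the arc is monotone, the two coordinates of [p] are between those of [a]
   and [b] at the same time, so [p] is inside the disk on the diameter from [a]
   to [b] or outside; on [S], this tells the side of the chord. *)
have key p : in_box xl xr yl yu p -> pow S p = 0 ->
   exists2 k : R, 0 < k & sg * line a b p * k = - ((p.1 - a.1) * (p.1 - b.1)).
  move=> Qp Sp; have := diff p a Sp Sa; have := diff p b Sp Sb.
  have Ya := Yg p a Qp Qa; have Yb := Yg p b Qp Qb.
  have X : 0 < (p.1 + a.1 - 2 * o.1) * (p.1 + b.1 - 2 * o.1).
    have [s|s] := pc_side pc; rewrite -/o in s;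
      have := s _ Qp; have := s _ Qa; have := s _ Qb => h1 h2 h3.
      by clear -h1 h2 h3; apply: mulr_gt0; lra.
    by clear -h1 h2 h3; rewrite nmulr_rgt0; lra.
  move: (powE p); rewrite Sp /pencil; set l := line a b p.
  move=> hp ea eb.
  have EE : (p.2 - a.2) * (p.2 - b.2) * (Y p a * Y p b) =
     (p.1 - a.1) * (p.1 - b.1) * ((p.1 + a.1 - 2 * o.1) * (p.1 + b.1 - 2 * o.1)).
    have -> : (p.2 - a.2) * (p.2 - b.2) * (Y p a * Y p b) =
      ((p.2 - a.2) * Y p a) * ((p.2 - b.2) * Y p b) by ring.
    by rewrite ea eb -[RHS]mul1r -sgsg; ring.
  set X0 := _ * _ in X EE; set Y0 := Y p a * Y p b in EE.
  have Y0p : 0 < Y0 by clear -Ya Yb g0; apply: mulr_gt0; lra.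
  exists (- (sg * h) * Y0 / (X0 + Y0)).
    by rewrite divr_gt0 ?addr_gt0 // mulr_gt0 //; clear -hH H0; lra.
  have n0 : X0 + Y0 != 0 by rewrite gt_eqF // addr_gt0.
  apply: (mulIf n0); rewrite mulrA divfK //.
  have -> : sg * l * (- (sg * h) * Y0) = - (sg * sg) * (h * l) * Y0 by ring.
  by rewrite sgsg; move: EE hp; move: (h * l) => hl; clear -hl; nra.
exists H, b, h; split=> //; first by rewrite bd.
split=> //; rewrite ?bd //.
- move=> p; rewrite -/L => hp; have Ld : 0 <= L * d by rewrite mulr_ge0 // ltW.
  have s1 := sqr_ge0 (p.1 - a.1); have s2 := sqr_ge0 (p.2 - a.2).
  by apply: (pc_near pc); apply: le_trans deta; apply: sqr_le_bound => //; clear -hp s1 s2; lra.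
- move=> p Qp Sp /andP[pa pb].
  have [k k0 E] := key p Qp Sp.
  by rewrite -(pmulr_lgt0 _ k0) E oppr_gt0 pmulr_rlt0 ?subr_gt0 // subr_lt0.
move=> p Qp Sp out; have [k k0 E] := key p Qp Sp.
rewrite -(pmulr_llt0 _ k0) E oppr_lt0.
by case: out => hp; [rewrite nmulr_rgt0|rewrite mulr_gt0 //]; clear -ab hp; lra.
Qed.

Lemma small_slot cs (G : graph) (lab : R * R -> vertex G + edge G) (e : edge G)
    S (sg : R) a (xl xr yl yu yb : R) z (g M eta e1 e2 : R) :
  picture cs lab e S sg a xl xr yl yu yb z g M eta -> 0 < e1 -> 0 < e2 ->
  exists H b h, [/\ 1 <= H, (1 + H ^+ 2) * (b.1 - a.1) < e1 /\
      2 * ((1 + H ^+ 2) * (b.1 - a.1)) ^+ 2 < e2 &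
    slot S sg a b xl xr yl yu yb H h].
Proof.
move=> pc e10 e20.
have e0 : 0 < Num.min e1 (Num.min 1 (e2 / 2)) by rewrite !lt_min e10 ltr01 divr_gt0.
have [H [b [h [H1 small sl]]]] := slot_exists pc e0; exists H, b, h; split=> //.
have L0 : 0 <= (1 + H ^+ 2) * (b.1 - a.1).
  by apply: mulr_ge0; [rewrite addr_ge0 ?sqr_ge0|rewrite subr_ge0 ltW // (sl_ab sl)].
move: small L0; move: (_ * _) => L; rewrite !lt_min => /andP[-> /andP[L1 L2]] L0.
have : L ^+ 2 <= L by rewrite expr2 ler_piMr // ltW.
by split=> //; lra.
Qed.

Lemma pencil_chord a b k (t : R) :
  pencil a b k ((1 - t) *: a + t *: b) =
  - (t * (1 - t) * ((b.1 - a.1) ^+ 2 + (b.2 - a.2) ^+ 2)).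
Proof.
set p := _ + _.
have p1 : p.1 = (1 - t) * a.1 + t * b.1 by [].
have p2 : p.2 = (1 - t) * a.2 + t * b.2 by [].
by rewrite /pencil /line p1 p2; ring.
Qed.

(** [pencil a b 0] is the power with respect to the circle on the diameter from
    [a] to [b], whose disk has no point farther from [a] than [b]. *)
Lemma pencil0_near a b p : pencil a b 0 p <= 0 ->
  (p.1 - a.1) ^+ 2 + (p.2 - a.2) ^+ 2 <= (b.1 - a.1) ^+ 2 + (b.2 - a.2) ^+ 2.
Proof.
rewrite /pencil mul0r subr0 => h.
have s1 := sqr_ge0 (p.1 - b.1); have s2 := sqr_ge0 (p.2 - b.2); lra.
Qed.

(** Both [a] and [p] are in the disk, hence their distance is at most its
    diameter. *)
Lemma disk_near C a p : pow C a = 0 -> pow C p <= 0 ->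
  (p.1 - a.1) ^+ 2 + (p.2 - a.2) ^+ 2 <= 4 * radius C ^+ 2.
Proof.
rewrite /pow; set c := center C => ha hp.
have s1 := sqr_ge0 (p.1 - c.1 + (a.1 - c.1)).
have s2 := sqr_ge0 (p.2 - c.2 + (a.2 - c.2)); lra.
Qed.

Section Addition.
Variables (eps : smallness R) (cs : seq (circle R)) (G : graph) (act : edge G -> bool).
Variables (xv : vertex G -> R) (lab : R * R -> vertex G + edge G) (e : edge G).
Variables (S C : circle R) (sg : R) (a b : R * R) (xl xr yl yu yb : R) (z : R -> R).
Variables (g M eta H h k : R).
Hypothesis dr : drawing cs act xv lab.
Hypothesis pc : picture cs lab e S sg a xl xr yl yu yb z g M eta.
Hypothesis sl : slot S sg a b xl xr yl yu yb H h.
Hypothesis hk : h != k.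
Hypothesis cC : center C = pencil_center a b k.
Hypothesis rC : radius C ^+ 2 = ((b.1 - a.1) ^+ 2 + (b.2 - a.2) ^+ 2) * (1 + k ^+ 2) / 4.
Hypothesis powC : forall p, pow C p = pencil a b k p.
Local Notation Q := (in_box xl xr yl yu).
Local Notation K := (closed_region cs).
Local Notation X := (punctured cs).

Lemma slot_sqr : (b.1 - a.1) ^+ 2 + (b.2 - a.2) ^+ 2 <= (1 + H ^+ 2) * (b.1 - a.1) ^+ 2.
Proof.
have st := sl_steep sl; have := ler_pM (normr_ge0 _) (normr_ge0 _) (ltW st) (ltW st).
by rewrite -!expr2 real_normK ?num_real // exprMn; lra.
Qed.

Lemma slot_sqr2 :
  (b.1 - a.1) ^+ 2 + (b.2 - a.2) ^+ 2 <= ((1 + H ^+ 2) * (b.1 - a.1)) ^+ 2.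
Proof.
apply: le_trans slot_sqr _; rewrite exprMn ler_wpM2r ?sqr_ge0 //.
by rewrite expr2 ler_peMl // ?addr_ge0 ?sqr_ge0 // lerDl sqr_ge0.
Qed.

Lemma slot_small p : pencil a b 0 p <= 0 -> Q p /\ yb < p.2.
Proof.
by move=> /pencil0_near hp; apply: (sl_near sl); apply: le_trans hp slot_sqr2.
Qed.

Lemma slot_radius : `|k| <= H ->
  4 * radius C ^+ 2 <= ((1 + H ^+ 2) * (b.1 - a.1)) ^+ 2.
Proof.
move=> kH; rewrite rC exprMn.
have k2 : k ^+ 2 <= H ^+ 2 by rewrite -(real_normK (num_real k)) lerXn2r ?nnegrE // (le_trans _ kH).
have -> : 4 * (((b.1 - a.1) ^+ 2 + (b.2 - a.2) ^+ 2) * (1 + k ^+ 2) / 4) =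
   ((b.1 - a.1) ^+ 2 + (b.2 - a.2) ^+ 2) * (1 + k ^+ 2) by field.
apply: (@le_trans _ _ ((1 + H ^+ 2) * (b.1 - a.1) ^+ 2 * (1 + H ^+ 2))); last by lra.
apply: ler_pM => //; last by lra.
- by rewrite addr_ge0 ?sqr_ge0.
- by rewrite addr_ge0 ?sqr_ge0.
exact: slot_sqr.
Qed.

Lemma slot_disk p : `|k| <= H -> pow C p <= 0 -> Q p /\ yb < p.2.
Proof.
move=> kH Cp; apply: (sl_near sl).
have Ca : pow C a = 0 by rewrite powC /pencil /line; ring.
exact: le_trans (disk_near Ca Cp) (slot_radius kH).
Qed.

Lemma slot_boundary p : Q p -> pow S p = 0 ->
  [/\ K p, bd X p & in_exactly_one X S p].
Proof.
have lg := pl_lg (pc_plot pc); have clE := dr_closure dr.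
move=> Qp Sp; have Kp : K p by apply/(lg_closed lg Qp); rewrite (on_graph lg Qp).1.
split=> //; first by apply/(bd_punctured _ clE); split=> //; exists S => //; exact: lg_in lg.
move=> C'; split=> [[C'X /circle_setP C'p]|->]; last first.
  by split; [exact: lg_in lg|exact/circle_setP].
exact: (box_other_circle lg C'X Qp C'p).
Qed.

Lemma slot_same_edge (p q : closure (dom X)) : Q (val p) -> Q (val q) ->
  same_edge fst p q /\ same_edge snd p q.
Proof.
move=> Qp Qq; have pl := pc_plot pc; have clE := dr_closure dr.
have cA := box_connected (pl_lg pl) (pl_yb pl) (pl_base pl).
have KA r : closure (dom X) r -> K r by rewrite /= clE.
have sA : [set q | Q q /\ K q] `<=` closure (dom X) by move=> r [_]; rewrite /= clE.
have Kp := KA _ (set_mem (valP p)); have Kq := KA _ (set_mem (valP q)).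
split; apply: same_edge_connected cA sA _ _ _ => //.
  move=> r /(pc_fst pc) nr r' [/andP[Qr' _] _] E; apply: nr.
  by rewrite -E.
move=> r /(pc_snd pc) nr r' [/andP[_ Qr'] _] E; apply: nr.
by rewrite -E.
Qed.

(** The other circles do not pass through [a], and [S] crosses [C] there. *)
Lemma slot_fresh : C \notin circles X.
Proof.
have pl := pc_plot pc.
apply: (@C_fresh _ cs S C a b sg xl xr yl yu z (pl_lg pl) (sl_Qa sl)).
  by rewrite powC /pencil /line; ring.
exact: pencil_trans (sl_ab sl) hk (sl_center sl) cC.
Qed.

Lemma slot_ne : a <> b.
Proof. by move=> E; have := sl_ab sl; rewrite E ltxx. Qed.

Lemma enorm_lt (r : R) : 0 < r -> (1 + H ^+ 2) * (b.1 - a.1) < r -> enorm (b - a) < r.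
Proof.
move=> r0 hr; rewrite -ltr_sqr ?nnegrE ?enorm_ge0 ?(ltW r0) // enorm_sqr.
apply: le_lt_trans slot_sqr2 _; rewrite ltr_sqr ?nnegrE ?(ltW r0) //.
by apply: mulr_ge0; [rewrite addr_ge0 ?sqr_ge0|rewrite subr_ge0 ltW // (sl_ab sl)].
Qed.

Lemma pow_disk_box p : pow C p <= 0 ->
  (center C).1 - radius C <= p.1 <= (center C).1 + radius C /\
  (center C).2 - radius C <= p.2 <= (center C).2 + radius C.
Proof.
have r0 := ltW (radius_gt0 C).
rewrite /pow => hp; have s1 := sqr_ge0 (p.1 - (center C).1).
have s2 := sqr_ge0 (p.2 - (center C).2).
have := @sqr_le_bound (p.1 - (center C).1) _ r0.
have := @sqr_le_bound (p.2 - (center C).2) _ r0.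
by rewrite !ler_norml => h2 h1; split; apply/andP; lra.
Qed.

(** The new disk covers the chord and the arc of [S] above it. The region between
    the two arcs is the intersection of the two disks; it is contained in a
    square around the new disk, which bounds its area. *)
Lemma near_addition : S = unit_circle R -> sg = 1 -> `|k| <= H ->
  (1 + H ^+ 2) * (b.1 - a.1) < (sscc_dist eps X a)%:num ->
  2 * ((1 + H ^+ 2) * (b.1 - a.1)) ^+ 2 < (sscc_area_near eps X a)%:num ->
  is_ss_region (punctured (rcons cs C)) ->
  sscc_addition eps X (punctured (rcons cs C)).
Proof.
move=> SU sg1 kH small_dist small_area ssX'.
have lg := pl_lg (pc_plot pc); have clE := dr_closure dr.
have [Qa Qb] := (sl_Qa sl, sl_Qb sl).
have [Ka bda onea] := slot_boundary Qa (sl_Sa sl).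
have [Kb bdb oneb] := slot_boundary Qb (sl_Sb sl).
have hlt : h < k.
  have := sl_h sl; rewrite sg1 mul1r; move: kH; rewrite ler_norml => /andP[]; lra.
have H0 : 0 <= H by apply: le_trans kH; exact: normr_ge0.
have h0 : h < 0 by have := sl_h sl; rewrite sg1 mul1r; lra.
have clDom : closure (dom X) = K by rewrite /= clE.
have Sp0 p : Q p -> pow S p <= 0 -> K p.
  by move=> Qp Sp; apply/(lg_closed lg Qp); rewrite (lg_le lg Qp) sg1 mul1r.
have chordN (t : R) : 0 < t < 1 ->
    0 < t * (1 - t) * ((b.1 - a.1) ^+ 2 + (b.2 - a.2) ^+ 2).
  move=> /andP[t0 t1]; rewrite mulr_gt0 //; first by rewrite mulr_gt0 // subr_gt0.
  by rewrite ltr_wpDr ?sqr_ge0 // exprn_gt0 // subr_gt0 (sl_ab sl).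
have cloC (p : R * R) (P : K p) : closure (dom X) p by rewrite clDom.
pose pa : closure (dom X) := exist _ a (mem_set (cloC a Ka)).
pose pb : closure (dom X) := exist _ b (mem_set (cloC b Kb)).
have powS p : pow S p = pow C p + (k - h) * line a b p.
  by rewrite (sl_pow sl) powC -(pencil_diff a b h k p); ring.
exists pa, pb, S, C; split=> //.
- split=> //; first exact: slot_ne.
  move=> p [/circle_setP Sp lp]; apply: (cloC _); apply: Sp0; last by rewrite Sp.
  apply: (proj1 (slot_small _)); have := pencil_diff a b 0 h p.
  rewrite -(sl_pow sl) Sp subr0 => ->; rewrite subr0.
  by rewrite nmulr_rle0.
- exact: slot_same_edge.
- by split; [| |exact: slot_fresh]; apply/circle_setP; rewrite powC /pencil /line; ring.
apply: Or31.
set A := _ `|` _; set W := enclosed A.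
pose L := [set p | pow S p < 0] `&` [set p | pow C p < 0].
have sAC : A `<=` [set p | pow C p <= 0].
  move=> p [[/circle_setP Sp lp]|[/circle_setP Cp _]] /=; last by rewrite Cp.
  have := powS p; rewrite Sp; have : 0 <= line a b p by [].
  by move: hlt; nra.
have LW : L `<=` W.
  apply: open_enclosed.
  - by apply: openI; exact: pow_open_lt.
  - exists 1; split; first exact: num_real.
    move=> M' M1 p [+ _]; rewrite /= SU pow_unit => Up.
    have s1 := sqr_ge0 p.1; have s2 := sqr_ge0 p.2.
    rewrite prod_normE ge_max; apply/andP; split;
      apply: le_trans (ltW M1); apply: sqr_le_bound => //; rewrite expr1n; lra.
  - move=> p [/= Sp Cp] [[/circle_setP Sp' _]|[/circle_setP Cp' _]].
      by rewrite Sp' ltxx in Sp.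
    by rewrite Cp' ltxx in Cp.
  move=> p clp.
  have [/= Sp Cp] : ([set p | pow S p <= 0] `&` [set p | pow C p <= 0]) p.
    have : closed ([set p | pow S p <= 0] `&` [set p | pow C p <= 0]).
      by apply: closedI; exact: pow_closed_le.
    move/closure_id => ->; move: p clp; apply: closure_subset => q [/= h1 h2].
    by split; exact: ltW.
  have [C0|Cn] := eqVneq (pow C p) 0.
    by right; right; split; [exact/circle_setP|exact/closed_diskP].
  have [S0|Sn] := eqVneq (pow S p) 0.
    right; left; split; first exact/circle_setP.
    have : 0 <= line a b p; last by [].
    by move: (powS p) hlt Cp; rewrite S0; nra.
  by left; split; rewrite /= lt_neqAle ?Sn ?Cn.
split=> //.
- move=> _ [t /andP[t0 t1] ->]; apply: (cloC _).
  have n (m : R) : pencil a b m ((1 - t) *: a + t *: b) <= 0.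
    rewrite pencil_chord oppr_le0; apply: mulr_ge0; last by rewrite addr_ge0 ?sqr_ge0.
    by apply: mulr_ge0; lra.
  apply: Sp0; first exact: (proj1 (slot_small (n 0))).
  by rewrite (sl_pow sl).
- apply: chord_closure => t ht; apply: LW; split=> /=.
    by rewrite (sl_pow sl) pencil_chord oppr_lt0 chordN.
  by rewrite powC pencil_chord oppr_lt0 chordN.
- exact: enorm_lt.
- apply: le_lt_trans (_ : ((2 * (2 * radius C) *
      ((center C).1 + radius C - ((center C).1 - radius C)))%:E < _)%E); last first.
    rewrite lte_fin; apply: le_lt_trans small_area.
    have -> : 2 * (2 * radius C) * ((center C).1 + radius C - ((center C).1 - radius C)) =
      2 * (4 * radius C ^+ 2) by ring.
    rewrite ler_pM2l //.
    exact: slot_radius.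
  have r0 := ltW (radius_gt0 C).
  have inbox : closure W `<=` [set p | (center C).1 - radius C <= p.1 <= (center C).1 + radius C /\
      (center C).2 - radius C <= p.2 <= (center C).2 + radius C].
    have := @box_closed R ((center C).1 - radius C) ((center C).1 + radius C)
       ((center C).2 - radius C) ((center C).2 + radius C).
    move/closure_id => ->; apply: closure_subset; apply: enclosed_box.
    by move=> p /sAC; exact: pow_disk_box.
  apply: area_le; [exact: closed_closure|lra|lra| |].
    by move=> p /inbox[].
  by move=> p q /inbox[_ hp] /inbox[_ hq] _; move: hp hq => /andP[? ?] /andP[? ?]; lra.
by rewrite remove_disk_punctured.
Qed.

(** Here the chord is outside the region, in a disk removed earlier. The new arc
    follows that of [S] closely on the side of the region, and the crescent
    between them gets thin as [k] tends to [h], while the chord is fixed. *)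
Lemma far_addition : S <> unit_circle R -> sg = -1 -> 0 <= k < h ->
  2 * ((h - k) * ((b.1 - a.1) ^+ 2 + (b.2 - a.2) ^+ 2) / (2 * g)) *
    (2 * ((1 + H ^+ 2) * (b.1 - a.1))) < (sscc_area eps X b a)%:num ->
  is_ss_region (punctured (rcons cs C)) ->
  sscc_addition eps X (punctured (rcons cs C)).
Proof.
move=> SU sg1 /andP[k0 kh] small_area ssX'.
have lg := pl_lg (pc_plot pc); have clE := dr_closure dr.
have [Qa Qb] := (sl_Qa sl, sl_Qb sl).
have [Ka bda onea] := slot_boundary Qa (sl_Sa sl).
have [Kb bdb oneb] := slot_boundary Qb (sl_Sb sl).
have clDom : closure (dom X) = K by rewrite /= clE.
have inK p : Q p -> K p <-> 0 <= pow S p.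
  move=> Qp; have := lg_closed lg Qp; rewrite (lg_le lg Qp) sg1 mulN1r oppr_le0.
  by [].
have d0 : 0 < b.1 - a.1 by rewrite subr_gt0 (sl_ab sl).
set D2 := (b.1 - a.1) ^+ 2 + (b.2 - a.2) ^+ 2 in small_area *.
have D20 : 0 < D2 by rewrite /D2 ltr_wpDr ?sqr_ge0 // exprn_gt0.
have cloC (p : R * R) (P : K p) : closure (dom X) p by rewrite clDom.
pose pa : closure (dom X) := exist _ a (mem_set (cloC a Ka)).
pose pb : closure (dom X) := exist _ b (mem_set (cloC b Kb)).
have powE p : pow C p = pow S p + (h - k) * line a b p.
  by rewrite (sl_pow sl) powC -(pencil_diff a b k h p); ring.
have pow0 p : pencil a b 0 p = pow C p + k * line a b p.
  by rewrite powC /pencil; ring.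
have lineN p : line b a p = - line a b p by rewrite /line; ring.
exists pb, pa, S, C; split=> //.
- split=> //; first by move=> E; exact: (slot_ne (esym E)).
  move=> p [/circle_setP Sp lp]; apply: (cloC _); apply/inK; last by rewrite Sp.
  have : 0 <= line b a p by [].
  rewrite lineN => lp'; apply: (proj1 (slot_small _)); rewrite pow0 powE Sp.
  by rewrite add0r -mulrDl subrK pmulr_rle0 ?(le_lt_trans k0) // -oppr_ge0.
- exact: slot_same_edge.
- by split; [| |exact: slot_fresh]; apply/circle_setP; rewrite powC /pencil /line; ring.
have chordE (t : R) : (1 - t) *: b + t *: a = (1 - (1 - t)) *: a + (1 - t) *: b.
  by rewrite subKr addrC.
apply: Or33; split; last 2 first.
- set A := _ `|` _; set W := enclosed A.
  pose Cr := [set p | pow C p <= 0] `&` [set p | 0 <= pow S p].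
  have crN p : Cr p -> line a b p <= 0 /\ pencil a b 0 p <= 0.
    case=> /= Cp Sp; have := powE p; have := pow0 p.
    have kh' : 0 < h - k by rewrite subr_gt0.
    move=> E0 E; have l0 : line a b p <= 0.
      by rewrite -(pmulr_rle0 _ kh'); lra.
    by split=> //; have := mulr_ge0_le0 k0 l0; lra.
  have crQ p : Cr p -> Q p by move/crN => -[_ /slot_small[]].
  have sA : A `<=` Cr.
    move=> p [[/circle_setP Sp lp]|[/circle_setP Cp nS]]; split=> /=.
    + have : 0 <= line b a p by [].
      by rewrite lineN powE Sp add0r => l0; rewrite pmulr_rle0 ?subr_gt0 // -oppr_ge0.
    + by rewrite Sp.
    + by rewrite Cp.
    by rewrite leNgt; apply/negP => Sp; apply: nS; apply/open_diskP.
  have above p : Q p -> g <= (center S).2 - p.2.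
    by move=> /(pc_above pc); rewrite sg1 mulN1r opprB.
  (* Outside the crescent, one escapes radially from [C], or upwards across [S],
     which the box does not let one meet again. *)
  have sW : W `<=` Cr.
    move=> p Wp; split; rewrite /= leNgt; apply/negP => hp.
      pose v := p - center C.
      have pE t : pow C (p + t *: v) = pow C p +
          t * (2 + t) * ((p.1 - (center C).1) ^+ 2 + (p.2 - (center C).2) ^+ 2).
        have e1 : (p + t *: v).1 = p.1 + t * (p.1 - (center C).1) by [].
        have e2 : (p + t *: v).2 = p.2 + t * (p.2 - (center C).2) by [].
        by rewrite /pow e1 e2; ring.
      apply: (@ray_escape _ A p v _ _ Wp).
        apply/eqP => v0; move: hp.
        have -> : p = center C by apply/eqP; rewrite -subr_eq0 -/v v0.
        by rewrite /pow !subrr; have := sqr_ge0 (radius C); lra.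
      move=> t t0 /sA[/= + _]; rewrite pE; apply/negP; rewrite -ltNge.
      by rewrite ltr_wpDr // mulr_ge0 // ?mulr_ge0 // addr_ge0 // sqr_ge0.
    pose v : R * R := (0, 1).
    have e1 t : (p + t *: v).1 = p.1 + t * 0 by [].
    have e2 t : (p + t *: v).2 = p.2 + t * 1 by [].
    apply: (@ray_escape _ A p v _ _ Wp).
      by apply/eqP => -[] /eqP; rewrite (negbTE (oner_neq0 _)).
    move=> t t0 /sA Cr'; have := above _ (crQ _ Cr'); rewrite e2 mulr1.
    have [_] := Cr'; rewrite /mkset; have -> : pow S (p + t *: v) =
        pow S p + t * (p.2 + (p.2 + t) - 2 * (center S).2).
      by rewrite /pow e1 e2; ring.
    by have := pc_g pc; move: hp t0; nra.
  have sclW : closure W `<=` Cr.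
    have : closed Cr by apply: closedI; [exact: pow_closed_le|exact: pow_closed_ge].
    by move/closure_id => ->; exact: closure_subset.
  apply: le_lt_trans (_ : ((2 * ((h - k) * D2 / (2 * g)) *
      ((a.1 + (1 + H ^+ 2) * (b.1 - a.1)) - (a.1 - (1 + H ^+ 2) * (b.1 - a.1))))%:E < _)%E); last first.
    rewrite lte_fin; apply: le_lt_trans small_area.
    by rewrite le_eqVlt; apply/orP; left; apply/eqP; ring.
  have D10 : 0 <= (1 + H ^+ 2) * (b.1 - a.1).
    by apply: mulr_ge0; [rewrite addr_ge0 ?sqr_ge0|exact: ltW].
  have g20 : 0 < 2 * g by rewrite mulr_gt0 // (pc_g pc).
  apply: area_le; [exact: closed_closure|lra| | |].
  + apply: divr_ge0; last exact: ltW.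
    by apply: mulr_ge0; [rewrite subr_ge0 ltW|exact: ltW].
  + move=> p /sclW/crN[_ /pencil0_near]; rewrite -/D2 => near.
    have s2 := sqr_ge0 (p.2 - a.2).
    have : `|p.1 - a.1| <= (1 + H ^+ 2) * (b.1 - a.1).
      by apply: sqr_le_bound => //; apply: le_trans slot_sqr2; rewrite -/D2; lra.
    by rewrite ler_norml => /andP[? ?]; apply/andP; lra.
  move=> p q /sclW Cp /sclW Cq pq; have gp := above _ (crQ _ Cp); have gq := above _ (crQ _ Cq).
  rewrite ler_pdivlMr //.
  have [le|/ltW le] := leP q.2 p.2.
    apply: (@le_trans _ _ 0); first by apply: mulr_le0_ge0; [rewrite subr_le0|exact: ltW].
    by apply: mulr_ge0; [rewrite subr_ge0 ltW|exact: ltW].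
  have bound : - line a b p <= D2.
    have [_ /pencil0_near] := crN _ Cp; rewrite -/D2.
    have := sqr_ge0 (b.1 - a.1 + (p.2 - a.2)); have := sqr_ge0 (b.2 - a.2 - (p.1 - a.1)).
    by rewrite /line /D2; lra.
  have up : pow S p <= (h - k) * D2.
    have [/= Cp' _] := Cp; have := powE p.
    have : (h - k) * - line a b p <= (h - k) * D2 by rewrite ler_wpM2l // subr_ge0 ltW.
    lra.
  have [_ /= Sq] := Cq.
  have E : pow S p - pow S q = (q.2 - p.2) * (2 * (center S).2 - p.2 - q.2).
    by rewrite /pow pq; ring.
  have : (q.2 - p.2) * (2 * g) <= (q.2 - p.2) * (2 * (center S).2 - p.2 - q.2).
    by apply: ler_wpM2l; [rewrite subr_ge0|lra].
  by rewrite -E; lra.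
- by rewrite remove_disk_punctured.
apply/seteqP; split=> [p [[t /andP[t0 t1] pE] clp]|].
  have [t00|tn0] := eqVneq t 0; first by left; rewrite pE t00 subr0 scale1r scale0r addr0.
  have [t11|tn1] := eqVneq t 1; first by right; rewrite pE t11 subrr scale1r scale0r add0r.
  have Kp : K p by rewrite -clDom.
  have ht : 0 < (1 - t) * (1 - (1 - t)).
    by rewrite subKr mulr_gt0 ?subr_gt0 // lt_neqAle ?t0 ?t1 ?tn1 // eq_sym tn0.
  have n (m : R) : pencil a b m p < 0.
    by rewrite pE chordE pencil_chord oppr_lt0 mulr_gt0.
  have Qp : Q p by exact: (proj1 (slot_small (ltW (n 0)))).
  by have := (inK p Qp).1 Kp; rewrite (sl_pow sl) leNgt n.
move=> p [->|->]; split; try (by apply: (cloC _)).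
  by exists 0; rewrite ?lexx ?ler01 // subr0 scale1r scale0r addr0.
by exists 1; rewrite ?lexx ?ler01 // subrr scale1r scale0r add0r.
Qed.

End Addition.

End Room.

(** * Carrying out the construction *)

Section Steps.
Variables (R : realType) (eps : smallness R).
Implicit Types (S C : circle R) (p q : R * R) (cs : seq (circle R)).
Local Notation U := (unit_circle R).

Lemma sign_neq : (1 : R) <> -1.
Proof. by move=> E; have := @ltr01 R; have := @ltr0N1 R; rewrite -E; lra. Qed.

(** Under an arc of the unit circle, the parameter [k = H] allows
    [near_addition]; under a removed disk, [k] is taken close to the parameter
    [h] of that disk, for [far_addition]. In both cases the center of [C] is above
    the chord, and [flat_cut] applies. *)
Lemma flat_addition cs (G : graph) (act : edge G -> bool) xv
    (lab : R * R -> vertex G + edge G) (e : edge G) : drawing cs act xv lab ->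
  exists C xv' lab', drawing (rcons cs C) (fun _ : edge (split_twice e) => false) xv' lab' /\
    sscc_addition eps (punctured cs) (punctured (rcons cs C)).
Proof.
move=> dr; have [a [S [sg [[Ka la SL] Sa ga hsg above]]]] := generic_top e dr.
have [xl [xr [yl [yu [yb [z [g [M [eta pc]]]]]]]]] :=
  generic_picture dr Ka la SL Sa ga hsg above.
pose e1 := (sscc_dist eps (punctured cs) a)%:num.
pose e2 := (sscc_area_near eps (punctured cs) a)%:num.
have e10 : 0 < e1 by rewrite /e1; exact: gt0.
have e20 : 0 < e2 by rewrite /e2; exact: gt0.
have [H [b [h [H1 [small1 small2] sl]]]] := small_slot pc e10 e20.
have ab := sl_ab sl; have d0 : 0 < b.1 - a.1 by rewrite subr_gt0.
set L := (1 + H ^+ 2) * (b.1 - a.1) in small1 small2.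
have L0 : 0 < L by apply: mulr_gt0 => //; have := sqr_ge0 H; lra.
have hH := sl_h sl; have g0 := pc_g pc.
pose e3 := (sscc_area eps (punctured cs) b a)%:num.
have e30 : 0 < e3 by rewrite /e3; exact: gt0.
have [N N0 NE] : exists2 N, 0 < N &
    N = 2 * (((b.1 - a.1) ^+ 2 + (b.2 - a.2) ^+ 2) / (2 * g)) * (2 * L).
  eexists; last reflexivity.
  apply: mulr_gt0; last exact: mulr_gt0.
  apply: mulr_gt0 => //; apply: divr_gt0; last exact: mulr_gt0.
  by rewrite ltr_wpDr ?sqr_ge0 // exprn_gt0.
(* [k = h - dl], where [dl] is small enough for [C] to remain above the chord
   and for the crescent to have the required area *)
have [k [kH hk k1 k2]] : exists k, [/\ H <= k, h != k, sg = 1 -> k = H &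
    sg = -1 -> 0 <= k < h /\ (h - k) * N < e3].
  case: hsg => -[_ sgE]; rewrite sgE ?mul1r ?mulN1r ?opprK in hH.
    exists H; split=> //; first by rewrite lt_eqF //; lra.
    by rewrite sgE => /sign_neq.
  have N20 : 0 < 2 * N by exact: mulr_gt0.
  have hH0 : 0 < (h - H) / 2 by rewrite divr_gt0 // subr_gt0.
  have [dl [dl0 dl1 dl2]] : exists dl, [/\ 0 < dl, dl <= (h - H) / 2 & dl * (2 * N) <= e3].
    exists (Num.min ((h - H) / 2) (e3 / (2 * N))).
    by rewrite lt_min hH0 divr_gt0 // -(ler_pdivlMr _ _ N20) !ge_min !lexx orbT.
  exists (h - dl); split.
  - lra.
  - by rewrite gt_eqF //; lra.
  - by rewrite sgE => /esym/sign_neq.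
  move=> _; split; first by apply/andP; lra.
  rewrite subKr; have := mulr_gt0 dl0 N0; lra.
have [C [cC rC powC]] := pencil_circle k ab.
have lineE p : pow C p = pow S p + (h - k) * line a b p.
  by rewrite (sl_pow sl) powC -(pencil_diff a b k h p); ring.
have st := sl_steep sl.
have slopeH : `|slope a b| < H.
  by rewrite /slope normrM normfV (gtr0_norm d0) ltr_pdivrMr.
have [xv' [lab' dr']] : exists (xv' : vertex (split_twice e) -> R) lab',
    drawing (rcons cs C) (fun _ : edge (split_twice e) => false) xv' lab'.
  apply: (flat_cut dr (pc_plot pc) ab (sl_Qa sl) (sl_Qb sl) hk (sl_Sa sl) (sl_Sb sl)
     (sl_center sl) cC powC).
  - move=> p Kp Cp m hm; case: hsg => -[SU sgE]; rewrite sgE in hH.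
      have Up : pow S p <= 0 by rewrite SU; case: Kp.
      move: hm; have hk' := k1 sgE; rewrite ler_norml => /andP[m1 m2].
      apply: (@pencil_mid _ a b h k m p); last 2 first.
      + by rewrite -(sl_pow sl).
      + by rewrite -powC.
      by rewrite mul1r in hH; clear -eps m1 m2 slopeH hH hk'; apply/andP; lra.
    have Sp : 0 <= pow S p.
      by case: Kp => _; apply; move: SL; rewrite inE => /orP[/eqP|].
    have [/andP[_ kh] _] := k2 sgE.
    have l0 : line a b p <= 0.
      have kh' : 0 < h - k by rewrite subr_gt0.
      by rewrite -(pmulr_rle0 _ kh'); have := lineE p; clear -eps Sp Cp; lra.
    have mk : 0 <= k - m.
      by move: hm; rewrite ler_norml => /andP[]; clear -eps slopeH kH; lra.
    have := pencil_diff a b m k p; rewrite -powC.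
    by have := mulr_ge0_le0 mk l0; clear -eps Cp; lra.
  - move=> p Qp Sp abp; rewrite lineE Sp add0r.
    have := sl_in sl Qp Sp abp; case: hsg => -[SU sgE]; rewrite sgE.
      rewrite mul1r => lp; rewrite nmulr_rlt0 //; have := k1 sgE.
      by rewrite sgE mul1r in hH; lra.
    rewrite mulN1r oppr_gt0 => lp; rewrite pmulr_rlt0 //.
    by have [/andP[_ kh] _] := k2 sgE; rewrite subr_gt0.
  - exact: slot_small sl.
  - rewrite cC /=; move: st; rewrite ltr_norml => /andP[s1 s2].
    have : H * (b.1 - a.1) <= k * (b.1 - a.1) by rewrite ler_wpM2r // ltW.
    lra.
  - rewrite cC /=; move: st; rewrite ltr_norml => /andP[s1 s2].
    have : H * (b.1 - a.1) <= k * (b.1 - a.1) by rewrite ler_wpM2r // ltW.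
    lra.
exists C, xv', lab'; split=> //; case: hsg => -[SU sgE].
  apply: (near_addition dr pc sl hk cC rC powC SU sgE _ small1 small2 (dr_ss dr')).
  by rewrite (k1 sgE) ger0_norm //; lra.
have [k0h areaN] := k2 sgE.
apply: (far_addition dr pc sl hk cC powC SU sgE k0h _ (dr_ss dr')).
rewrite -/L; apply: le_lt_trans areaN; rewrite le_eqVlt; apply/orP; left; apply/eqP.
by rewrite NE; field; rewrite gt_eqF.
Qed.

(** With the opposite parameter [k = - H], the center of [C] is below the chord,
    and so far below that the leftmost and rightmost points of [C] are under the
    line through [a] and [b], which puts them inside the unit circle. *)
Lemma branch_addition cs (G : graph) (act : edge G -> bool) xv
    (lab : R * R -> vertex G + edge G) (e : edge G) : drawing cs act xv lab -> act e ->
  exists C xv' lab', drawing (rcons cs C) (@branch_active G e act) xv' lab' /\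
    sscc_addition eps (punctured cs) (punctured (rcons cs C)).
Proof.
move=> dr acte; have [a [Ka la Ua ga a2]] := generic_active dr acte.
have hsg : side_sign U 1 by left.
have above : 0 < 1 * (a.2 - (center U).2) by rewrite mul1r subr0.
have [xl [xr [yl [yu [yb [z [g [M [eta pc]]]]]]]]] :=
  generic_picture dr Ka la (mem_head _ _) Ua ga hsg above.
pose e1 := (sscc_dist eps (punctured cs) a)%:num.
pose e2 := (sscc_area_near eps (punctured cs) a)%:num.
have e10 : 0 < e1 by rewrite /e1; exact: gt0.
have e20 : 0 < e2 by rewrite /e2; exact: gt0.
have [H [b [h [H1 [small1 small2] sl]]]] := small_slot pc e10 e20.
have ab := sl_ab sl; have d0 : 0 < b.1 - a.1 by rewrite subr_gt0.
have hH := sl_h sl; rewrite mul1r in hH.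
pose k := - H; have hk' : h < k by rewrite /k; lra.
have hk : h != k by rewrite lt_eqF.
have kH : `|k| <= H by rewrite normrN ger0_norm //; lra.
have [C [cC rC powC]] := pencil_circle k ab.
have lineE p : pow C p = pow U p + (h - k) * line a b p.
  by rewrite (sl_pow sl) powC -(pencil_diff a b k h p); ring.
have st := sl_steep sl; have r0 := radius_gt0 C.
set dx := b.1 - a.1 in d0 st rC; set dy := b.2 - a.2 in st rC.
have tip (s : R) : s = 1 \/ s = -1 -> pow U ((center C).1 + s * radius C, (center C).2) < 0.
  move=> s1; set q := (_, _).
  have Cq : pow C q = 0 by rewrite /pow /q /=; case: s1 => ->; ring.
  have := lineE q; rewrite Cq => /eqP; rewrite eq_sym addr_eq0 => /eqP ->.
  have hk0 : h - k < 0 by rewrite subr_lt0.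
  rewrite oppr_lt0 (nmulr_rgt0 _ hk0).
  have -> : line a b q = (dx ^+ 2 + dy ^+ 2) * k / 2 - s * (radius C * dy).
    by rewrite /line /q cC /= /dx /dy; field.
  pose D := dx ^+ 2 + dy ^+ 2; rewrite -/D in rC *.
  have D0 : 0 < D by rewrite /D ltr_wpDr ?sqr_ge0 // exprn_gt0.
  have dyH : dy ^+ 2 < (H * dx) ^+ 2.
    by rewrite -(real_normK (num_real dy)) ltr_sqr ?nnegrE // mulr_ge0 ?(ltW d0) //; lra.
  have sq : `|radius C * dy| ^+ 2 < (D * H / 2) ^+ 2.
    rewrite real_normK ?num_real // exprMn rC /k sqrrN.
    have -> : (D * H / 2) ^+ 2 = D / 4 * (D * H ^+ 2) by field.
    have -> : D * (1 + H ^+ 2) / 4 * dy ^+ 2 = D / 4 * ((1 + H ^+ 2) * dy ^+ 2) by field.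
    rewrite ltr_pM2l ?divr_gt0 // /D; move: dyH; rewrite exprMn; lra.
  (* the extreme points are under the line [ab], its slope being less than [H] *)
  have DH : 0 <= D * H / 2 by rewrite divr_ge0 // mulr_ge0 ?(ltW D0) //; lra.
  move: sq; rewrite ltr_sqr ?nnegrE // ltr_norml => /andP[q1 q2].
  by rewrite /k; case: s1 => ->; lra.
have [xv' [lab' dr']] : exists xv' lab', drawing (rcons cs C) (@branch_active G e act) xv' lab'.
  apply: (branch_cut dr (pc_plot pc) (pc_yb pc erefl) ab (sl_Qa sl) (sl_Qb sl) hk
    (sl_Sa sl) (sl_Sb sl) (sl_center sl) cC powC).
  - by move=> p; exact: (slot_disk sl rC powC kH).
  - move=> p Qp Up abp; have := sl_in sl Qp Up abp; rewrite mul1r => lp.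
    by rewrite lineE Up add0r nmulr_rlt0 // subr_lt0.
  - move=> p Qp Up abp; have := sl_out sl Qp Up abp; rewrite mul1r => lp.
    by rewrite lineE Up add0r nmulr_rgt0 // subr_lt0.
  - by have := tip (-1) (or_intror erefl); rewrite mulN1r.
  - by have := tip 1 (or_introl erefl); rewrite mul1r.
exists C, xv', lab'; split=> //.
exact: (near_addition dr pc sl hk cC rC powC erefl erefl kH small1 small2 (dr_ss dr')).
Qed.

Definition disk_xv (v : bool) : R := if v then 1 else -1.
Definition disk_lab p : bool + unit :=
  if p.1 == -1 then inl false else if p.1 == 1 then inl true else inr tt.

Lemma disk_region p : closed_region [::] p <-> p.1 ^+ 2 + p.2 ^+ 2 <= 1.
Proof.
rewrite /closed_region /=; split=> [[+ _]|h]; first by rewrite pow_unit; lra.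
by split; [rewrite pow_unit; lra|].
Qed.

Lemma disk_closure : closure (open_region [::]) = @closed_region R [::].
Proof.
apply/seteqP; split=> p.
  have := @closed_region_closed R [::]; move/closure_id => ->.
  by apply: closure_subset; exact: open_region_sub.
move=> /disk_region hp B nB; have [t /andP[t0 t1] Bt] := shift_near (- p) (@ltr01 R) nB.
exists (p + t *: - p); split=> //; split=> //.
have e1 : (p + t *: - p).1 = p.1 + t * - p.1 by [].
have e2 : (p + t *: - p).2 = p.2 + t * - p.2 by [].
rewrite pow_unit e1 e2.
have -> : (p.1 + t * - p.1) ^+ 2 + (p.2 + t * - p.2) ^+ 2 - 1 =
  (1 - t) ^+ 2 * (p.1 ^+ 2 + p.2 ^+ 2) - 1 by ring.
have : (1 - t) ^+ 2 * (p.1 ^+ 2 + p.2 ^+ 2) <= (1 - t) ^+ 2 * 1 by rewrite ler_wpM2l ?sqr_ge0.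
have : (1 - t) ^+ 2 < 1 by rewrite expr_lte1 ?subr_ge0 ?ltW //; lra.
lra.
Qed.

Lemma disk_connected : connected (@open_region R [::]).
Proof.
have inD q : q.1 ^+ 2 + q.2 ^+ 2 < 1 -> open_region [::] q.
  by move=> hq; split=> //; rewrite pow_unit; lra.
apply: (@comb_connected _ _ [set q : R * R | q.2 = 0 /\ -1 < q.1 < 1]).
- have -> : [set q : R * R | q.2 = 0 /\ -1 < q.1 < 1] = (fun x => (x, 0)) @` `]-1, 1[%classic.
    apply/seteqP; split=> [[q1 q2] /= [-> hq]|q /= [x]].
      by exists q1 => //=; rewrite in_itv.
    by rewrite in_itv /= => hx <-.
  apply: connected_continuous_connected.
    exact/connected_intervalP/interval_is_interval.
  apply: continuous_subspaceT => x.
  by apply: cvg_pair_nbhs; [exact: cvg_id|exact: cvg_cst].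
- by move=> [q1 q2] /= [-> hq]; apply: inD => /=; nra.
move=> p [+ _]; rewrite pow_unit => hp.
exists [set q | q.1 = p.1 /\ Num.min p.2 0 <= q.2 <= Num.max p.2 0]; split.
- exact: vertical_connected.
- move=> [q1 q2] /= [-> ]; rewrite ge_min le_max => /andP[h1 h2]; apply: inD => /=.
  have : q2 ^+ 2 <= p.2 ^+ 2; last by lra.
  case/orP: h1 => h1; case/orP: h2 => h2; try nra.
  by have -> : q2 = p.2 by lra.
- by split=> //; rewrite ge_min lexx le_max lexx.
exists (p.1, 0); split=> /=; first by split=> //; rewrite ge_min lexx orbT le_max lexx orbT.
by split=> //; have := sqr_ge0 p.2; nra.
Qed.

Lemma disk_labP p v : disk_lab p = inl v -> p.1 = disk_xv v.
Proof. by rewrite /disk_lab; case: eqP => [E|_]; [|case: eqP => // E]; move=> -[<-]. Qed.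

Lemma disk_lab_edge p : closed_region [::] p -> disk_lab p = inr tt <-> -1 < p.1 < 1.
Proof.
move=> /disk_region hp; have s1 := sqr_ge0 p.2.
have /andP[ge le] : -1 <= p.1 <= 1 by apply/andP; nra.
rewrite /disk_lab !lt_neqAle ge le !andbT eq_sym.
by case: eqP => _; case: eqP => _.
Qed.

Lemma disk_bd p : bd (punctured [::]) p <-> pow U p = 0.
Proof.
rewrite (bd_punctured _ disk_closure); split.
  by case=> _ [S]; rewrite inE => /eqP ->.
move=> Up; split; last by exists U => //; exact: mem_head.
by split=> //; rewrite Up.
Qed.

Lemma disk_singular p : singular fst (punctured [::]) p <-> pow U p = 0 /\ p.2 = 0.
Proof.
have one S : (S \in circles (punctured [::])) = (S == U) by rewrite inE.
split.
  case=> /disk_bd Up sing; split=> //.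
  case: sing => [[S1 [S2 [ne two]]]|[S [only _ tan]]].
    case: ne; have [+ _] := (two S1).2 (or_introl erefl).
    have [+ _] := (two S2).2 (or_intror erefl).
    by rewrite !one => /eqP -> /eqP ->.
  have [+ _] := (only S).2 erefl; rewrite one => /eqP SU.
  have : - p.2 = 0; last by move/eqP; rewrite oppr_eq0 => /eqP.
  apply: (tan (- p.2, p.1)).
  by rewrite SU /tangent /dot /= /mkset !subr0; ring.
case=> Up p2; split; first exact/disk_bd.
right; exists U; split.
- move=> S; rewrite one; split=> [[/eqP]//|->].
  by split=> //; exact/circle_setP.
- apply: filterS filterT => q _; split; first by move/disk_bd/circle_setP.
  by move/circle_setP/disk_bd.
move=> v; rewrite /tangent /dot /= !subr0 p2 mul0r addr0 => /eqP.
rewrite mulf_eq0 => /orP[/eqP p1|/eqP//].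
by move: Up; rewrite pow_unit p1 p2 expr0n /= addr0 sub0r => /eqP; rewrite oppr_eq0 oner_eq0.
Qed.

Lemma disk_drawing : drawing [::] (fun _ : edge one_edge_graph => true) disk_xv disk_lab.
Proof.
have N1 : -1 != 1 :> R by apply/eqP => /esym/sign_neq.
split.
- split=> //.
  + by split; [exact: open_region_open|exact: disk_connected].
  + by move=> p /disk_bd Up; exists U; [exact: mem_head|exact/circle_setP].
  + move=> S; rewrite inE => /eqP ->; exists (1, 0); split.
      by rewrite /= disk_closure; apply/disk_region => /=; rewrite expr0n addr0 expr1n.
    by apply/circle_setP; rewrite pow_unit /= expr0n addr0 expr1n subrr.
  split=> [S1 S2|S1 S2 S3]; rewrite !inE => /eqP -> /eqP ->; rewrite ?eqxx //.
- exact: disk_closure.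
- split.
  + by case.
  + by move=> p v _; exact: disk_labP.
  + by move=> p [] Kp /(disk_lab_edge Kp) hp; rewrite /btw /= hp.
  + case; [exists (1, 0)|exists (-1, 0)]; (split;
      [by apply/disk_region; rewrite /= expr0n addr0 ?sqrrN expr1n|]).
      by rewrite /disk_lab /= eq_sym (negbTE N1) eqxx.
    by rewrite /disk_lab /= eqxx.
  + move=> [] t; rewrite /btw /= => /orP[ht|ht]; last by exfalso; lra.
    have Kt : closed_region [::] (t, 0 : R) by apply/disk_region => /=; rewrite expr0n addr0; nra.
    by exists (t, 0); split=> //; apply/(disk_lab_edge Kt).
  + move=> p q y /disk_region hp /disk_region hq _ pq /andP[py yq].
    split=> //; apply/disk_region => /=; rewrite -pq in hq.
    have [y0|y0] := leP 0 y.
      have : y ^+ 2 <= q.2 ^+ 2 by nra.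
      by lra.
    have : y ^+ 2 <= p.2 ^+ 2 by nra.
    by lra.
  + case; have -> : [set p | closed_region [::] p /\ @closed_edge one_edge_graph tt (disk_lab p)] =
        closed_region [::].
      apply/seteqP; split=> [p []//|p Kp]; split=> //.
      by rewrite /closed_edge /disk_lab; case: (p.1 == -1) => //; case: (p.1 == 1).
    exact: closed_region_closed.
- split; last by case; case.
  by move=> v; exists tt; case: v.
- move=> p /disk_singular[Up p2]; have Kp : closed_region [::] p by split; rewrite ?Up.
  rewrite /disk_lab; case: eqP => [_|n1]; first by exists false.
  case: eqP => [_|n2]; first by exists true.
  have /eqP : p.1 ^+ 2 == 1.
    by move: Up; rewrite pow_unit p2 expr0n addr0 => /eqP; rewrite subr_eq0.
  by move/eqP; rewrite sqrf_eq1 => /orP[]/eqP.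
- case; [exists (1, 0)|exists (-1, 0)]; try (apply/disk_singular; split=> //;
    by rewrite pow_unit /= expr0n addr0 ?sqrrN expr1n subrr).
    by rewrite /disk_lab /= eq_sym (negbTE N1) eqxx.
  by rewrite /disk_lab /= eqxx.
case=> _; exists (0, 1).
have K01 : closed_region [::] (0, 1 : R) by apply/disk_region; rewrite /= expr0n add0r expr1n.
split=> //=; first by apply/(disk_lab_edge K01); rewrite /= ltrN10 ltr01.
by rewrite pow_unit /= expr0n add0r expr1n subrr.
Qed.

Definition drawn (G : graph) (act : edge G -> bool) : Prop :=
  exists cs xv lab, drawing cs act xv lab /\ obtained eps (unit_disk R) (punctured cs).

Lemma procedure_tree_drawn (T : graph) : procedure_tree T ->
  drawn (fun _ : edge T => false).
Proof.
move=> hT; apply: (procedure_drawn (drawn := drawn)) hT.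
- move=> G H f act act' hact [cs [xv [lab [dr ob]]]].
  by exists cs; do 2 eexists; split; [exact: drawing_iso hact dr|].
- move=> G act e [cs [xv [lab [dr ob]]]].
  have [C [xv' [lab' [dr' ad]]]] := flat_addition e dr.
  by exists (rcons cs C), xv', lab'; split=> //; apply: obtained_step ob _; right.
- move=> G act e acte [cs [xv [lab [dr ob]]]].
  have [C [xv' [lab' [dr' ad]]]] := branch_addition dr acte.
  by exists (rcons cs C), xv', lab'; split=> //; apply: obtained_step ob _; right.
exists [::], disk_xv, disk_lab; split; first exact: disk_drawing.
by rewrite unit_disk_punctured; exact: obtained_refl.
Qed.

End Steps.

Theorem theorem1 (R : realType) (T : graph) (hT : procedure_tree T)
    (eps : smallness R) :
  exists X : ss_pair R,
    [/\ is_ss_region X,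
        obtained eps (unit_disk R) X &
        reeb_isomorphic fst X T].
Proof.
have [cs [xv [lab [dr ob]]]] := procedure_tree_drawn eps hT.
have clE : closure (dom (punctured cs)) = closed_region cs := dr_closure dr.
exists (punctured cs); split=> //; first exact: dr_ss dr.
apply: (@layout_reeb_isomorphic _ _ _ xv lab).
- by rewrite clE; exact: dr_layout dr.
- exact: dr_simple dr.
- by rewrite clE; exact: closed_region_compact.
- exact: dr_sing dr.
- exact: dr_vertex dr.
Qed.
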